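(* The problem Semiring-Connected-Dominating-Set is fixed-parameter tractable when parameterized by the clique-width $\mathbf{cw}(G)$ of the input graph $G$, assuming that a $\mathbf{cw}(G)$-expression of $G$ is given as part of the input. That is, there exist a computable function $f$ and an algorithm which, given a graph $G$ together with a $\mathbf{cw}(G)$-expression of $G$, outputs a join/union expression over the sets $(V_G,\{0,1\})$ whose semantics is exactly the set $\{\mathbf{1}^{V_G}_S : S\subseteq V_G \text{ is a connected dominating set of } G\}$, in time $f(\mathbf{cw}(G))\cdot n^{O(1)}$ where $n$ is the size of the input.
   Context: Graphs are finite and simple. For $u\in V_G$, $N_G[u]=\{v:\{u,v\}\in E_G\}\cup\{u\}$ and $N_G[U]=\bigcup_{u\in U}N_G[u]$. A connected dominating set of $G$ is $S\subseteq V_G$ with $N_G[S]=V_G$ and $G[S]$ connected. For $S\subseteq V$, $\mathbf{1}^V_S:V\to\{0,1\}$ is the indicator function of $S$. Join/union expressions over finite sets $(S,T)$ are generated by the grammar $E ::= \emptyset \mid T^{\emptyset} \mid (s\mapsto t) \mid E\uplus E \mid E\Join E$ with $(s,t)\in S\times T$; $dom(E)$ is the set of $s$ such that some leaf of $E$ is $(s\mapsto t)$. The semantics $[E]$ is either FAIL or a subset of $T^{dom(E)}$: $[\emptyset]=\emptyset$; $[T^\emptyset]=T^\emptyset$ (the set containing the unique function with empty domain); $[s\mapsto t]=\{(s\mapsto t)\}$ (the function on $\{s\}$ sending $s$ to $t$); $[E_1\uplus E_2]$ is FAIL if either $[E_i]$ is FAIL, else $[E_1]$ if $[E_2]=\emptyset$,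 else $[E_2]$ if $[E_1]=\emptyset$, else FAIL if $dom(E_1)\neq dom(E_2)$ or $[E_1]\cap[E_2]\ne\emptyset$, else $[E_1]\cup[E_2]$; $[E_1\Join E_2]$ is FAIL if either $[E_i]$ is FAIL or $dom(E_1)\cap dom(E_2)\neq\emptyset$, else $\{f_1\Join f_2: f_1\in[E_1],f_2\in[E_2]\}$, where $f_1\Join f_2$ is the function on the disjoint union of the domains agreeing with $f_1$ and $f_2$. Clique-width: a $k$-labeled graph is a graph with a labeling $l:V\to[k]$. A $k$-expression is built from: $\bullet_i$ (one vertex labeled $i\in[k]$); $\varphi_1\oplus\varphi_2$ (disjoint union); $\rho_{i\to j}(\varphi)$ ($i\ne j$, relabel all vertices of label $i$ to $j$); $\eta_{i,j}(\varphi)$ ($i\neq j$, add all edges between vertices labeled $i$ and vertices labeled $j$). $G$ has a $k$-expression if some labeling of $G$ is the graph it produces; $\mathbf{cw}(G)$ is the least such $k$.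
   Formalization: The join/union expression is output with shared subexpressions (as a directed acyclic graph whose unfolding has the stated semantics); written out in full as a tree, it cannot always have size f(cw(G))·n^{O(1)}, by lower bounds on monotone formulas for iterated matrix products. *)

(* Defs.v *)
From mathcomp Require Import all_boot.

Set Implicit Arguments.
Unset Strict Implicit.
Unset Printing Implicit Defensive.

Record sgraph (V : finType) := SGraph {
  adj :> rel V;
  adj_sym : symmetric adj;
  adj_irrefl : irreflexive adj
}.

Section Graphs.
Variables (V : finType) (G : sgraph V).

Definition closed_nbhd (u : V) : {set V} := [set v | adj G u v] :|: [set u].

Definition closed_nbhds (U : {set V}) : {set V} := \bigcup_(u in U) closed_nbhd u.

Definition induced_adj (S : {set V}) : rel V :=
  [rel u v | [&& u \in S, v \in S & adj G u v]].

(* The empty induced subgraph counts as connected; this convention is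
   immaterial below, since it never dominates a graph with a vertex. *)
Definition induced_connected (S : {set V}) : bool :=
  [forall u in S, forall v in S, connect (induced_adj S) u v].

Definition connected_dominating (S : {set V}) : bool :=
  (closed_nbhds S == [set: V]) && induced_connected S.

End Graphs.

(* Leaves carry the vertex they create, so that an expression determines a
   labeled graph on V itself and not merely up to isomorphism. *)
Inductive cwexpr (V : Type) (k : nat) : Type :=
| CwVertex of V & 'I_k
| CwUnion of cwexpr V k & cwexpr V k
| CwRelabel of 'I_k & 'I_k & cwexpr V k
| CwJoin of 'I_k & 'I_k & cwexpr V k.

Section CliqueWidth.
Variable V : finType.

(* A k-labeled graph whose vertex set is a subset of V: the vertices are the
   points where [lg_lab] is defined. *)
Record lgraph (k : nat) := LGraph {
  lg_lab : V -> option 'I_k;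
  lg_adj : rel V
}.

Definition lg_verts k (H : lgraph k) : {set V} := [set v | lg_lab H v != None].

Fixpoint cw_graph k (e : cwexpr V k) : lgraph k :=
  match e with
  | CwVertex v i =>
      LGraph (fun u => if u == v then Some i else None) (fun _ _ => false)
  | CwUnion e1 e2 =>
      let H1 := cw_graph e1 in let H2 := cw_graph e2 in
      LGraph (fun u => if lg_lab H1 u is Some i then Some i else lg_lab H2 u)
             (fun u v => lg_adj H1 u v || lg_adj H2 u v)
  | CwRelabel i j e1 =>
      let H := cw_graph e1 in
      LGraph (fun u => if lg_lab H u == Some i then Some j else lg_lab H u)
             (lg_adj H)
  | CwJoin i j e1 =>
      let H := cw_graph e1 in
      LGraph (lg_lab H)
             (fun u v => [|| lg_adj H u v,
                             (lg_lab H u == Some i) && (lg_lab H v == Some j)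
                           | (lg_lab H u == Some j) && (lg_lab H v == Some i)])
  end.

Fixpoint cw_wf k (e : cwexpr V k) : bool :=
  match e with
  | CwVertex _ _ => true
  | CwUnion e1 e2 =>
      [&& cw_wf e1, cw_wf e2
        & [disjoint lg_verts (cw_graph e1) & lg_verts (cw_graph e2)]]
  | CwRelabel i j e1 => (i != j) && cw_wf e1
  | CwJoin i j e1 => (i != j) && cw_wf e1
  end.

Definition is_kexpr_of k (e : cwexpr V k) (G : sgraph V) : Prop :=
  cw_wf e /\
  exists l : V -> 'I_k,
    (forall v, lg_lab (cw_graph e) v = Some (l v)) /\
    (forall u v, lg_adj (cw_graph e) u v = adj G u v).

Definition has_kexpr (G : sgraph V) (k : nat) : Prop :=
  exists e : cwexpr V k, is_kexpr_of e G.

Definition clique_width (G : sgraph V) (k : nat) : Prop :=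
  has_kexpr G k /\ forall j, has_kexpr G j -> k <= j.

End CliqueWidth.

Inductive juexpr (S T : Type) : Type :=
| JUEmpty
| JUUnit
| JUMap of S & T
| JUUnion of juexpr S T & juexpr S T
| JUJoin of juexpr S T & juexpr S T.

Arguments JUEmpty {S T}.
Arguments JUUnit {S T}.

Section JoinUnion.
Variables S T : finType.

(* A function on a subset of S is a finite function into [option T]; its domain
   is the set of points not sent to [None]. *)
Notation pfun := {ffun S -> option T}.

Definition pjoin (f1 f2 : pfun) : pfun :=
  [ffun x => if f1 x is Some t then Some t else f2 x].

Fixpoint ju_dom (E : juexpr S T) : {set S} :=
  match E with
  | JUEmpty | JUUnit => set0
  | JUMap s _ => [set s]
  | JUUnion E1 E2 | JUJoin E1 E2 => ju_dom E1 :|: ju_dom E2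
  end.

(* [None] is FAIL. *)
Fixpoint ju_sem (E : juexpr S T) : option {set pfun} :=
  match E with
  | JUEmpty => Some set0
  | JUUnit => Some [set [ffun=> None]]
  | JUMap s t => Some [set [ffun x => if x == s then Some t else None]]
  | JUUnion E1 E2 =>
      match ju_sem E1, ju_sem E2 with
      | Some A1, Some A2 =>
          if A2 == set0 then Some A1
          else if A1 == set0 then Some A2
          else if (ju_dom E1 != ju_dom E2) || (A1 :&: A2 != set0) then None
          else Some (A1 :|: A2)
      | _, _ => None
      end
  | JUJoin E1 E2 =>
      match ju_sem E1, ju_sem E2 with
      | Some A1, Some A2 =>
          if ju_dom E1 :&: ju_dom E2 != set0 then None
          else Some [set pjoin f1 f2 | f1 in A1, f2 in A2]
      | _, _ => None
      end
  end.

End JoinUnion.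

Definition indicator (V : finType) (A : {set V}) : {ffun V -> option bool} :=
  [ffun v => Some (v \in A)].

(** Join/union expressions are written down with shared subexpressions: a DAG is
    the list of its nodes, every node referring to earlier ones by their position,
    and the last node is the root.  (Fully expanded, an expression produced by
    dynamic programming can be exponentially larger than the computation that
    builds it.) *)

Inductive junode (S T : Type) : Type :=
| NEmpty
| NUnit
| NMap of S & T
| NUnion of nat & nat
| NJoin of nat & nat.

Arguments NEmpty {S T}.
Arguments NUnit {S T}.
Arguments NUnion {S T}.
Arguments NJoin {S T}.

Section Dag.
Variables S T : Type.

Definition node_wf (m : nat) (g : junode S T) : bool :=
  match g with
  | NUnion i j | NJoin i j => (i < m) && (j < m)
  | _ => true
  end.

Definition dag_wf (D : seq (junode S T)) : bool :=
  (0 < size D) && all (fun m => node_wf m (nth NEmpty D m)) (iota 0 (size D)).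

Definition node_expr (Es : seq (juexpr S T)) (g : junode S T) : juexpr S T :=
  match g with
  | NEmpty => JUEmpty
  | NUnit => JUUnit
  | NMap s t => JUMap s t
  | NUnion i j => JUUnion (nth JUEmpty Es i) (nth JUEmpty Es j)
  | NJoin i j => JUJoin (nth JUEmpty Es i) (nth JUEmpty Es j)
  end.

Definition dag_exprs (D : seq (junode S T)) : seq (juexpr S T) :=
  foldl (fun Es g => rcons Es (node_expr Es g)) [::] D.

Definition dag_expr (D : seq (junode S T)) : juexpr S T :=
  last JUEmpty (dag_exprs D).

End Dag.

(** The WHILE language over binary trees of N. D. Jones, "Computability and
    Complexity from a Programming Perspective", with its unit-cost time measure;
    its running times are polynomially related to those of Turing machines. *)

Inductive tree : Type := Nil | Cons of tree & tree.

Fixpoint tree_size (d : tree) : nat :=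
  match d with
  | Nil => 1
  | Cons a b => (tree_size a + tree_size b).+1
  end.

Definition tree_hd (d : tree) : tree := if d is Cons a _ then a else Nil.
Definition tree_tl (d : tree) : tree := if d is Cons _ b then b else Nil.

Inductive wexp : Type :=
| EVar of nat
| ENil
| ECons of wexp & wexp
| EHd of wexp
| ETl of wexp.

Inductive wcmd : Type :=
| CAssign of nat & wexp
| CSeq of wcmd & wcmd
| CIf of wexp & wcmd & wcmd
| CWhile of wexp & wcmd.

Definition store := nat -> tree.

Definition upd (s : store) (x : nat) (d : tree) : store :=
  fun y => if y == x then d else s y.

Fixpoint eval (s : store) (e : wexp) : tree :=
  match e with
  | EVar x => s x
  | ENil => Nil
  | ECons e1 e2 => Cons (eval s e1) (eval s e2)
  | EHd e1 => tree_hd (eval s e1)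
  | ETl e1 => tree_tl (eval s e1)
  end.

Fixpoint eval_cost (e : wexp) : nat :=
  match e with
  | EVar _ | ENil => 1
  | ECons e1 e2 => (eval_cost e1 + eval_cost e2).+1
  | EHd e1 | ETl e1 => (eval_cost e1).+1
  end.

(* [exec c s s' t]: started in store s, the command c halts in store s' after t
   steps.  As a truth value, Nil is false and every other tree is true. *)
Inductive exec : wcmd -> store -> store -> nat -> Prop :=
| ExecAssign x e s :
    exec (CAssign x e) s (upd s x (eval s e)) (eval_cost e).+1
| ExecSeq c1 c2 s s1 s2 t1 t2 :
    exec c1 s s1 t1 -> exec c2 s1 s2 t2 ->
    exec (CSeq c1 c2) s s2 (t1 + t2)
| ExecIfTrue e c1 c2 s s' t :
    eval s e <> Nil -> exec c1 s s' t ->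
    exec (CIf e c1 c2) s s' (eval_cost e + t).+1
| ExecIfFalse e c1 c2 s s' t :
    eval s e = Nil -> exec c2 s s' t ->
    exec (CIf e c1 c2) s s' (eval_cost e + t).+1
| ExecWhileTrue e c s s1 s2 t1 t2 :
    eval s e <> Nil -> exec c s s1 t1 -> exec (CWhile e c) s1 s2 t2 ->
    exec (CWhile e c) s s2 (eval_cost e + t1 + t2).+1
| ExecWhileFalse e c s :
    eval s e = Nil ->
    exec (CWhile e c) s s (eval_cost e).+1.

Definition init_store (d : tree) : store := fun x => if x == 0 then d else Nil.

(* Time to run p and to write its output out in full: without the second term,
   a tree could be exponentially larger than the number of steps building it. *)
Definition computes_in (p : wcmd) (input output : tree) (time : nat) : Prop :=
  exists s t, [/\ exec p (init_store input) s t, s 0 = output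
                & time = t + tree_size output].

(* Unary notation: vertices, labels and node positions are all bounded by the
   size of the object they occur in, so this is polynomially equivalent to binary. *)
Definition enc_nat (n : nat) : tree := iter n (Cons Nil) Nil.

Definition enc_bool (b : bool) : tree := enc_nat b.

Definition enc_seq (T : Type) (enc : T -> tree) (s : seq T) : tree :=
  foldr (fun x d => Cons (enc x) d) Nil s.

Definition enc_graph n (G : sgraph 'I_n) : tree :=
  enc_seq (fun u => enc_seq (fun v => enc_bool (adj G u v)) (enum 'I_n))
          (enum 'I_n).

Fixpoint enc_cwexpr n k (e : cwexpr 'I_n k) : tree :=
  match e with
  | CwVertex v i => Cons (enc_nat 0) (Cons (enc_nat v) (enc_nat i))
  | CwUnion e1 e2 => Cons (enc_nat 1) (Cons (enc_cwexpr e1) (enc_cwexpr e2))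
  | CwRelabel i j e1 =>
      Cons (enc_nat 2) (Cons (Cons (enc_nat i) (enc_nat j)) (enc_cwexpr e1))
  | CwJoin i j e1 =>
      Cons (enc_nat 3) (Cons (Cons (enc_nat i) (enc_nat j)) (enc_cwexpr e1))
  end.

(* An expression comes with the number k of labels over which it is written. *)
Definition enc_input n (G : sgraph 'I_n) k (e : cwexpr 'I_n k) : tree :=
  Cons (enc_graph G) (Cons (enc_nat k) (enc_cwexpr e)).

Definition enc_junode n (g : junode 'I_n bool) : tree :=
  match g with
  | NEmpty => Cons (enc_nat 0) Nil
  | NUnit => Cons (enc_nat 1) Nil
  | NMap v b => Cons (enc_nat 2) (Cons (enc_nat v) (enc_bool b))
  | NUnion i j => Cons (enc_nat 3) (Cons (enc_nat i) (enc_nat j))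
  | NJoin i j => Cons (enc_nat 4) (Cons (enc_nat i) (enc_nat j))
  end.

Definition enc_dag n (D : seq (junode 'I_n bool)) : tree :=
  enc_seq (@enc_junode n) D.

Definition computable (f : nat -> nat) : Prop :=
  exists p, forall k, exists time, computes_in p (enc_nat k) (enc_nat (f k)) time.

(* Main.v *)
Require Import Defs.
From HB Require Import structures.
From mathcomp Require Import all_boot zify.
(* Repeated because [seq] rebinds the names [Nil] and [Cons]. *)
Require Import Defs.

Set Implicit Arguments.
Unset Strict Implicit.
Unset Printing Implicit Defensive.

(** The set S is tracked through its cuts.  A colouring of a labeled graph H gives colour 1 or
    2 to the vertices of S and colour 0 or 3 to the others; it is valid if no edge joins two
    different nonzero colours.  Then S is connected and dominating iff no valid colouring uses
    colour 3 or two different nonzero colours: the classes 1 and 2 form a cut of H[S] without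
    edges, and a vertex of colour 3 is undominated.  The state of S is the set of profiles
    {(label of v, colour of v) : colour of v <> 0} of all valid colourings.  It behaves well
    under the operations: a disjoint union takes pairwise unions of profiles, a relabeling acts on
    profiles, and adding edges between labels i and j discards the profiles containing (i, c) and
    (j, d) with c <> d.  There are at most 2^2^(3k) states, so for each subexpression one tabulates,
    for each state, a join/union expression for the sets S with that state; as the state is a
    function of S, all unions are disjoint.

    Running times are bounded through a calculus of commands that run in time polynomial in a
    given measure; the measure for the algorithm is the input size times 2^2^(3k). *)

(** The obstacle is that the grammar only admits unions of disjoint families over a common domain,
    so the dynamic program may not guess: every set has to be filed under exactly one table entry.
    Guessing a cut or an undominated vertex is nondeterministic; a state therefore records the
    outcomes of all guesses at once, as in the subset construction for automata. Colour 3 is the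
    guess that a vertex outside S has no neighbour in S: vertices of S never have colour 0, so an
    edge from S to colour 3 is always forbidden. Colour 0 conflicts with nothing, which is why
    profiles omit it; the [3 * k] counts the pairs of a label and a nonzero colour. The function f
    is a threefold exponential of [C + k] because the shift [C] then absorbs the factor and the
    degree of the polynomial together with the [3 * k], and because f is computed by running one
    doubling program three times. *)

(** * Polynomial bounds in a measure *)

Definition polyO (X : Type) (P : X -> Prop) (sz g : X -> nat) : Prop :=
  exists c, forall x, P x -> g x <= c * (sz x).+1 ^ c.

Section PolyO.
Variables (X : Type) (P : X -> Prop) (sz : X -> nat).

Lemma polyO_le g h : (forall x, P x -> g x <= h x) -> polyO P sz h -> polyO P sz g.
Proof. by move=> le_gh [c hc]; exists c => x Px; apply: leq_trans (le_gh x Px) (hc x Px). Qed.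

Lemma polyO_const n : polyO P sz (fun=> n).
Proof. by exists n => x _; rewrite leq_pmulr // expn_gt0. Qed.

Lemma polyO_sz : polyO P sz sz.
Proof. by exists 1 => x _; rewrite mul1n expn1. Qed.

Lemma polyO_add g h : polyO P sz g -> polyO P sz h -> polyO P sz (fun x => g x + h x).
Proof.
move=> [c hc] [d hd]; exists (c + d) => x Px.
rewrite mulnDl; apply: leq_add.
  by apply: leq_trans (hc x Px) _; rewrite leq_mul2l leq_pexp2l ?orbT // leq_addr.
by apply: leq_trans (hd x Px) _; rewrite leq_mul2l leq_pexp2l ?orbT // leq_addl.
Qed.

Lemma polyO_mul g h : polyO P sz g -> polyO P sz h -> polyO P sz (fun x => g x * h x).
Proof.
(* One number bounds factor and degree: [c * d] covers the product of the factors, [c + d] the sum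
   of the degrees. *)
move=> [c hc] [d hd]; exists (c * d + (c + d)) => x Px.
apply: leq_trans (leq_mul (hc x Px) (hd x Px)) _.
rewrite mulnACA -expnD; apply: leq_mul; first exact: leq_addr.
by rewrite leq_pexp2l // leq_addl.
Qed.

Lemma polyO_S g : polyO P sz g -> polyO P sz (fun x => (g x).+1).
Proof.
move=> hg; apply: (polyO_le (h := fun x => g x + 1)) => [x _|]; first by rewrite addn1.
exact: polyO_add hg (polyO_const 1).
Qed.

End PolyO.

Lemma polyO_sub X (P Q : X -> Prop) sz g :
  (forall x, Q x -> P x) -> polyO P sz g -> polyO Q sz g.
Proof. by move=> QP [c hc]; exists c => x /QP; apply: hc. Qed.

Lemma polyO_reindex X Y (P : X -> Prop) (Q : Y -> Prop) sz g (h : Y -> X) :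
  (forall y, Q y -> P (h y)) -> polyO P sz g ->
  polyO Q (fun y => sz (h y)) (fun y => g (h y)).
Proof. by move=> QP [c hc]; exists c => y /QP; apply: hc. Qed.

(** * Polynomial-time computability relative to a size measure *)

(* A command computing [out x] from [inp x] in variable 0, for every [x]
   satisfying [P], in time polynomial in the measure [sz x], which need not be the
   size of the input.  Only variables up to [b] are touched, so that commands can
   be run with data saved in the higher ones. *)
Definition PTs (X : Type) (P : X -> Prop) (sz : X -> nat) (inp out : X -> tree) : Prop :=
  polyO P sz (fun x => tree_size (out x)) /\
  exists (p : wcmd) (b : nat) (T : X -> nat), polyO P sz T /\
    forall x s, P x -> s 0 = inp x ->
      exists s' t, [/\ exec p s s' t, s' 0 = out x,
                       (forall y, b < y -> s' y = s y) & t <= T x].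

(** The bound on the input is a premise, so that programs compose without restating it: [PT_comp]
    feeds the output bound of the first program to the second. *)
Definition PT (X : Type) (P : X -> Prop) (sz : X -> nat) (inp out : X -> tree) : Prop :=
  polyO P sz (fun x => tree_size (inp x)) -> PTs P sz inp out.

Lemma upd_same s x d : upd s x d x = d.
Proof. by rewrite /upd eqxx. Qed.

Lemma upd_other s x y d : y != x -> upd s x d y = s y.
Proof. by rewrite /upd => /negbTE ->. Qed.

Lemma tree_size_gt0 d : 0 < tree_size d.
Proof. by case: d. Qed.

Definition nonnil (d : tree) : bool := if d is Cons _ _ then true else false.

Lemma nonnilP d : reflect (d <> Nil) (nonnil d).
Proof. by case: d => [|a b]; constructor. Qed.

Section Combinators.
Variables (X : Type) (P : X -> Prop) (sz : X -> nat) (inp : X -> tree).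
Implicit Types (a b out : X -> tree).

Lemma PT_id : PT P sz inp inp.
Proof.
move=> Hi; split=> //; exists (CAssign 0 (EVar 0)), 0, (fun=> 2); split; first exact: polyO_const.
move=> x s Px s0; exists (upd s 0 (s 0)), 2; split=> //; first exact: (ExecAssign 0 (EVar 0)).
by case.
Qed.

Lemma PT_ext a b : (forall x, P x -> a x = b x) -> PT P sz inp a -> PT P sz inp b.
Proof.
move=> eq_ab Ha /Ha [szo [p [n [T [hT hp]]]]]; split.
  by apply: polyO_le szo => x Px; rewrite eq_ab.
by exists p, n, T; split=> // x s Px; rewrite -eq_ab //; apply: hp.
Qed.

Lemma PT_comp a b : PT P sz inp a -> PT P sz a b -> PT P sz inp b.
Proof.
move=> Ha Hb /Ha [/Hb [szb [q [m [Tq [hTq hq]]]]]] [p [n [Tp [hTp hp]]]]; split=> //.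
exists (CSeq p q), (maxn n m), (fun x => Tp x + Tq x); split; first exact: polyO_add.
move=> x s Px /(hp _ _ Px)[s1 [t1 [e1 o1 k1 l1]]].
have [s2 [t2 [e2 o2 k2 l2]]] := hq x s1 Px o1.
exists s2, (t1 + t2); split=> //; [exact: ExecSeq e1 e2 | | exact: leq_add].
by move=> y; rewrite gtn_max => /andP[y1 y2]; rewrite k2 // k1.
Qed.

Lemma PT_nil : PT P sz inp (fun=> Nil).
Proof.
move=> _; split; first exact: (polyO_const P sz 1).
exists (CAssign 0 ENil), 0, (fun=> 2); split; first exact: polyO_const.
move=> x s Px s0; exists (upd s 0 Nil), 2; split=> //; first exact: (ExecAssign 0 ENil).
by case.
Qed.

Lemma PT_hd a : PT P sz inp a -> PT P sz inp (fun x => tree_hd (a x)).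
Proof.
move=> Ha; apply: (PT_comp Ha) => sza; split.
  apply: polyO_le sza => x _; case: (a x) => //= u v; rewrite -addnS; exact: leq_addr.
exists (CAssign 0 (EHd (EVar 0))), 0, (fun=> 3); split; first exact: polyO_const.
move=> x s Px s0; exists (upd s 0 (tree_hd (s 0))), 3; split=> //.
- exact: (ExecAssign 0 (EHd (EVar 0))).
- by rewrite upd_same s0.
- by case.
Qed.

Lemma PT_tl a : PT P sz inp a -> PT P sz inp (fun x => tree_tl (a x)).
Proof.
move=> Ha; apply: (PT_comp Ha) => sza; split.
  apply: polyO_le sza => x _; case: (a x) => //= u v; rewrite -addSn; exact: leq_addl.
exists (CAssign 0 (ETl (EVar 0))), 0, (fun=> 3); split; first exact: polyO_const.
move=> x s Px s0; exists (upd s 0 (tree_tl (s 0))), 3; split=> //.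
- exact: (ExecAssign 0 (ETl (EVar 0))).
- by rewrite upd_same s0.
- by case.
Qed.

Lemma PT_cons a b :
  PT P sz inp a -> PT P sz inp b -> PT P sz inp (fun x => Cons (a x) (b x)).
Proof.
move=> Ha Hb Hi.
have [sza [p [n [Tp [hTp hp]]]]] := Ha Hi.
have [szb [q [m [Tq [hTq hq]]]]] := Hb Hi.
split; first exact: polyO_S (polyO_add sza szb).
(* Neither program touches a variable above [maxn n m]: [z] keeps the input while [p] runs, and
   [z.+1] keeps the result of [p] while [q] runs. *)
pose z := (maxn n m).+1.
exists (CSeq (CAssign z (EVar 0)) (CSeq p (CSeq (CAssign z.+1 (EVar 0))
  (CSeq (CAssign 0 (EVar z)) (CSeq q (CAssign 0 (ECons (EVar z.+1) (EVar 0)))))))).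
exists z.+1, (fun x => 2 + (Tp x + (2 + (2 + (Tq x + 4))))); split.
  by do ?[apply: polyO_add => // | exact: polyO_const].
move=> x s Px s0.
have [nz mz] : n < z /\ m < z by rewrite /z !ltnS leq_maxl leq_maxr.
have h1 : upd s z (s 0) 0 = inp x by rewrite upd_other.
have [s1 [t1 [e1 o1 k1 l1]]] := hp x _ Px h1.
pose s2 := upd s1 z.+1 (s1 0); pose s3 := upd s2 0 (s2 z).
have h3 : s3 0 = inp x.
  by rewrite /s3 upd_same /s2 upd_other ?k1 ?upd_same // neq_ltn ltnSn.
have [s4 [t4 [e4 o4 k4 l4]]] := hq x _ Px h3.
exists (upd s4 0 (Cons (s4 z.+1) (s4 0))), (2 + (t1 + (2 + (2 + (t4 + 4))))); split.
- apply: ExecSeq; first exact: (ExecAssign z (EVar 0)).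
  apply: ExecSeq; first exact: e1.
  apply: ExecSeq; first exact: (ExecAssign z.+1 (EVar 0)).
  apply: ExecSeq; first exact: (ExecAssign 0 (EVar z)).
  by apply: ExecSeq; [exact: e4 | exact: (ExecAssign 0 (ECons (EVar z.+1) (EVar 0)))].
- rewrite upd_same o4 k4 ?(ltnW mz) //; last by rewrite ltnS (ltnW mz).
  by rewrite /s3 upd_other // /s2 upd_same o1.
- move=> y yz; have y0 : y != 0 by case: y yz.
  have ny : n < y by rewrite (ltn_trans nz) // (ltn_trans _ yz).
  have my : m < y by rewrite (ltn_trans mz) // (ltn_trans _ yz).
  rewrite upd_other // k4 // /s3 upd_other // /s2 upd_other ?k1 ?upd_other //.
    by rewrite neq_ltn (ltn_trans _ yz) ?orbT.
  by rewrite neq_ltn yz orbT.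
- by rewrite !(leq_add, leq_add2l, leq_add2r).
Qed.

Lemma PT_const d : PT P sz inp (fun=> d).
Proof. by elim: d => [|u Hu v Hv]; [exact: PT_nil | exact: PT_cons]. Qed.

End Combinators.

(** A program sees only trees, so it can be moved to another index type along a relation preserving
    measure, input and output. The time bound is replaced by its polynomial, which depends on the
    measure alone. *)
Lemma PT_rel X Y (P : X -> Prop) (Q : Y -> Prop) sz sz' inp inp' out out' :
  (forall y, Q y -> exists x, [/\ P x, sz x = sz' y, inp x = inp' y & out x = out' y]) ->
  PTs P sz inp out -> PTs Q sz' inp' out'.
Proof.
move=> QP [[d szo] [p [b [T [[c hT] hp]]]]]; split.
  by exists d => y /QP[x [Px <- _ <-]]; apply: szo.
exists p, b, (fun y => c * (sz' y).+1 ^ c); split; first by exists c.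
move=> y s /QP[x [Px esz <- <-]] /(hp _ _ Px)[s' [t [e o k l]]].
by exists s', t; split=> //; rewrite -esz; apply: leq_trans l (hT _ Px).
Qed.

Lemma PT_sub X (P Q : X -> Prop) sz inp out :
  (forall x, Q x -> P x) -> PTs P sz inp out -> PTs Q sz inp out.
Proof. by move=> QP; apply: PT_rel => y Qy; exists y; split=> //; apply: QP. Qed.

(** Loop bodies receive the current element consed onto the outer input; this weakening lets a
    program written for the outer input run there. *)
Lemma PT_up X Y (P : X -> Prop) (Q : Y -> Prop) (h : Y -> X) sz inp out (d : Y -> tree) :
  polyO P sz (fun x => tree_size (inp x)) -> (forall y, Q y -> P (h y)) ->
  PT P sz inp out ->
  PT Q (fun y => sz (h y)) (fun y => Cons (d y) (inp (h y))) (fun y => out (h y)).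
Proof.
move=> Hi QP Ho; apply: (PT_comp (PT_tl (@PT_id _ _ _ _))) => _.
by apply: PT_rel (Ho Hi) => y Qy; exists (h y); split=> //; apply: QP.
Qed.

(** Each branch is required only on the inputs that reach it, so that the outcome of the test may be
    used in its analysis. *)
Lemma PT_if X (P : X -> Prop) sz inp (c : X -> bool) a b :
  PT P sz inp (fun x => enc_bool (c x)) ->
  PT (fun x => P x /\ c x) sz inp a -> PT (fun x => P x /\ ~~ c x) sz inp b ->
  PT P sz inp (fun x => if c x then a x else b x).
Proof.
move=> Hc Ha Hb Hi.
have [szc [p [n [Tp [hTp hp]]]]] := Hc Hi.
have [sza [q [m [Tq [hTq hq]]]]] := Ha (polyO_sub (fun x => @proj1 _ _) Hi).
have [szb [r [l [Tr [hTr hr]]]]] := Hb (polyO_sub (fun x => @proj1 _ _) Hi).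
have HP (g h : X -> nat) : polyO (fun x => P x /\ c x) sz g ->
    polyO (fun x => P x /\ ~~ c x) sz h -> polyO P sz (fun x => if c x then g x else h x).
  move=> [c1 h1] [c2 h2].
  apply: (polyO_le (h := fun x => c1 * (sz x).+1 ^ c1 + c2 * (sz x).+1 ^ c2)).
    move=> x Px; case: ifPn => cx.
      by apply: leq_trans (h1 x _) (leq_addr _ _).
    by apply: leq_trans (h2 x _) (leq_addl _ _).
  by apply: polyO_add; [exists c1 | exists c2].
split.
  by apply: polyO_le (HP _ _ sza szb) => x _; case: ifP.
pose z := (maxn n (maxn m l)).+1.
exists (CSeq (CAssign z (EVar 0)) (CSeq p (CSeq (CAssign z.+1 (EVar 0))
  (CSeq (CAssign 0 (EVar z)) (CIf (EVar z.+1) q r))))).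
exists z.+1, (fun x => 2 + (Tp x + (2 + (2 + (if c x then Tq x else Tr x).+2)))); split.
  have := HP _ _ hTq hTr => H.
  by do ?[apply: polyO_add => // | exact: polyO_const | apply: polyO_S].
move=> x s Px s0.
have [nz mz lz] : [/\ n < z, m < z & l < z].
  by rewrite /z !ltnS !leq_max !leqnn !orbT.
have h1 : upd s z (s 0) 0 = inp x by rewrite upd_other.
have [s1 [t1 [e1 o1 k1 l1]]] := hp x _ Px h1.
pose s2 := upd s1 z.+1 (s1 0); pose s3 := upd s2 0 (s2 z).
have h3 : s3 0 = inp x.
  by rewrite /s3 upd_same /s2 upd_other ?k1 ?upd_same // neq_ltn ltnSn.
have k3 y : z.+1 < y -> s3 y = s y.
  move=> yz; have y0 : y != 0 by case: y yz.
  have ny : n < y by rewrite (ltn_trans nz) // (ltn_trans _ yz).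
  rewrite /s3 upd_other // /s2 upd_other ?k1 ?upd_other //.
    by rewrite neq_ltn (ltn_trans _ yz) ?orbT.
  by rewrite neq_ltn yz orbT.
have c3 : eval s3 (EVar z.+1) = enc_bool (c x) by rewrite /= /s3 upd_other // /s2 upd_same.
have pre s' t : exec (CIf (EVar z.+1) q r) s3 s' t ->
   exec (CSeq (CAssign z (EVar 0)) (CSeq p (CSeq (CAssign z.+1 (EVar 0))
     (CSeq (CAssign 0 (EVar z)) (CIf (EVar z.+1) q r))))) s s' (2 + (t1 + (2 + (2 + t)))).
  move=> E.
  apply: ExecSeq; first exact: (ExecAssign z (EVar 0)).
  apply: ExecSeq; first exact: e1.
  apply: ExecSeq; first exact: (ExecAssign z.+1 (EVar 0)).
  by apply: ExecSeq E; exact: (ExecAssign 0 (EVar z)).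
case: ifPn => cx.
  have [s4 [t4 [e4 o4 k4 l4]]] := hq x _ (conj Px cx) h3.
  exists s4, (2 + (t1 + (2 + (2 + (1 + t4).+1)))); split=> //.
  - by apply/pre/ExecIfTrue; rewrite // c3 cx.
  - by move=> y yz; rewrite k4 ?k3 // (ltn_trans mz) // (ltn_trans _ yz).
  - by rewrite !add1n !(leq_add, leq_add2l, leq_add2r).
have [s4 [t4 [e4 o4 k4 l4]]] := hr x _ (conj Px cx) h3.
exists s4, (2 + (t1 + (2 + (2 + (1 + t4).+1)))); split=> //.
- by apply/pre/ExecIfFalse; rewrite // c3 (negbTE cx).
- by move=> y yz; rewrite k4 ?k3 // (ltn_trans lz) // (ltn_trans _ yz).
- by rewrite !add1n !(leq_add, leq_add2l, leq_add2r).
Qed.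

Lemma PT_ite X (P : X -> Prop) sz inp (c : X -> bool) a b :
  PT P sz inp (fun x => enc_bool (c x)) -> PT P sz inp a -> PT P sz inp b ->
  PT P sz inp (fun x => if c x then a x else b x).
Proof.
move=> Hc Ha Hb Hi; have {}Ha := Ha Hi; have {}Hb := Hb Hi; move: Hi.
by apply: PT_if Hc _ _ => _; [apply: PT_sub Ha | apply: PT_sub Hb] => x [].
Qed.

(** A stopped state is a fixed point of [step], so iterating as often as the initial potential
    allows gives the same result as stopping early. The size bound on all reachable states is a
    separate hypothesis, because a polynomial body could still double its state in every round. *)
Lemma PT_iter X (P : X -> Prop) sz inp (A : Type) (encA : X -> A -> tree)
    (step : X -> A -> A) (a0 : X -> A) (mu : X -> A -> nat) :
  let reach x a := exists i, a = iter i (step x) (a0 x) in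
  let cond x a := nonnil (tree_hd (encA x a)) in
  PT P sz inp (fun x => encA x (a0 x)) ->
  (forall x a, P x -> reach x a -> cond x a -> mu x (step x a) < mu x a) ->
  (forall x a, P x -> reach x a -> ~~ cond x a -> step x a = a) ->
  polyO P sz (fun x => mu x (a0 x)) ->
  polyO (fun y : X * A => P y.1 /\ reach y.1 y.2) (fun y => sz y.1)
        (fun y => tree_size (encA y.1 y.2)) ->
  PT (fun y : X * A => [/\ P y.1, reach y.1 y.2 & cond y.1 y.2]) (fun y => sz y.1)
     (fun y => encA y.1 y.2) (fun y => encA y.1 (step y.1 y.2)) ->
  PT P sz inp (fun x => encA x (iter (mu x (a0 x)) (step x) (a0 x))).
Proof.
move=> reach cond H0 Hmu Hstop Hn Hsz Hbody; apply: (PT_comp H0) => _.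
have [|_ [p [b [T [[c hT] hp]]]]] := Hbody.
  by apply: polyO_sub Hsz => y [].
have reachS x a : reach x a -> reach x (step x a).
  by case=> i ->; exists i.+1.
split.
  have [d hd] := Hsz; exists d => x Px.
  by apply: (hd (x, _)); split=> //=; exists (mu x (a0 x)).
exists (CWhile (EHd (EVar 0)) p), b.
exists (fun x => (mu x (a0 x)) * (3 + c * (sz x).+1 ^ c) + 3); split.
  apply: polyO_add (polyO_const _ _ _); apply: (polyO_mul Hn).
  by apply: polyO_add (polyO_const _ _ _) _; exists c.
have fixa x m a : P x -> reach x a -> ~~ cond x a -> iter m (step x) a = a.
  by move=> Px ra na; elim: m => //= m ->; exact: Hstop.
move=> x s Px; suff: forall n a s, mu x a <= n -> reach x a -> s 0 = encA x a ->
    exists s' t, [/\ exec (CWhile (EHd (EVar 0)) p) s s' t,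
      s' 0 = encA x (iter n (step x) a), (forall y, b < y -> s' y = s y)
      & t <= n * (3 + c * (sz x).+1 ^ c) + 3].
  by apply=> //; exists 0.
elim=> {s} [|n IHn] a s le_n ra s0.
  have nc : ~~ cond x a by apply/negP => /(Hmu x a Px ra); lia.
  exists s, 3; split; rewrite ?leq_addl //.
  apply: (ExecWhileFalse (e := EHd (EVar 0))); rewrite /= s0.
  by move: nc; rewrite /cond; case: (tree_hd _).
have [ca|nc] := boolP (cond x a); last first.
  exists s, 3; split; rewrite ?fixa ?leq_addl //.
  apply: (ExecWhileFalse (e := EHd (EVar 0))); rewrite /= s0.
  by move: nc; rewrite /cond; case: (tree_hd _).
have Pc : [/\ P (x, a).1, reach (x, a).1 (x, a).2 & cond (x, a).1 (x, a).2] by [].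
have [s1 [t1 [e1 o1 k1 l1]]] := hp (x, a) s Pc s0.
have lt_mu := Hmu x a Px ra ca.
have [|s2 [t2 [e2 o2 k2 l2]]] := IHn (step x a) s1 _ (reachS _ _ ra) o1; first lia.
exists s2, (2 + t1 + t2).+1; split.
- apply: (ExecWhileTrue (e := EHd (EVar 0)) _ e1 e2); rewrite /= s0; exact/nonnilP.
- by rewrite iterSr.
- by move=> y yb; rewrite k2 ?k1.
- have /= := hT _ Pc; rewrite mulSn; lia.
Qed.

(** * List functions *)

Fixpoint tree_eqb (a b : tree) : bool :=
  match a, b with
  | Nil, Nil => true
  | Cons a1 a2, Cons b1 b2 => tree_eqb a1 b1 && tree_eqb a2 b2
  | _, _ => false
  end.

Lemma tree_eqP : Equality.axiom tree_eqb.
Proof.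
move=> a b; apply: (iffP idP) => [|<-]; last by elim: a => //= u -> v ->.
by elim: a b => [|u IHu v IHv] [|u' v'] //= /andP[/IHu-> /IHv->].
Qed.

HB.instance Definition _ := hasDecEq.Build tree tree_eqP.

Lemma enc_nat_inj : injective enc_nat.
Proof. by elim=> [|m IHm] [|n] //= [/IHm->]. Qed.

Lemma enc_seq_inj T (enc : T -> tree) : injective enc -> injective (enc_seq enc).
Proof. by move=> injT; elim=> [|a s IHs] [|b t] //= [/injT-> /IHs->]. Qed.

Lemma tree_size_enc_nat n : tree_size (enc_nat n) = n.*2.+1.
Proof. by elim: n => //= n ->; lia. Qed.

Lemma enc_nat_seq n : enc_nat n = enc_seq id (nseq n Nil).
Proof. by elim: n => //= n ->. Qed.

Section EncSeq.
Variables (T : Type) (enc : T -> tree).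

Lemma nonnil_enc_seq l : nonnil (enc_seq enc l) = ~~ nilp l.
Proof. by case: l. Qed.

Lemma tree_size_cat l1 l2 :
  (tree_size (enc_seq enc (l1 ++ l2))).+1 = tree_size (enc_seq enc l1) + tree_size (enc_seq enc l2).
Proof. by elim: l1 => //= a l1; lia. Qed.

Lemma tree_size_rev l : tree_size (enc_seq enc (rev l)) = tree_size (enc_seq enc l).
Proof.
elim: l => //= a l IHl; rewrite rev_cons -cats1.
by have := tree_size_cat (rev l) [:: a]; rewrite /=; lia.
Qed.

Lemma size_enc_seq l : size l < tree_size (enc_seq enc l).
Proof. by elim: l => //= a l; lia. Qed.

Lemma tree_size_In a l : List.In a l -> tree_size (enc a) < tree_size (enc_seq enc l).
Proof. by elim: l => //= b l IHl [->|/IHl]; lia. Qed.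

Lemma tree_size_prefix l1 l2 : tree_size (enc_seq enc l1) <= tree_size (enc_seq enc (l1 ++ l2)).
Proof. by have := tree_size_cat l1 l2; have := tree_size_gt0 (enc_seq enc l2); lia. Qed.

Lemma tree_size_seq_le l B :
  (forall a, List.In a l -> tree_size (enc a) <= B) ->
  tree_size (enc_seq enc l) <= size l * B.+1 + 1.
Proof.
elim: l => //= a l IHl H; have := H a (or_introl erefl).
have := IHl (fun b bl => H b (or_intror bl)); rewrite mulSn; lia.
Qed.

End EncSeq.

(** The loop state holds the remaining list, the accumulator and the input. Size bound and body are
    required only for accumulators arising from a prefix of the list, so that invariants of the fold
    can be used to prove them. *)
Lemma PT_foldl X (P : X -> Prop) sz inp (E A : Type) (encE : E -> tree) (encA : A -> tree)
    (l : X -> seq E) (a0 : X -> A) (step : X -> A -> E -> A) :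
  PT P sz inp (fun x => enc_seq encE (l x)) -> PT P sz inp (fun x => encA (a0 x)) ->
  polyO (fun y : X * seq E => P y.1 /\ exists l2, l y.1 = y.2 ++ l2) (fun y => sz y.1)
    (fun y => tree_size (encA (foldl (step y.1) (a0 y.1) y.2))) ->
  PT (fun y : X * (A * E) => P y.1 /\ exists l1 l2, l y.1 = l1 ++ y.2.2 :: l2 /\
         y.2.1 = foldl (step y.1) (a0 y.1) l1)
     (fun y => sz y.1)
     (fun y => Cons (encE y.2.2) (Cons (encA y.2.1) (inp y.1)))
     (fun y => encA (step y.1 y.2.1 y.2.2)) ->
  PT P sz inp (fun x => encA (foldl (step x) (a0 x) (l x))).
Proof.
move=> Hl Ha Hsz Hbody Hi.
pose encS x (la : seq E * A) := Cons (enc_seq encE la.1) (Cons (encA la.2) (inp x)).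
pose st x (la : seq E * A) := if la.1 is e :: l' then (l', step x la.2 e) else la.
have iterE x l1 l2 a : iter (size l1) (st x) (l1 ++ l2, a) = (l2, foldl (step x) a l1).
  by elim: l1 a => //= e l1 IHl a; rewrite -iterS iterSr /= IHl.
have [szl _] := Hl Hi.
have reachP x (la : seq E * A) : P x ->
    (exists i, la = iter i (st x) (l x, a0 x)) ->
    exists2 l1, l x = l1 ++ la.1 & la.2 = foldl (step x) (a0 x) l1.
  move=> Px [i ->]; elim: i => [|i [l1 E1 E2]]; first by exists [::].
  rewrite iterS; case: (iter i _ _) E1 E2 => -[|e l'] a /= E1 E2.
    by exists l1.
  by exists (rcons l1 e); rewrite ?cat_rcons // foldl_rcons E2.
suff H : PT P sz inp (fun x => encS x (iter (size (l x)) (st x) (l x, a0 x))).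
  apply: PT_ext (PT_hd (PT_tl H)) Hi => x Px /=.
  by have := iterE x (l x) [::] (a0 x); rewrite cats0 => ->.
apply: (@PT_iter _ P sz inp _ encS st (fun x => (l x, a0 x)) (fun x la => size la.1)).
- by apply: PT_cons Hl _; apply: PT_cons Ha _; exact: PT_id.
- by move=> x [[|e l'] a].
- by move=> x [[|e l'] a].
- by apply: polyO_le szl => x _; apply/ltnW/size_enc_seq.
- have [c2 h2] := Hsz.
  pose B (x : X) := tree_size (enc_seq encE (l x)) + (c2 * (sz x).+1 ^ c2 + tree_size (inp x)).+1.
  apply: (polyO_le (h := fun y => (B y.1).+1)).
    move=> [x [l' a]] /= [Px /(reachP _ _ Px)[l1 /= El ->]].
    have := h2 (x, l1) (conj Px (ex_intro _ l' El)).
    have := tree_size_cat encE l1 l'; rewrite -El /B /=.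
    have := tree_size_gt0 (enc_seq encE l1); lia.
  apply: polyO_S; apply: (polyO_reindex (P := P)) => [y []//|].
  apply: polyO_add => //; apply: polyO_S; apply: polyO_add => //; by exists c2.
- move=> HY.
  have HB : PTs (fun y : X * (A * E) => P y.1 /\ exists l1 l2, l y.1 = l1 ++ y.2.2 :: l2 /\
         y.2.1 = foldl (step y.1) (a0 y.1) l1) (fun y => sz y.1)
     (fun y => Cons (encE y.2.2) (Cons (encA y.2.1) (inp y.1)))
     (fun y => encA (step y.1 y.2.1 y.2.2)).
    apply: Hbody; have [c hc] := HY; exists c => -[x [a e]] /= [Px [l1 [l2 [El Ea]]]].
    apply: leq_trans (hc (x, (e :: l2, a)) _).
      by rewrite /=; have := tree_size_gt0 (enc_seq encE l2); lia.
    by split=> //; exists (size l1); rewrite /= El iterE Ea.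
  have Hs : PT (fun y : X * (seq E * A) => [/\ P y.1, exists i, y.2 = iter i (st y.1) (l y.1, a0 y.1)
      & nonnil (tree_hd (encS y.1 y.2))]) (fun y => sz y.1) (fun y => encS y.1 y.2)
      (fun y => encA (st y.1 y.2).2).
    apply: (PT_comp (a := fun y => Cons (tree_hd (enc_seq encE y.2.1)) (Cons (encA y.2.2) (inp y.1)))).
      exact: PT_cons (PT_hd (PT_hd (@PT_id _ _ _ _))) (PT_tl (@PT_id _ _ _ _)).
    move=> _; apply: PT_rel HB => -[x [[|e l'] a]] [] //= Px /(reachP _ _ Px)[l1 /= El ->] _.
    exists (x, (foldl (step x) (a0 x) l1, e)); split=> //=; split=> //.
    by exists l1, l'.
  apply: PT_ext (PT_cons (PT_tl (PT_hd (@PT_id _ _ _ _))) (PT_cons Hs (PT_tl (PT_tl (@PT_id _ _ _ _))))) HY.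
  by move=> [x [[|e l'] a]] [].
Qed.

Section ListFunctions.
Variables (X : Type) (P : X -> Prop) (sz : X -> nat) (inp : X -> tree).
Variables (E : Type) (encE : E -> tree).

(** Consing in a loop reverses the list, which makes this the primitive from which reversal and
    concatenation follow. *)
Lemma PT_catrev (l m : X -> seq E) :
  PT P sz inp (fun x => enc_seq encE (l x)) -> PT P sz inp (fun x => enc_seq encE (m x)) ->
  PT P sz inp (fun x => enc_seq encE (catrev (l x) (m x))).
Proof.
move=> Hl Hm Hi; have [szl _] := Hl Hi; have [szm _] := Hm Hi; move: Hi.
have foldE (s t : seq E) : foldl (fun a e => e :: a) t s = catrev s t.
  by elim: s t => //= e s IHs t; rewrite IHs.
apply: (@PT_ext _ _ _ _ (fun x => enc_seq encE (foldl (fun a e => e :: a) (m x) (l x)))).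
  by move=> x _; rewrite foldE.
apply: (@PT_foldl _ P sz inp E _ encE _ l m (fun _ a e => e :: a)) => //.
  apply: (polyO_le (h := fun y => tree_size (enc_seq encE (l y.1)) + tree_size (enc_seq encE (m y.1)))).
    move=> [x l1] /= [Px [l2 El]]; rewrite foldE catrevE.
    have := tree_size_cat encE (rev l1) (m x); rewrite tree_size_rev El.
    by have := tree_size_prefix encE l1 l2; lia.
  by apply: (polyO_reindex (P := P)) (polyO_add szl szm) => y [].
exact: PT_cons (PT_hd (@PT_id _ _ _ _)) (PT_hd (PT_tl (@PT_id _ _ _ _))).
Qed.

Lemma PT_rev (l : X -> seq E) :
  PT P sz inp (fun x => enc_seq encE (l x)) -> PT P sz inp (fun x => enc_seq encE (rev (l x))).
Proof. by move=> Hl; apply: PT_catrev Hl _; exact: PT_nil. Qed.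

Lemma PT_cat (l m : X -> seq E) :
  PT P sz inp (fun x => enc_seq encE (l x)) -> PT P sz inp (fun x => enc_seq encE (m x)) ->
  PT P sz inp (fun x => enc_seq encE (l x ++ m x)).
Proof.
move=> Hl Hm; apply: PT_ext (PT_catrev (PT_rev Hl) Hm) => x _.
by rewrite catrevE revK.
Qed.

Lemma PT_size (l : X -> seq E) :
  PT P sz inp (fun x => enc_seq encE (l x)) -> PT P sz inp (fun x => enc_nat (size (l x))).
Proof.
move=> Hl Hi; have [szl _] := Hl Hi; move: Hi.
have foldE n (s : seq E) : foldl (fun n _ => n.+1) n s = n + size s.
  by elim: s n => [|e s IHs] n /=; rewrite ?addn0 // IHs addSnnS.
apply: (@PT_ext _ _ _ _ (fun x => enc_nat (foldl (fun n _ => n.+1) 0 (l x)))).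
  by move=> x _; rewrite foldE.
apply: (@PT_foldl _ P sz inp E _ encE _ l (fun=> 0) (fun _ n _ => n.+1)) => //.
- exact: PT_nil.
- apply: (polyO_le (h := fun y => 2 * tree_size (enc_seq encE (l y.1)))).
    move=> [x l1] /= [Px [l2 El]]; rewrite foldE tree_size_enc_nat add0n.
    have := tree_size_prefix encE l1 l2; rewrite -El.
    by have := size_enc_seq encE l1; lia.
  by apply: (polyO_reindex (P := P)) (polyO_mul (polyO_const _ _ _) szl) => y [].
- exact: PT_cons (@PT_nil _ _ _ _) (PT_hd (PT_tl (@PT_id _ _ _ _))).
Qed.

End ListFunctions.

(** The index set for the body of a loop over [l]. [List.In] is used because the elements need not
    have decidable equality. *)
Definition elt_of (X : Type) (P : X -> Prop) (E : Type) (l : X -> seq E) (y : X * E) : Prop :=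
  P y.1 /\ List.In y.2 (l y.1).

Section MoreListFunctions.
Variables (X : Type) (P : X -> Prop) (sz : X -> nat) (inp : X -> tree).
Variables (E : Type) (encE : E -> tree).

Lemma polyO_elt (l : X -> seq E) :
  polyO P sz (fun x => tree_size (inp x)) -> PT P sz inp (fun x => enc_seq encE (l x)) ->
  polyO (elt_of P l) (fun y => sz y.1) (fun y => tree_size (Cons (encE y.2) (inp y.1))).
Proof.
move=> Hi Hl; have [szl _] := Hl Hi.
apply: (polyO_le (h := fun y => (tree_size (enc_seq encE (l y.1)) + tree_size (inp y.1)).+1)).
  by move=> [x e] /= [Px /(tree_size_In encE)]; rewrite /=; lia.
by apply: polyO_S; apply: (polyO_reindex (P := P)) (polyO_add szl Hi) => y [].
Qed.

Lemma PT_pmap (F : Type) (encF : F -> tree) (l : X -> seq E) (q : X -> E -> bool) (f : X -> E -> F) :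
  PT P sz inp (fun x => enc_seq encE (l x)) ->
  PT (elt_of P l) (fun y => sz y.1) (fun y => Cons (encE y.2) (inp y.1))
     (fun y => enc_bool (q y.1 y.2)) ->
  PT (elt_of P l) (fun y => sz y.1) (fun y => Cons (encE y.2) (inp y.1))
     (fun y => encF (f y.1 y.2)) ->
  PT P sz inp (fun x => enc_seq encF [seq f x e | e <- l x & q x e]).
Proof.
move=> Hl Hq Hf Hi; have [szl _] := Hl Hi.
have szb := polyO_elt Hi Hl.
have {}Hq := Hq szb; have {}Hf := Hf szb; have [[c hc] _] := Hf.
pose st x a e := if q x e then f x e :: a else a.
have foldE x (a : seq F) s : foldl (st x) a s = catrev [seq f x e | e <- s & q x e] a.
  by elim: s a => //= e s IHs a; rewrite IHs /st; case: ifP.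
have H : PT P sz inp (fun x => enc_seq encF (foldl (st x) [::] (l x))).
  apply: (PT_foldl (a0 := fun=> [::]) Hl); first exact: PT_nil.
    apply: (polyO_le (h := fun y => tree_size (enc_seq encE (l y.1)) * (c * (sz y.1).+1 ^ c).+1 + 1)).
      move=> [x l1] /= [Px [l2 El]]; rewrite foldE catrevE cats0 tree_size_rev.
      apply: leq_trans (tree_size_seq_le (B := c * (sz x).+1 ^ c) _) _.
        move=> a /List.in_map_iff[e [<-]] /List.filter_In[el1 _].
        by apply: (hc (x, e)); split=> //=; rewrite El; apply/List.in_or_app; left.
      rewrite leq_add2r leq_mul2r /= size_map; apply: leq_trans (_ : size l1 <= _).
        by rewrite size_filter count_size.
      by rewrite El; apply: leq_trans (tree_size_prefix encE l1 l2); apply/ltnW/size_enc_seq.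
    apply: (polyO_reindex (P := P) (h := fst)
      (g := fun x => tree_size (enc_seq encE (l x)) * (c * (sz x).+1 ^ c).+1 + 1)) => [y []//|].
    by apply: polyO_add (polyO_const _ _ _); apply: polyO_mul => //; apply: polyO_S; exists c.
  set Q := fun y : _ * (_ * _) => _.
  have QE y : Q y -> elt_of P l (y.1, y.2.2).
    move=> [Py [l1 [l2 [El _]]]]; split=> //=; rewrite El.
    by apply/List.in_or_app; right; left.
  have env : PT Q (fun y => sz y.1) (fun y => Cons (encE y.2.2) (Cons (enc_seq encF y.2.1) (inp y.1)))
     (fun y => Cons (encE y.2.2) (inp y.1)).
    exact: PT_cons (PT_hd (@PT_id _ _ _ _)) (PT_tl (PT_tl (@PT_id _ _ _ _))).
  apply: PT_ext (PT_if (c := fun y => q y.1 y.2.2) (a := fun y => enc_seq encF (f y.1 y.2.2 :: y.2.1))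
    (b := fun y => enc_seq encF y.2.1) _ _ _).
  - by move=> y _; rewrite /st; case: ifP.
  - by apply: (PT_comp env) => _; apply: PT_rel Hq => y /QE Qy; exists (y.1, y.2.2).
  - apply: PT_cons; last exact: PT_hd (PT_tl (@PT_id _ _ _ _)).
    apply: (@PT_comp _ _ _ _ (fun y => Cons (encE y.2.2) (inp y.1))).
      exact: PT_cons (PT_hd (@PT_id _ _ _ _)) (PT_tl (PT_tl (@PT_id _ _ _ _))).
    by move=> _; apply: PT_rel Hf => y [/QE Qy _]; exists (y.1, y.2.2).
  - exact: PT_hd (PT_tl (@PT_id _ _ _ _)).
by apply: (PT_ext _ (PT_rev H)) Hi => x _; rewrite foldE catrevE cats0 revK.
Qed.

Lemma PT_map (F : Type) (encF : F -> tree) (l : X -> seq E) (f : X -> E -> F) :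
  PT P sz inp (fun x => enc_seq encE (l x)) ->
  PT (elt_of P l) (fun y => sz y.1) (fun y => Cons (encE y.2) (inp y.1))
     (fun y => encF (f y.1 y.2)) ->
  PT P sz inp (fun x => enc_seq encF [seq f x e | e <- l x]).
Proof.
move=> Hl Hf; apply: PT_ext (PT_pmap (q := fun _ _ => true) Hl _ Hf); last exact: PT_const.
by move=> x _; rewrite filter_predT.
Qed.

Lemma PT_filter (l : X -> seq E) (q : X -> E -> bool) :
  PT P sz inp (fun x => enc_seq encE (l x)) ->
  PT (elt_of P l) (fun y => sz y.1) (fun y => Cons (encE y.2) (inp y.1))
     (fun y => enc_bool (q y.1 y.2)) ->
  PT P sz inp (fun x => enc_seq encE [seq e <- l x | q x e]).
Proof.
move=> Hl Hq; apply: PT_ext (PT_pmap (encF := encE) (f := fun _ e => e) Hl Hq _).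
  by move=> x _; rewrite map_id.
exact: PT_hd (@PT_id _ _ _ _).
Qed.

Lemma PT_nonnil (a : X -> tree) :
  PT P sz inp a -> PT P sz inp (fun x => enc_bool (nonnil (a x))).
Proof.
move=> Ha; apply: (PT_comp Ha) => sza; split.
  by apply: (polyO_le (h := fun=> 3)) (polyO_const _ _ _) => x _; case: nonnil.
exists (CIf (EVar 0) (CAssign 0 (ECons ENil ENil)) (CAssign 0 ENil)), 0, (fun=> 9).
split; first exact: polyO_const.
move=> x s Px s0; case: (a x) s0 => [|u v] /= s0.
  exists (upd s 0 Nil), (1 + 2).+1; split=> //.
    by apply: ExecIfFalse => //; exact: (ExecAssign 0 ENil).
  by case.
exists (upd s 0 (Cons Nil Nil)), (1 + 4).+1; split=> //.
  by apply: ExecIfTrue; rewrite /= ?s0 //; exact: (ExecAssign 0 (ECons ENil ENil)).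
by case.
Qed.

Lemma PT_neg (b : X -> bool) :
  PT P sz inp (fun x => enc_bool (b x)) -> PT P sz inp (fun x => enc_bool (~~ b x)).
Proof.
move=> Hb; apply: PT_ext (PT_if (a := fun=> enc_bool false) (b := fun=> enc_bool true) Hb _ _).
- by move=> x _; case: (b x).
- exact: PT_const.
- exact: PT_const.
Qed.

Lemma PT_nilp (l : X -> seq E) :
  PT P sz inp (fun x => enc_seq encE (l x)) -> PT P sz inp (fun x => enc_bool (nilp (l x))).
Proof.
by move=> Hl; apply: PT_ext (PT_neg (PT_nonnil Hl)) => x _; rewrite nonnil_enc_seq negbK.
Qed.

Lemma PT_and (b c : X -> bool) :
  PT P sz inp (fun x => enc_bool (b x)) -> PT (fun x => P x /\ b x) sz inp (fun x => enc_bool (c x)) ->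
  PT P sz inp (fun x => enc_bool (b x && c x)).
Proof.
move=> Hb Hc; apply: PT_ext (PT_if (b := fun=> enc_bool false) Hb Hc _).
- by move=> x _; case: (b x).
- exact: PT_const.
Qed.

End MoreListFunctions.

Section ListPredicates.
Variables (X : Type) (P : X -> Prop) (sz : X -> nat) (inp : X -> tree).
Variables (E : Type) (encE : E -> tree).

Lemma PT_has (l : X -> seq E) (q : X -> E -> bool) :
  PT P sz inp (fun x => enc_seq encE (l x)) ->
  PT (elt_of P l) (fun y => sz y.1) (fun y => Cons (encE y.2) (inp y.1))
     (fun y => enc_bool (q y.1 y.2)) ->
  PT P sz inp (fun x => enc_bool (has (q x) (l x))).
Proof.
move=> Hl Hq; apply: (PT_ext _ (PT_neg (PT_nilp (PT_filter Hl Hq)))) => x _.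
by rewrite /nilp size_filter has_count lt0n.
Qed.

Lemma PT_all (l : X -> seq E) (q : X -> E -> bool) :
  PT P sz inp (fun x => enc_seq encE (l x)) ->
  PT (elt_of P l) (fun y => sz y.1) (fun y => Cons (encE y.2) (inp y.1))
     (fun y => enc_bool (q y.1 y.2)) ->
  PT P sz inp (fun x => enc_bool (all (q x) (l x))).
Proof.
move=> Hl Hq; apply: PT_ext (PT_neg (PT_has (q := fun x e => ~~ q x e) Hl (PT_neg Hq))) => x _.
by congr enc_bool; rewrite -[RHS]negbK -has_predC.
Qed.

End ListPredicates.

(** * Equality tests and power sets *)

Definition enc_pair (A B : Type) (encA : A -> tree) (encB : B -> tree) (p : A * B) : tree :=
  Cons (encA p.1) (encB p.2).

(** Finds, by trying all of them, a sequence of at most [n] head and tail projections that reads the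
    goal off the input. *)
Ltac pt_path t n :=
  first [ exact t
        | lazymatch n with
          | S ?m => first [pt_path uconstr:(PT_hd t) m | pt_path uconstr:(PT_tl t) m]
          end ].

Ltac pt_solve n := pt_path uconstr:(@PT_id _ _ _ _) n.

Section TreeEquality.

(** The language only tests for [Nil], so equality of trees is itself a loop, over a list of pairs
    still to be compared. A mismatch empties the list and records [false]. *)
Definition eq_step (st : seq (tree * tree) * bool) : seq (tree * tree) * bool :=
  match st.1 with
  | [::] => st
  | (Nil, Nil) :: s => (s, st.2)
  | (Cons a1 a2, Cons b1 b2) :: s => ((a1, b1) :: (a2, b2) :: s, st.2)
  | _ :: _ => ([::], false)
  end.

Let val (st : seq (tree * tree) * bool) := st.2 && all (fun p => p.1 == p.2) st.1.
Let mu (st : seq (tree * tree) * bool) := sumn [seq tree_size p.1 | p <- st.1].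
Let encS (st : seq (tree * tree) * bool) :=
  Cons (enc_seq (enc_pair id id) st.1) (enc_bool st.2).

Lemma eq_step_val st : val (eq_step st) = val st.
Proof.
case: st => -[|[[|a1 a2] [|b1 b2]] s] r //=; rewrite /val /= ?andbF //.
by rewrite -[Cons a1 a2 == _]/((a1 == b1) && (a2 == b2)) -!andbA.
Qed.

(** The first components suffice as potential, since every step removes at least the root of the
    first member of the leading pair. *)
Lemma eq_step_mu st : ~~ nilp st.1 -> mu (eq_step st) < mu st.
Proof. by case: st => -[|[[|a1 a2] [|b1 b2]] s] r //= _; rewrite /mu /=; lia. Qed.

Lemma eq_step_size st : tree_size (enc_seq (enc_pair id id) (eq_step st).1)
  <= tree_size (enc_seq (enc_pair id id) st.1).
Proof. by case: st => -[|[[|a1 a2] [|b1 b2]] s] r //=; lia. Qed.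

Lemma iter_eq_step a b :
  (iter (tree_size a) eq_step ([:: (a, b)], true)).2 = (a == b).
Proof.
have Hval n st : val (iter n eq_step st) = val st.
  by elim: n => //= n <-; rewrite eq_step_val.
have Hstop n st : mu st <= n -> nilp (iter n eq_step st).1.
  elim: n st => [|n IHn] st le_n.
    by case: (boolP (nilp st.1)) => // /eq_step_mu; lia.
  rewrite iterSr; have [nst|/eq_step_mu] := boolP (nilp st.1); last by move=> ?; apply: IHn; lia.
  have fixst : eq_step st = st by case: st nst {le_n} => -[].
  by rewrite fixst; elim: n {IHn le_n} => //= n IHn; case: (iter _ _ _) IHn => -[].
have := Hval (tree_size a) ([:: (a, b)], true); rewrite {2}/val /= andbT => <-.
have /Hstop : mu ([:: (a, b)], true) <= tree_size a by rewrite /mu /= addn0.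
by rewrite /val; case: (iter _ _ _) => -[] //= r; rewrite andbT.
Qed.

Lemma PT_eqtree X (P : X -> Prop) sz inp (a b : X -> tree) :
  PT P sz inp a -> PT P sz inp b -> PT P sz inp (fun x => enc_bool (a x == b x)).
Proof.
move=> Ha Hb Hi; have [sza _] := Ha Hi; have [szb _] := Hb Hi; move: Hi.
have H : PT P sz inp (fun x => encS (iter (mu ([:: (a x, b x)], true)) eq_step ([:: (a x, b x)], true))).
  apply: (@PT_iter _ P sz inp _ (fun=> encS) (fun=> eq_step) (fun x => ([:: (a x, b x)], true)) (fun=> mu)).
  - apply: PT_cons; last exact: PT_const.
    by apply: PT_cons; [exact: PT_cons | exact: PT_nil].
  - by move=> x st _ _ /=; rewrite nonnil_enc_seq; apply: eq_step_mu.
  - by move=> x st _ _ /=; rewrite nonnil_enc_seq negbK; case: st => -[].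
  - by apply: polyO_le sza => x _; rewrite /mu /= addn0.
  - apply: (polyO_le (h := fun y => (tree_size (a y.1) + tree_size (b y.1) + 7))).
      move=> [x st] /= [_ [i ->]].
      have /= : tree_size (enc_seq (enc_pair id id) (iter i eq_step ([:: (a x, b x)], true)).1)
         <= tree_size (enc_seq (enc_pair id id) [:: (a x, b x)]).
        by elim: i => //= i IHi; apply: leq_trans (eq_step_size _) IHi.
      by case: (iter _ _ _).2; rewrite /=; lia.
    apply: polyO_add (polyO_const _ _ _).
    by apply: (polyO_reindex (P := P)) (polyO_add sza szb) => y [].
  pose Q := fun y : X * (seq (tree * tree) * bool) => [/\ P y.1, 
     exists i, y.2 = iter i eq_step ([:: (a y.1, b y.1)], true) & nonnil (tree_hd (encS y.2))].
  rewrite -/Q.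
  pose hh y : tree := tree_hd (tree_hd (encS (y : X * (seq (tree * tree) * bool)).2)).
  have P1 R : PT R (fun y => sz y.1) (fun y => encS y.2) (fun y => tree_hd (hh y)).
    by do 3 apply: PT_hd; exact: PT_id.
  have P2 R : PT R (fun y => sz y.1) (fun y => encS y.2) (fun y => tree_tl (hh y)).
    by apply: PT_tl; do 2 apply: PT_hd; exact: PT_id.
  have P3 R : PT R (fun y => sz y.1) (fun y => encS y.2) (fun y => tree_tl (tree_hd (encS y.2))).
    by apply: PT_tl; apply: PT_hd; exact: PT_id.
  have P4 R : PT R (fun y => sz y.1) (fun y => encS y.2) (fun y => tree_tl (encS y.2)).
    by apply: PT_tl; exact: PT_id.
  apply: PT_ext (PT_if (c := fun y => nonnil (tree_hd (hh y)))
     (a := fun y => if nonnil (tree_tl (hh y)) then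
        Cons (Cons (Cons (tree_hd (tree_hd (hh y))) (tree_hd (tree_tl (hh y))))
              (Cons (Cons (tree_tl (tree_hd (hh y))) (tree_tl (tree_tl (hh y))))
                    (tree_tl (tree_hd (encS y.2))))) (tree_tl (encS y.2))
        else Cons Nil Nil)
     (b := fun y => if nonnil (tree_tl (hh y)) then Cons Nil Nil
        else Cons (tree_tl (tree_hd (encS y.2))) (tree_tl (encS y.2))) _ _ _).
  - by move=> [x [[|[[|a1 a2] [|b1 b2]] s] r]] [].
  - exact/PT_nonnil/P1.
  - apply: PT_if; first exact/PT_nonnil/P2.
      apply: (PT_cons _ (P4 _)); apply: (PT_cons (PT_cons (PT_hd (P1 _)) (PT_hd (P2 _)))).
      exact: PT_cons (PT_cons (PT_tl (P1 _)) (PT_tl (P2 _))) (P3 _).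
    exact: PT_const.
  - apply: PT_if; first exact/PT_nonnil/P2.
      exact: PT_const.
    exact: PT_cons (P3 _) (P4 _).
apply: PT_ext (PT_tl H) => x _.
by rewrite [mu _]addn0 /= iter_eq_step.
Qed.

End TreeEquality.

Lemma PT_eq X (P : X -> Prop) sz inp (T : eqType) (enc : T -> tree) (a b : X -> T) :
  injective enc -> PT P sz inp (fun x => enc (a x)) -> PT P sz inp (fun x => enc (b x)) ->
  PT P sz inp (fun x => enc_bool (a x == b x)).
Proof.
by move=> inj Ha Hb; apply: PT_ext (PT_eqtree Ha Hb) => x _; rewrite (inj_eq inj).
Qed.

Lemma elt_of_P X (P : X -> Prop) E (l : X -> seq E) y : elt_of P l y -> P y.1.
Proof. by case. Qed.

Lemma PT_mem X (P : X -> Prop) sz inp (T : eqType) (enc : T -> tree) (a : X -> T) (l : X -> seq T) :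
  injective enc -> PT P sz inp (fun x => enc (a x)) -> PT P sz inp (fun x => enc_seq enc (l x)) ->
  PT P sz inp (fun x => enc_bool (a x \in l x)).
Proof.
move=> inj Ha Hl Hi; move: (Hi).
apply: PT_ext (PT_has (q := fun x e => a x == e) Hl _).
  by move=> x _; rewrite -has_pred1; congr enc_bool; apply: eq_has => e; rewrite /= eq_sym.
apply: PT_eq inj _ _; last by pt_solve 3.
exact: PT_up Hi (@elt_of_P _ _ _ _) Ha.
Qed.

Lemma PT_flatten X (P : X -> Prop) sz inp (E : Type) (enc : E -> tree) (l : X -> seq (seq E)) :
  PT P sz inp (fun x => enc_seq (enc_seq enc) (l x)) ->
  PT P sz inp (fun x => enc_seq enc (flatten (l x))).
Proof.
move=> Hl Hi; have [szl _] := Hl Hi; move: Hi.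
have foldE s (a : seq E) : foldl (fun a s => catrev s a) a s = catrev (flatten s) a.
  by elim: s a => //= s ss IH a; rewrite IH !catrevE rev_cat catA.
have szf s : tree_size (enc_seq enc (flatten s)) <= tree_size (enc_seq (enc_seq enc) s).
  elim: s => //= s ss; have := tree_size_cat enc s (flatten ss); lia.
have H : PT P sz inp (fun x => enc_seq enc (foldl (fun a s => catrev s a) [::] (l x))).
  apply: (PT_foldl (a0 := fun=> [::]) (step := fun _ a s => catrev s a) Hl).
  - exact: PT_nil.
  - apply: (polyO_le (h := fun y => tree_size (enc_seq (enc_seq enc) (l y.1)))).
      move=> [x l1] /= [Px [l2 El]]; rewrite foldE catrevE cats0 tree_size_rev El.
      exact: leq_trans (szf _) (tree_size_prefix _ _ _).
    by apply: (polyO_reindex (P := P)) szl => y [].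
  - by apply: PT_catrev; [pt_solve 3 | pt_solve 4].
by apply: PT_ext (PT_rev H) => x _; rewrite foldE catrevE cats0 revK.
Qed.

Lemma PT_allpairs X (P : X -> Prop) sz inp (E1 E2 F : Type) (enc1 : E1 -> tree)
    (enc2 : E2 -> tree) (encF : F -> tree) (l : X -> seq E1) (m : X -> seq E2)
    (f : X -> E1 -> E2 -> F) :
  PT P sz inp (fun x => enc_seq enc1 (l x)) -> PT P sz inp (fun x => enc_seq enc2 (m x)) ->
  PT (elt_of (elt_of P l) (fun y => m y.1)) (fun z => sz z.1.1)
     (fun z => Cons (enc2 z.2) (Cons (enc1 z.1.2) (inp z.1.1)))
     (fun z => encF (f z.1.1 z.1.2 z.2)) ->
  PT P sz inp (fun x => enc_seq encF [seq f x a b | a <- l x, b <- m x]).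
Proof.
move=> Hl Hm Hf Hi; move: (Hi); apply: PT_flatten.
apply: (PT_map (encF := enc_seq encF) Hl).
apply: (PT_map (encE := enc2) (sz := fun y => sz y.1) (f := fun y b => f y.1 y.2 b)) => //.
exact: PT_up Hi (@elt_of_P _ _ _ _) Hm.
Qed.

(** Written as a left fold, the form of list recursion that [PT_foldl] can run; [powl_cons] recovers
    the usual equation. *)
Definition powl (T : Type) (U : seq T) : seq (seq T) :=
  foldl (fun acc a => acc ++ [seq a :: s | s <- acc]) [:: [::]] (rev U).

Lemma powl_cons T (a : T) U : powl (a :: U) = powl U ++ [seq a :: s | s <- powl U].
Proof. by rewrite /powl rev_cons foldl_rcons. Qed.

Lemma size_powl T (U : seq T) : size (powl U) = 2 ^ size U.
Proof. by elim: U => // a U IHU; rewrite powl_cons size_cat size_map IHU expnS mul2n addnn. Qed.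

(** Profiles and states are filterings of their universe, so the power list contains them all; this
    bounds the number of table keys. *)
Lemma filter_powl (T : eqType) (U : seq T) q : [seq u <- U | q u] \in powl U.
Proof.
elim: U => // a U IHU; rewrite powl_cons mem_cat /=; case: (q a) => //.
  by rewrite map_f ?orbT.
by rewrite IHU.
Qed.

Lemma tree_size_powl T (enc : T -> tree) (U : seq T) s :
  List.In s (powl U) -> tree_size (enc_seq enc s) <= tree_size (enc_seq enc U).
Proof.
elim: U s => [|a U IHU] s; first by case=> [<-|].
rewrite powl_cons => H; have [/IHU /=|H'] := List.in_app_or _ _ _ H; first lia.
by have [t [<- /IHU /=]] := proj1 (List.in_map_iff _ _ _) H'; lia.
Qed.

Lemma PT_powl X (P : X -> Prop) sz inp (E : Type) (enc : E -> tree) (l : X -> seq E) :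
  PT P sz inp (fun x => enc_seq enc (l x)) -> polyO P sz (fun x => 2 ^ size (l x)) ->
  PT P sz inp (fun x => enc_seq (enc_seq enc) (powl (l x))).
Proof.
move=> Hl Hp Hi; have [szl _] := Hl Hi; move: (Hi).
apply: (@PT_foldl _ P sz inp E _ enc (enc_seq (enc_seq enc)) (fun x => rev (l x))
  (fun=> [:: [::]]) (fun _ acc a => acc ++ [seq a :: s | s <- acc])); first exact: PT_rev.
- exact: PT_const (Cons Nil Nil).
- apply: (polyO_le (h := fun y => 2 ^ size (l y.1) * (tree_size (enc_seq enc (l y.1))).+1 + 1)).
    move=> [x l1] /= [Px [l2 El]]; rewrite -[l1]revK -/(powl (rev l1)).
    have -> : l x = rev l2 ++ rev l1 by rewrite -rev_cat -El revK.
    apply: leq_trans (tree_size_seq_le (fun s => @tree_size_powl _ enc (rev l1) s)) _.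
    rewrite size_powl leq_add2r; apply: leq_mul.
      by rewrite leq_exp2l // size_cat leq_addl.
    have := tree_size_cat enc (rev l2) (rev l1); have := tree_size_gt0 (enc_seq enc (rev l2)); lia.
  apply: (polyO_reindex (P := P) (h := fst)
    (g := fun x => 2 ^ size (l x) * (tree_size (enc_seq enc (l x))).+1 + 1)) => [y []//|].
  by apply: polyO_add (polyO_const _ _ _); apply: (polyO_mul Hp); apply: polyO_S.
- apply: PT_cat; first by pt_solve 4.
  apply: PT_map; first by pt_solve 4.
  by apply: PT_cons; pt_solve 4.
Qed.

(** * The algorithm *)

Lemma polyO_le_fst X Y (P : X -> Prop) (Q : X * Y -> Prop) sz f (g : X -> nat) :
  (forall x y, Q (x, y) -> P x /\ f (x, y) <= g x) ->
  polyO P sz g -> polyO Q (fun y => sz y.1) f.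
Proof.
move=> H [c hc]; exists c => -[x y] /H[Px le_fg]; exact: leq_trans le_fg (hc x Px).
Qed.

Ltac poly := repeat first
  [ assumption | exact: polyO_const | apply: polyO_S | apply: polyO_add | apply: polyO_mul ].

(** Atoms and nodes are raw trees, so that the program is defined and analysed on arbitrary input
    trees; their meaning enters only in the correctness proof. *)
Definition prof := seq tree.
Definition state := seq prof.
Definition table := seq (state * nat).
Definition dag := seq tree.

Definition enc_state : state -> tree := enc_seq (enc_seq id).
Definition enc_table : table -> tree := enc_seq (enc_pair enc_state enc_nat).
Definition enc_nodes : dag -> tree := enc_seq id.

(* States and profiles are kept as sublists of fixed lists [U1] and [U0], so that equal sets are
   equal lists. *)
Definition norm (T : eqType) (U l : seq T) : seq T := [seq u <- U | u \in l].

Definition key_leaf (U0 : prof) (U1 : state) (i c1 c2 : tree) : state :=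
  norm U1 [:: norm U0 [:: Cons i c1]; norm U0 [:: Cons i c2]].

Definition key_union (U0 : prof) (U1 s1 s2 : state) : state :=
  norm U1 [seq norm U0 (p ++ q) | p <- s1, q <- s2].

Definition relabel_atom (i j a : tree) : tree :=
  if tree_hd a == i then Cons j (tree_tl a) else a.

Definition key_relabel (U0 : prof) (U1 : state) (i j : tree) (s : state) : state :=
  norm U1 [seq norm U0 [seq relabel_atom i j a | a <- p] | p <- s].

Definition conflict (i j : tree) (p : prof) : bool :=
  has (fun a => has (fun b =>
    [&& tree_hd a == i, tree_hd b == j & tree_tl a != tree_tl b]) p) p.

Definition key_join (U1 : state) (i j : tree) (s : state) : state :=
  norm U1 [seq p <- s | ~~ conflict i j p].

Definition accept (s : state) : bool :=
  all (fun p : prof => all (fun a =>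
    (tree_tl a != enc_nat 3) && all (fun b => tree_tl a == tree_tl b) p) p) s.

Definition t_map (v : tree) (b : bool) : tree := Cons (enc_nat 2) (Cons v (enc_bool b)).
Definition t_union (i j : nat) : tree := Cons (enc_nat 3) (Cons (enc_nat i) (enc_nat j)).
Definition t_join (i j : nat) : tree := Cons (enc_nat 4) (Cons (enc_nat i) (enc_nat j)).

(* A table pairs each state with the position of a DAG node.  The list [dag] holds the nodes in
   reverse order, so the position of the next node is its size. *)
Definition ins_step (st : state) (acc : table * nat * dag) (ent : state * nat) :
    table * nat * dag :=
  if ent.1 == st then (acc.1.1, size acc.2, t_union ent.2 acc.1.2 :: acc.2)
  else (ent :: acc.1.1, acc.1.2, acc.2).

Definition insert (st : state) (idx : nat) (T : table) (d : dag) : table * dag :=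
  let acc := foldl (ins_step st) ([::], idx, d) T in
  ((st, acc.1.2) :: acc.1.1, acc.2).

Definition addcand (Td : table * dag) (c : state * tree) : table * dag :=
  insert c.1 (size Td.2) Td.1 (c.2 :: Td.2).

(* The node [t_union i 0] is a copy of node [i], as node 0 is the empty expression.  In a leaf,
   an atom of colour 0 does not belong to [U0] and yields the empty profile. *)
Definition cands (U0 : prof) (U1 : state) (stk : seq table) (t : tree) : seq (state * tree) :=
  let tag := tree_hd t in
  let i := tree_hd (tree_hd (tree_tl t)) in
  let j := tree_tl (tree_hd (tree_tl t)) in
  if nonnil tag then
    if nonnil (tree_tl tag) then
      if nonnil (tree_tl (tree_tl tag)) then
        [seq (key_join U1 i j e.1, t_union e.2 0) | e <- head [::] stk]
      else [seq (key_relabel U0 U1 i j e.1, t_union e.2 0) | e <- head [::] stk]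
    else [seq (key_union U0 U1 e1.1 e2.1, t_join e1.2 e2.2)
         | e1 <- head [::] stk, e2 <- head [::] (behead stk)]
  else
    let v := tree_hd (tree_tl t) in
    let l := tree_tl (tree_tl t) in
    [:: (key_leaf U0 U1 l (enc_nat 1) (enc_nat 2), t_map v true);
        (key_leaf U0 U1 l (enc_nat 0) (enc_nat 3), t_map v false)].

Definition pop (stk : seq table) (t : tree) : seq table :=
  let tag := tree_hd t in
  if nonnil tag then if nonnil (tree_tl tag) then behead stk else behead (behead stk)
  else stk.

Definition run_step (U0 : prof) (U1 : state) (sd : seq table * dag) (t : tree) :
    seq table * dag :=
  let Td := foldl addcand ([::], sd.2) (cands U0 U1 sd.1 t) in
  (Td.1 :: pop sd.1 t, Td.2).

(** Position [(size d).-1] is that of the last node, which holds the union so far. [finish] starts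
    from a fresh empty expression, so the last node is the root even if no state is accepted. *)
Definition fin_step (d : dag) (ent : state * nat) : dag :=
  if accept ent.1 then t_union ent.2 (size d).-1 :: d else d.

Definition finish (T : table) (d : dag) : dag := foldl fin_step (Cons Nil Nil :: d) T.

Definition children (t : tree) : seq tree :=
  let tag := tree_hd t in
  if nonnil tag then
    if nonnil (tree_tl tag) then [:: tree_tl (tree_tl t)]
    else [:: tree_hd (tree_tl t); tree_tl (tree_tl t)]
  else [::].

Definition tr_step (to : seq tree * seq tree) : seq tree * seq tree :=
  if to.1 is t :: s then (children t ++ s, t :: to.2) else to.

(* Visiting a tree before its subtrees and consing the visited ones lists them with every tree
   after its subtrees, the second argument of a union coming before the first. *)
Definition postorder (t : tree) : seq tree :=
  (iter (tree_size t) tr_step ([:: t], [::])).2.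

(** The length of the accumulator serves as the counter. *)
Definition labels (k : nat) : seq tree :=
  foldl (fun acc _ => enc_nat (size acc) :: acc) [::] (nseq k Nil).

Definition atoms (k : nat) : prof :=
  [seq Cons l c | l <- labels k, c <- [:: enc_nat 1; enc_nat 2; enc_nat 3]].

Definition run (k : nat) (ts : seq tree) : seq table * dag :=
  foldl (run_step (atoms k) (powl (atoms k))) ([::], [:: Cons Nil Nil]) ts.

Definition algorithm (k : nat) (t : tree) : dag :=
  let sd := run k (postorder t) in rev (finish (head [::] sd.1) sd.2).

(** * Polynomial time for the operations on states *)

Lemma id_inj (T : Type) : injective (@id T). Proof. by []. Qed.

Lemma enc_prof_inj : injective (enc_seq (@id tree)).
Proof. exact: enc_seq_inj (@id_inj _). Qed.

Lemma enc_state_inj : injective enc_state.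
Proof. exact: enc_seq_inj enc_prof_inj. Qed.

Lemma PT_norm X (P : X -> Prop) sz inp (T : eqType) (enc : T -> tree) (U l : X -> seq T) :
  injective enc ->
  PT P sz inp (fun x => enc_seq enc (U x)) -> PT P sz inp (fun x => enc_seq enc (l x)) ->
  PT P sz inp (fun x => enc_seq enc (norm (U x) (l x))).
Proof.
move=> inj HU Hl Hi; move: (Hi); apply: (PT_filter HU).
by apply: PT_mem inj _ _; [pt_solve 2 | exact: PT_up Hi (@elt_of_P _ _ _ _) Hl].
Qed.

Section Keys.
Variables (X : Type) (P : X -> Prop) (sz : X -> nat) (inp : X -> tree).
Variables (U0 : X -> prof) (U1 : X -> state) (i j : X -> tree) (s : X -> state).
Hypothesis HU0 : PT P sz inp (fun x => enc_seq id (U0 x)).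
Hypothesis HU1 : PT P sz inp (fun x => enc_state (U1 x)).
Hypothesis Hi : PT P sz inp i.
Hypothesis Hj : PT P sz inp j.
Hypothesis Hs : PT P sz inp (fun x => enc_state (s x)).

Lemma PT_key_leaf (c1 c2 : tree) :
  PT P sz inp (fun x => enc_state (key_leaf (U0 x) (U1 x) (i x) c1 c2)).
Proof.
have H c : PT P sz inp (fun x => enc_seq id (norm (U0 x) [:: Cons (i x) c])).
  apply: PT_norm => //.
  by apply: PT_cons; [apply: PT_cons Hi _; exact: PT_const | exact: PT_const].
apply: PT_norm => //; first exact: enc_prof_inj.
by apply: PT_cons (H c1) _; apply: PT_cons (H c2) _; exact: PT_const.
Qed.

Lemma PT_key_union (s' : X -> state) :
  PT P sz inp (fun x => enc_state (s' x)) ->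
  PT P sz inp (fun x => enc_state (key_union (U0 x) (U1 x) (s x) (s' x))).
Proof.
move=> Hs' Hz; move: (Hz).
apply: PT_norm HU1 _; first exact: enc_prof_inj.
apply: (PT_allpairs (encF := enc_seq id) Hs Hs').
apply: PT_norm => //; last by apply: PT_cat; pt_solve 3.
have HU := PT_up (d := fun y => enc_seq id y.2) Hz (@elt_of_P _ P _ s) HU0.
exact: (PT_up (polyO_elt Hz Hs) (@elt_of_P _ _ _ _) HU).
Qed.

Lemma PT_key_relabel :
  PT P sz inp (fun x => enc_state (key_relabel (U0 x) (U1 x) (i x) (j x) (s x))).
Proof.
move=> Hz; move: (Hz).
apply: PT_norm HU1 _; first exact: enc_prof_inj.
apply: (PT_map (encF := enc_seq id) Hs).
(* [up], and [up2] below, give access to the outer data from inside one and two nested loops. *)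
have up o := PT_up (d := fun y => enc_seq id y.2) Hz (@elt_of_P _ P _ s) (out := o).
apply: PT_norm => //; first exact: (up _ HU0).
have env := polyO_elt Hz Hs.
apply: (PT_map (l := fun y => y.2) (sz := fun y => sz y.1)
   (f := fun y a => relabel_atom (i y.1) (j y.1) a)); first by pt_solve 2.
have up2 o Ho := PT_up (d := fun z => id z.2) env (@elt_of_P _ _ _ (fun y => y.2)) (up o Ho).
apply: (PT_ite (sz := fun z => sz z.1.1)).
- apply: PT_eqtree; [by pt_solve 3 | exact: (up2 _ Hi)].
- apply: PT_cons; [exact: (up2 _ Hj) | by pt_solve 3].
- by pt_solve 3.
Qed.

Lemma PT_key_join :
  PT P sz inp (fun x => enc_state (key_join (U1 x) (i x) (j x) (s x))).
Proof.
move=> Hz; move: (Hz).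
apply: PT_norm HU1 _; first exact: enc_prof_inj.
apply: (PT_filter Hs); apply: PT_neg.
have up o := PT_up (d := fun y => enc_seq id y.2) Hz (@elt_of_P _ P _ s) (out := o).
have env := polyO_elt Hz Hs.
have up2 o Ho := PT_up (d := fun z => id z.2) env (@elt_of_P _ _ _ (fun y => y.2)) (up o Ho).
pose p0 (y : X * prof) := y.2.
have Hp0 : PT (elt_of P s) (fun y => sz y.1) (fun y => Cons (enc_seq id y.2) (inp y.1))
    (fun y => enc_seq id (p0 y)) by pt_solve 2.
have env2 := polyO_elt env Hp0.
apply: (PT_has (sz := fun y => sz y.1) (q := fun y a => has (fun b =>
    [&& tree_hd a == i y.1, tree_hd b == j y.1 & tree_tl a != tree_tl b]) y.2) Hp0).
apply: (PT_has (encE := id) (sz := fun y => sz y.1.1) (l := fun y => y.1.2) (q := fun z b => 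
    [&& tree_hd z.2 == i z.1.1, tree_hd b == j z.1.1 & tree_tl z.2 != tree_tl b])).
  by pt_solve 3.
have up3 o Ho := PT_up (d := fun z => id z.2) env2 (@elt_of_P _ _ _ (fun y => y.1.2)) (up2 o Ho).
have HI := up3 _ Hi; have HJ := up3 _ Hj.
have H3 : PT (elt_of (elt_of (elt_of P s) (fun y => p0 y)) (fun y => y.1.2))
   (fun z => sz z.1.1.1) (fun z => Cons z.2 (Cons z.1.2 (Cons (enc_seq id z.1.1.2) (inp z.1.1.1))))
   (fun z => enc_bool (tree_tl z.1.2 != tree_tl z.2)).
  by apply: PT_neg; apply: PT_eqtree; pt_solve 4.
move=> env3; move: (env3).
apply: (PT_and (sz := fun z => sz z.1.1.1)).
  by apply: PT_eqtree HI; pt_solve 4.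
move=> env4; move: (env4).
apply: (PT_and (sz := fun z => sz z.1.1.1)).
  apply: PT_eqtree; first by pt_solve 4.
  by move=> _; apply: PT_sub (HJ env3) => z [].
by move=> _; apply: PT_sub (H3 env3) => z [[]].
Qed.

End Keys.

Lemma PT_accept X (P : X -> Prop) sz inp (s : X -> state) :
  PT P sz inp (fun x => enc_state (s x)) -> PT P sz inp (fun x => enc_bool (accept (s x))).
Proof.
move=> Hs; apply: (PT_all Hs).
apply: (PT_all (encE := id) (sz := fun y => sz y.1) (l := fun y => y.2) (q := fun y a =>
  (tree_tl a != enc_nat 3) && all (fun b => tree_tl a == tree_tl b) y.2)).
  by pt_solve 2.
apply: (PT_and (sz := fun y => sz y.1.1)).
  by apply/PT_neg/PT_eqtree; [pt_solve 3 | exact: PT_const].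
apply: (PT_all (encE := id) (sz := fun y => sz y.1.1) (l := fun y => y.1.2)
  (q := fun y b => tree_tl y.2 == tree_tl b)); first by pt_solve 3.
by apply: PT_eqtree; pt_solve 4.
Qed.

Lemma In_memP (T : eqType) (a : T) s : reflect (List.In a s) (a \in s).
Proof.
elim: s => [|b s IHs] /=; first exact: ReflectF.
rewrite inE; apply: (iffP orP) => [[/eqP->|/IHs]|[->|/IHs]]; auto.
Qed.

Definition enc_ins := enc_pair (enc_pair enc_table enc_nat) enc_nodes.
Definition enc_td := enc_pair enc_table enc_nodes.

(** The increment per step is stated for the whole list [l1 ++ l2], so that it stays fixed while the
    prefix grows. *)
Lemma ins_fold_bounds st idx d l1 l2 :
  let T := l1 ++ l2 in
  let acc := foldl (ins_step st) ([::], idx, d) l1 in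
  [/\ size acc.2 <= size d + size l1, acc.1.2 <= idx + size d + size l1,
      tree_size (enc_table acc.1.1) <= tree_size (enc_table l1)
    & tree_size (enc_nodes acc.2) <= tree_size (enc_nodes d) +
       size l1 * (20 + 2 * (idx + size d + size T) + tree_size (enc_table T))].
Proof.
elim/last_ind: l1 l2 => [|l1 ent IHl] l2; first by rewrite /= addn0; split=> //; lia.
have := IHl (ent :: l2); rewrite -cat_rcons; cbv zeta.
set K := (20 + _ + _) => -[h1 h2 h3 h4].
rewrite foldl_rcons; set acc := foldl _ _ _ in h1 h2 h3 h4 *.
have e1 : tree_size (enc_table (rcons l1 ent)) =
   (tree_size (enc_table l1) + tree_size (enc_pair enc_state enc_nat ent)).+1.
  by rewrite -cats1; have /= := tree_size_cat (enc_pair enc_state enc_nat) l1 [:: ent]; rewrite /enc_table; lia.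
have := tree_size_prefix (enc_pair enc_state enc_nat) (rcons l1 ent) l2.
rewrite -![enc_seq _ _]/(enc_table _) e1 => e2.
have eK : K = 20 + 2 * (idx + size d + (size l1 + 1 + size l2)) + tree_size (enc_table (rcons l1 ent ++ l2)).
  by rewrite /K size_cat size_rcons addn1.
rewrite !size_rcons mulSn.
rewrite /ins_step; case: ifP => _ /=; split=> //; rewrite ?tree_size_enc_nat ?e1 /enc_pair /=; try lia.
by move: e2; rewrite /enc_pair /= eK !tree_size_enc_nat; lia.
Qed.

Lemma PT_insert X (P : X -> Prop) sz inp st idx (T : X -> table) d :
  PT P sz inp (fun x => enc_state (st x)) -> PT P sz inp (fun x => enc_nat (idx x)) ->
  PT P sz inp (fun x => enc_table (T x)) -> PT P sz inp (fun x => enc_nodes (d x)) ->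
  PT P sz inp (fun x => enc_td (insert (st x) (idx x) (T x) (d x))).
Proof.
move=> Hst Hidx HT Hd Hi; move: (Hi).
have [szT _] := HT Hi; have [szd _] := Hd Hi; have [szi _] := Hidx Hi.
suff H : PT P sz inp (fun x => enc_ins (foldl (ins_step (st x)) ([::], idx x, d x) (T x))).
  by apply: PT_cons (PT_tl H); apply: PT_cons (PT_hd (PT_hd H)); apply: PT_cons (PT_tl (PT_hd H)).
pose st0 x : table * nat * dag := ([::], idx x, d x).
apply: (@PT_foldl _ P sz inp _ _ _ enc_ins T st0 (fun x => ins_step (st x)) HT).
- by apply: PT_cons Hd; apply: PT_cons Hidx; exact: PT_nil.
- pose t x := tree_size (enc_table (T x)); pose n x := tree_size (enc_nodes (d x)).
  pose i x := tree_size (enc_nat (idx x)).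
  apply: (polyO_le_fst (P := P) (g := fun x => t x + 2 * (i x + n x + t x) + n x + t x *
      (20 + 2 * (i x + n x + t x) + t x) + 20)); last by poly.
  move=> x l1 [/= Px [l2 El]]; split=> //.
  have [] := ins_fold_bounds (st x) (idx x) (d x) l1 l2.
  rewrite -El -/(st0 x); move: (foldl _ _ _) => acc h1 h2 h3 h4.
  have a1 : idx x <= i x by rewrite /i tree_size_enc_nat; lia.
  have a2 : size (d x) <= n x by apply/ltnW/size_enc_seq.
  have a3 : size (T x) <= t x by apply/ltnW/size_enc_seq.
  have a4 : size l1 <= size (T x) by rewrite El size_cat leq_addr.
  have a5 : tree_size (enc_table l1) <= t x by rewrite /t El; apply: tree_size_prefix.
  have a6 : tree_size (enc_nodes acc.2) <= n x + t x * (20 + 2 * (i x + n x + t x) + t x).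
    apply: leq_trans h4 _; rewrite -/(t x) leq_add2l; apply: leq_mul; lia.
  rewrite /enc_ins /enc_pair /= tree_size_enc_nat; lia.
set Q := fun y : _ * (_ * _) => _.
have QP y : Q y -> P y.1 by case.
have Hst' : PT Q (fun y => sz y.1)
   (fun y => Cons (enc_pair enc_state enc_nat y.2.2) (Cons (enc_ins y.2.1) (inp y.1)))
   (fun y => enc_state (st y.1)).
  apply: (PT_comp (PT_tl (PT_tl (@PT_id _ _ _ _)))) => _.
  by apply: PT_rel (Hst Hi) => y Qy; exists y.1; split=> //; apply: QP.
apply: PT_ext (PT_ite (c := fun y => y.2.2.1 == st y.1)
   (a := fun y => enc_ins (y.2.1.1.1, size y.2.1.2, t_union y.2.2.2 y.2.1.1.2 :: y.2.1.2))
   (b := fun y => enc_ins (y.2.2 :: y.2.1.1.1, y.2.1.1.2, y.2.1.2)) _ _ _).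
- by move=> y _; rewrite /ins_step; case: ifP.
- by apply: PT_eq enc_state_inj _ Hst'; pt_solve 4.
- apply: PT_cons; [apply: PT_cons; first by pt_solve 5 | ].
    by apply: (PT_size (encE := id)); pt_solve 4.
  apply: PT_cons; last by pt_solve 4.
  by apply: PT_cons; [exact: PT_const | apply: PT_cons; pt_solve 5].
- apply: PT_cons; last by pt_solve 4.
  by apply: PT_cons; [apply: PT_cons; pt_solve 5 | pt_solve 5].
Qed.

(** * Tables *)

Lemma ins_fold_table st idx d l :
  (foldl (ins_step st) ([::], idx, d) l).1.1 = rev [seq e <- l | e.1 != st].
Proof.
elim/last_ind: l => //= l e IHl; rewrite foldl_rcons filter_rcons /ins_step.
by case: eqP => /= _; rewrite IHl // rev_rcons.
Qed.

Lemma t_union_size i j n : i < n -> j < n -> tree_size (t_union i j) <= 4 * n + 20.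
Proof. by move=> i_n j_n; rewrite /t_union /= !tree_size_enc_nat; lia. Qed.

(** A new node holds just two positions in unary, so its size is bounded by the number of nodes and
    not by the sizes of earlier nodes; otherwise the bounds would compound over the run. *)
Lemma insert_inv st idx (T : table) d (Td := insert st idx T d) :
  idx < size d -> (forall e : state * nat, e \in T -> e.2 < size d) -> uniq (unzip1 T) ->
  [/\ uniq (unzip1 Td.1), {subset unzip1 Td.1 <= st :: unzip1 T},
      (forall e : state * nat, e \in Td.1 -> e.2 < size Td.2), size d <= size Td.2 <= size d + size T
    & forall g : tree, g \in Td.2 -> g \in d \/ tree_size g <= 4 * size Td.2 + 20].
Proof.
move=> idx_d T_d uT; rewrite {}/Td /insert /=; set acc := foldl _ _ _.
have tab : acc.1.1 = rev [seq e <- T | e.1 != st] by exact: ins_fold_table.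
have [h1 h2 h3] : [/\ acc.1.2 < size acc.2, size d <= size acc.2 <= size d + size T
    & forall g : tree, g \in acc.2 -> g \in d \/ tree_size g <= 4 * size acc.2 + 20].
  rewrite /acc; elim/last_ind: T T_d {uT acc tab} => [|T e IHT] T_d.
    by rewrite /= addn0 leqnn; split=> // g; left.
  have [|h1 h2 h3] := IHT.
    by move=> e' e'T; apply: T_d; rewrite mem_rcons inE e'T orbT.
  have e_d : e.2 < size d by apply: T_d; rewrite mem_rcons mem_head.
  rewrite foldl_rcons size_rcons; move: (foldl _ _ _) h1 h2 h3 => acc h1 h2 h3.
  rewrite /ins_step; case: ifP => _ /=; split=> //; try lia.
  move=> g; rewrite inE => /predU1P[->|/h3[|?]]; [right|by left|right; lia].
  by apply: t_union_size; lia.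
have memF e : e \in acc.1.1 -> e \in T by rewrite tab mem_rev mem_filter => /andP[].
split=> //.
- rewrite /= tab; apply/andP; split.
    apply/mapP => -[e]; rewrite mem_rev mem_filter => /andP[/eqP ne _] eq_e.
    by case: ne.
  rewrite /unzip1 map_rev rev_uniq; apply: subseq_uniq uT.
  exact/map_subseq/filter_subseq.
- move=> k; rewrite !inE => /orP[->//|/mapP[e /memF eT ->]].
  by rewrite map_f ?orbT.
- move=> e; rewrite inE => /predU1P[->|/memF/T_d] /=; lia.
Qed.

(** The keys of the table are distinct members of [Ks], so a candidate adds its own node and at most
    [size Ks] unions. *)
Lemma addcands_inv (d0 : dag) (cs : seq (state * tree)) (Ks : seq state) (Td := foldl addcand ([::], d0) cs) :
  {subset unzip1 cs <= Ks} ->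
  [/\ uniq (unzip1 Td.1), {subset unzip1 Td.1 <= Ks},
      (forall e : state * nat, e \in Td.1 -> e.2 < size Td.2),
      size d0 <= size Td.2 <= size d0 + size cs * (size Ks).+1
    & forall g : tree, g \in Td.2 -> [\/ g \in d0, g \in unzip2 cs | tree_size g <= 4 * size Td.2 + 20]].
Proof.
rewrite {}/Td; elim/last_ind: cs => [|cs c IHcs] sub.
  by rewrite /= addn0 leqnn; split=> // g; constructor.
have [|h1 h2 h3 h4 h5] := IHcs.
  by move=> k kcs; apply: sub; rewrite /unzip1 map_rcons mem_rcons inE kcs orbT.
have cK : c.1 \in Ks by apply: sub; rewrite /unzip1 map_rcons mem_rcons mem_head.
rewrite foldl_rcons size_rcons; move: (foldl _ _ _) h1 h2 h3 h4 h5 => [T d] h1 h2 h3 h4 h5.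
rewrite /= in h1 h2 h3 h4 h5.
have T_d (e : state * nat) : e \in T -> e.2 < size (c.2 :: d) by move=> /h3/ltnW.
have := @insert_inv c.1 (size d) T (c.2 :: d) (ltnSn _) T_d h1; cbv zeta.
rewrite -/(addcand (T, d) c); move: (addcand _ _) => [T' d'] /= [g1 g2 g3 g4 g5].
have szT : size T <= size Ks by rewrite -(size_map fst); apply: uniq_leq_size.
split=> //.
- by move=> k /g2; rewrite inE => /predU1P[->//|/h2].
- rewrite mulSn; move: h4 g4 szT.
  by move: (size Ks) (size T) (size d) (size d') (size cs) (size d0) => *; lia.
- move=> g /g5[|?]; last by constructor 3.
  rewrite inE => /predU1P[->|/h5[?|?|?]].
  + by constructor 2; rewrite /unzip2 map_rcons mem_rcons mem_head.
  + by constructor.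
  + by constructor 2; rewrite /unzip2 map_rcons mem_rcons inE orbC; apply/orP; left.
  + by constructor 3; lia.
Qed.

Definition enc_cands : seq (state * tree) -> tree := enc_seq (enc_pair enc_state id).

Lemma tree_size_mem (T : eqType) (enc : T -> tree) a l :
  a \in l -> tree_size (enc a) < tree_size (enc_seq enc l).
Proof. by move=> /In_memP al; apply: tree_size_In. Qed.

Lemma tree_size_seq_mem (T : eqType) (enc : T -> tree) l B :
  (forall a, a \in l -> tree_size (enc a) <= B) ->
  tree_size (enc_seq enc l) <= size l * B.+1 + 1.
Proof. by move=> H; apply: tree_size_seq_le => a /In_memP/H. Qed.

Lemma td_size (T : table) (d : dag) m n s B :
  size T <= m -> size d <= n -> (forall e : state * nat, e \in T -> e.2 < size d) ->
  (forall k : state, k \in unzip1 T -> tree_size (enc_state k) <= s) ->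
  (forall g : tree, g \in d -> tree_size g <= B) ->
  tree_size (enc_table T) <= m * (s + 2 * n + 2).+1 + 1 /\
  tree_size (enc_nodes d) <= n * B.+1 + 1.
Proof.
move=> Tm dn Td Ts dB; split.
  apply: leq_trans (tree_size_seq_mem (B := s + 2 * n + 2) _) _.
    move=> [k i] eT; have := leq_trans (Td _ eT) dn; have := Ts _ (map_f fst eT).
    by rewrite /enc_pair /= tree_size_enc_nat; move: (tree_size _) => *; lia.
  by rewrite leq_add2r leq_mul2r Tm orbT.
apply: leq_trans (tree_size_seq_mem (B := B) _) _ => //.
by rewrite leq_add2r leq_mul2r dn orbT.
Qed.

Lemma PT_addcands X (P : X -> Prop) sz inp (cs : X -> seq (state * tree)) d (Ks : X -> seq state) :
  PT P sz inp (fun x => enc_cands (cs x)) -> PT P sz inp (fun x => enc_nodes (d x)) ->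
  (forall x, P x -> {subset unzip1 (cs x) <= Ks x}) -> polyO P sz (fun x => size (Ks x)) ->
  PT P sz inp (fun x => enc_td (foldl addcand ([::], d x) (cs x))).
Proof.
move=> Hcs Hd subK HK Hi; move: (Hi).
have [szc _] := Hcs Hi; have [szd _] := Hd Hi.
apply: (@PT_foldl _ P sz inp _ _ _ enc_td cs (fun x => ([::], d x)) (fun=> addcand) Hcs).
- by apply: PT_cons Hd; exact: PT_nil.
- pose c x := tree_size (enc_cands (cs x)); pose n x := tree_size (enc_nodes (d x)).
  pose m x := size (Ks x); pose N x := n x + c x * (m x).+1.
  pose B x := n x + c x + (4 * N x + 20).
  apply: (polyO_le_fst (P := P) (g := fun x => m x * (c x + 2 * N x + 2).+1 + 1 +
     (N x * (B x).+1 + 1) + 1)).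
    move=> x l1 [/= Px [l2 El]]; split=> //.
    have sub1 : {subset unzip1 l1 <= Ks x}.
      by move=> k kl; apply: subK Px _ _; rewrite El /unzip1 map_cat mem_cat kl.
    (* The invariant is used twice: with the keys of the prefix itself, to bound the size of each
       key, and with [Ks x], to bound their number. *)
    have [_ hk _ _ _] := @addcands_inv (d x) l1 (unzip1 l1) (fun k h => h).
    have [] := addcands_inv (d x) sub1; move: hk; case: (foldl _ _ _) => T d' /= hk h1 h2 h3 h4 h5.
    have l1c : tree_size (enc_cands l1) <= c x by rewrite /c El; apply: tree_size_prefix.
    have l1s : size l1 <= c x by apply: leq_trans l1c; apply/ltnW/size_enc_seq.
    have dN : size d' <= N x.
      have := leq_mul l1s (leqnn (m x).+1); have : size (d x) < n x by apply: size_enc_seq.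
      rewrite /N -/(m x); move: h4; rewrite -/(m x); lia.
    have [] := @td_size T d' (m x) (N x) (c x) (B x) _ dN h3.
    + by rewrite -(size_map fst); apply: uniq_leq_size.
    + move=> k /hk/mapP[e /(tree_size_mem (enc_pair enc_state id))].
      by rewrite -/(enc_cands _) /enc_pair /= => ? ->; lia.
    + move=> g /h5[/(tree_size_mem id)|/mapP[e /(tree_size_mem (enc_pair enc_state id)) he ->]|].
      * by rewrite -/(enc_nodes _) /B /n; lia.
      * by move: he; rewrite -/(enc_cands _) /enc_pair /B /=; lia.
      * by rewrite /B; lia.
    by rewrite /enc_td /enc_pair /=; lia.
  by rewrite /B /N; poly.
apply: (PT_insert (sz := fun y => sz y.1)).
- by pt_solve 3.
- by apply: (PT_size (encE := id)); pt_solve 4.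
- by pt_solve 4.
- by apply: PT_cons; pt_solve 4.
Qed.

Section Stack.
Variables (X : Type) (P : X -> Prop) (sz : X -> nat) (inp : X -> tree).
Variables (stk : X -> seq table).
Hypothesis Hstk : PT P sz inp (fun x => enc_seq enc_table (stk x)).

Lemma PT_top : PT P sz inp (fun x => enc_table (head [::] (stk x))).
Proof. by apply: PT_ext (PT_hd Hstk) => x _; case: (stk x). Qed.

Lemma PT_behead : PT P sz inp (fun x => enc_seq enc_table (behead (stk x))).
Proof. by apply: PT_ext (PT_tl Hstk) => x _; case: (stk x). Qed.

End Stack.

Section Cands.
Variables (X : Type) (P : X -> Prop) (sz : X -> nat) (inp : X -> tree).
Variables (U0 : X -> prof) (U1 : X -> state) (stk : X -> seq table) (t : X -> tree).
Hypothesis HU0 : PT P sz inp (fun x => enc_seq id (U0 x)).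
Hypothesis HU1 : PT P sz inp (fun x => enc_state (U1 x)).
Hypothesis Hstk : PT P sz inp (fun x => enc_seq enc_table (stk x)).
Hypothesis Ht : PT P sz inp t.

Let Htag : PT P sz inp (fun x => tree_hd (t x)) := PT_hd Ht.

Lemma PT_pop : PT P sz inp (fun x => enc_seq enc_table (pop (stk x) (t x))).
Proof.
apply: PT_ext (PT_ite (c := fun x => nonnil (tree_hd (t x)))
  (a := fun x => if nonnil (tree_tl (tree_hd (t x))) then enc_seq enc_table (behead (stk x))
                 else enc_seq enc_table (behead (behead (stk x))))
  (b := fun x => enc_seq enc_table (stk x)) _ _ _) => //.
- by move=> x _; rewrite /pop; case: nonnil => //; case: nonnil.
- exact: PT_nonnil.
- apply: PT_ite; first exact/PT_nonnil/PT_tl.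
    exact: PT_behead.
  exact/PT_behead/PT_behead.
Qed.

Lemma PT_cands : PT P sz inp (fun x => enc_cands (cands (U0 x) (U1 x) (stk x) (t x))).
Proof.
move=> Hi; move: (Hi).
pose i x := tree_hd (tree_hd (tree_tl (t x))); pose j x := tree_tl (tree_hd (tree_tl (t x))).
have HI : PT P sz inp i by do 2 apply: PT_hd; apply: PT_tl.
have HJ : PT P sz inp j by apply/PT_tl/PT_hd/PT_tl.
pose l x := tree_tl (tree_tl (t x)); pose v x := tree_hd (tree_tl (t x)).
have HL : PT P sz inp l by apply/PT_tl/PT_tl.
have HV : PT P sz inp v by apply/PT_hd/PT_tl.
pose T1 x := head [::] (stk x); pose T2 x := head [::] (behead (stk x)).
have HT1 : PT P sz inp (fun x => enc_table (T1 x)) by apply: PT_top.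
have HT2 : PT P sz inp (fun x => enc_table (T2 x)) by apply: PT_top; apply: PT_behead.
have up o Ho := PT_up (d := fun y => enc_pair enc_state enc_nat y.2) Hi (@elt_of_P _ P _ T1) (out := o) Ho.
have env1 := polyO_elt Hi HT1.
have up2 o Ho := PT_up (d := fun y => enc_pair enc_state enc_nat y.2) env1
    (@elt_of_P _ _ _ (fun y => T2 y.1)) (up o Ho).
apply: PT_ext (PT_ite (c := fun x => nonnil (tree_hd (t x)))
  (a := fun x => if nonnil (tree_tl (tree_hd (t x))) then
     if nonnil (tree_tl (tree_tl (tree_hd (t x)))) then
       enc_cands [seq (key_join (U1 x) (i x) (j x) e.1, t_union e.2 0) | e <- T1 x]
     else enc_cands [seq (key_relabel (U0 x) (U1 x) (i x) (j x) e.1, t_union e.2 0) | e <- T1 x]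
     else enc_cands [seq (key_union (U0 x) (U1 x) e1.1 e2.1, t_join e1.2 e2.2)
         | e1 <- T1 x, e2 <- T2 x])
  (b := fun x => enc_cands
    [:: (key_leaf (U0 x) (U1 x) (l x) (enc_nat 1) (enc_nat 2), t_map (v x) true);
        (key_leaf (U0 x) (U1 x) (l x) (enc_nat 0) (enc_nat 3), t_map (v x) false)]) _ _ _) => //.
- by move=> x _; rewrite /cands; case: nonnil => //; case: nonnil => //; case: nonnil.
- exact: PT_nonnil.
- apply: PT_ite; first exact/PT_nonnil/PT_tl.
    apply: PT_ite; first exact/PT_nonnil/PT_tl/PT_tl.
      apply: (PT_map (encF := enc_pair enc_state id) HT1); apply: PT_cons.
        apply: (PT_key_join (sz := fun y => sz y.1)); 
          [exact: (up _ HU1)|exact: (up _ HI)|exact: (up _ HJ)|by pt_solve 3].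
      by apply: PT_cons; [exact: PT_const | apply: PT_cons; [pt_solve 3 | exact: PT_const]].
    apply: (PT_map (encF := enc_pair enc_state id) HT1); apply: PT_cons.
      apply: (PT_key_relabel (sz := fun y => sz y.1)); 
        [exact: (up _ HU0)|exact: (up _ HU1)|exact: (up _ HI)|exact: (up _ HJ)|by pt_solve 3].
    by apply: PT_cons; [exact: PT_const | apply: PT_cons; [pt_solve 3 | exact: PT_const]].
  apply: (PT_allpairs (encF := enc_pair enc_state id) HT1 HT2); apply: PT_cons.
    apply: (PT_key_union (sz := fun y => sz y.1.1)); 
      [exact: (up2 _ HU0)|exact: (up2 _ HU1)|by pt_solve 4|by pt_solve 4].
  by apply: PT_cons; [exact: PT_const | apply: PT_cons; pt_solve 4].
- have leaf c1 c2 b : PT P sz inp (fun x => enc_pair enc_state id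
     (key_leaf (U0 x) (U1 x) (l x) c1 c2, t_map (v x) b)).
    apply: PT_cons; first exact: PT_key_leaf.
    by apply: PT_cons; [exact: PT_const | apply: PT_cons => //; exact: PT_const].
  by apply: PT_cons; [exact: leaf | apply: PT_cons; [exact: leaf | exact: PT_nil]].
Qed.

End Cands.

(** * Size invariants of the run *)

Definition table_ok (U1 : state) (n : nat) (T : table) : Prop :=
  [/\ uniq (unzip1 T), {subset unzip1 T <= powl U1} & forall e : state * nat, e \in T -> e.2 < n].

Definition stack_ok (U1 : state) (n : nat) (stk : seq table) : Prop :=
  forall T, T \in stk -> table_ok U1 n T.

Lemma table_ok_size U1 n T : table_ok U1 n T -> size T <= size (powl U1).
Proof. by case=> uT sT _; rewrite -(size_map fst); apply: uniq_leq_size. Qed.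

Lemma top_ok U1 n stk : stack_ok U1 n stk -> table_ok U1 n (head [::] stk).
Proof. by case: stk => [|T stk] H; [split | apply: H; rewrite mem_head]. Qed.

Lemma behead_ok U1 n stk : stack_ok U1 n stk -> stack_ok U1 n (behead stk).
Proof. by move=> H T /mem_behead/H. Qed.

Lemma pop_ok U1 n stk t : stack_ok U1 n stk -> stack_ok U1 n (pop stk t).
Proof. by move=> H; rewrite /pop; do 2?case: ifP => _ //; do ?apply: behead_ok. Qed.

Lemma stack_ok_le U1 n n' stk : n <= n' -> stack_ok U1 n stk -> stack_ok U1 n' stk.
Proof. by move=> le_n H T /H[? ? h]; split=> // e /h e_n; apply: leq_trans e_n le_n. Qed.

Lemma tree_size_hd d : tree_size (tree_hd d) <= tree_size d.
Proof. by case: d => //= a b; lia. Qed.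

Lemma tree_size_tl d : tree_size (tree_tl d) <= tree_size d.
Proof. by case: d => //= a b; lia. Qed.

(** [m * m] counts the pairs of states combined at a disjoint union, and [2] the candidates of a
    leaf. A leaf node copies its vertex from [t]; the other nodes hold two positions each. *)
Lemma cands_inv U0 U1 stk t n (cs := cands U0 U1 stk t) (m := size (powl U1)) :
  stack_ok U1 n stk ->
  [/\ {subset unzip1 cs <= powl U1}, size cs <= m * m + 2
    & forall g : tree, g \in unzip2 cs -> tree_size g <= tree_size t + 4 * n + 20].
Proof.
move=> ok; have ok1 := top_ok ok; have ok2 := top_ok (behead_ok ok).
have m_gt0 : 0 < m by rewrite /m size_powl expn_gt0.
have s1 := table_ok_size ok1; have s2 := table_ok_size ok2.
have s1m : size (head [::] stk) <= m * m + 2.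
  by apply: leq_trans s1 _; rewrite -/m; have := leq_mul m_gt0 (leqnn m); lia.
have un i j : i < n -> tree_size (Cons (enc_nat j) (Cons (enc_nat i) (enc_nat 0))) <= 
    tree_size t + 4 * n + (12 + 2 * j) by move=> ?; rewrite /= !tree_size_enc_nat; lia.
rewrite {}/cs /cands; case: ifP => _; last first.
  split; rewrite ?leq_addl //.
    by move=> k; rewrite /= !inE => /orP[] /eqP->; apply: filter_powl.
  have h : tree_size (tree_hd (tree_tl t)) <= tree_size t.
    exact: leq_trans (tree_size_hd _) (tree_size_tl _).
  by move=> g; rewrite /= !inE => /orP[] /eqP->; rewrite /t_map /=; lia.
case: ifP => _; last first.
  split.
  - by move=> k /mapP[c /allpairsP[[e1 e2] [_ _ ->]] ->]; apply: filter_powl.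
  - by rewrite size_allpairs; apply: leq_trans (leq_mul s1 s2) (leq_addr _ _).
  - move=> g /mapP[c /allpairsP[[[k1 i1] [k2 i2]] [h1 h2 ->]] -> /=].
    have [_ _ /(_ _ h1) /= l1] := ok1; have [_ _ /(_ _ h2) /= l2] := ok2.
    by rewrite !tree_size_enc_nat; lia.
case: ifP => _.
all: split; rewrite ?size_map //.
all: try by move=> k /mapP[c /mapP[e _ ->] ->]; apply: filter_powl.
all: move=> g /mapP[c /mapP[[k i] h ->] -> /=].
all: have [_ _ /(_ _ h) /= l] := ok1.
all: by rewrite !tree_size_enc_nat; lia.
Qed.

(** There is one initial node, and each tree brings at most [m * m + 2] candidates adding at most
    [m.+1] nodes each. The trees are arbitrary, so the time analysis does not rest on
    correctness. *)
Lemma run_inv U0 U1 ts (m := size (powl U1))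
    (sd := foldl (run_step U0 U1) ([::], [:: Cons Nil Nil]) ts) :
  [/\ stack_ok U1 (size sd.2) sd.1, size sd.1 <= size ts,
      0 < size sd.2 <= 1 + size ts * ((m * m + 2) * m.+1)
    & forall g, g \in sd.2 -> tree_size g <= tree_size (enc_seq id ts) + 4 * size sd.2 + 20].
Proof.
rewrite {}/sd; elim/last_ind: ts => [|ts t IH].
  by split=> // g; rewrite inE => /eqP->.
rewrite foldl_rcons size_rcons; case: (foldl _ _ _) IH => stk d [h1 h2 h3 h4].
rewrite /= in h1 h2 h3 h4.
have [c1 c2 c3] := cands_inv U0 t h1; rewrite /run_step.
have := addcands_inv d c1; cbv zeta; rewrite -/m in c2 *.
case: (foldl _ _ _) => T d' /= [g1 g2 g3 g4 g5].
have tst : tree_size (enc_seq id (rcons ts t)) = (tree_size (enc_seq id ts) + tree_size t).+1.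
  by rewrite -cats1; have /= := tree_size_cat id ts [:: t]; lia.
have le_d : size d <= size d' by case/andP: g4.
split.
- move=> T'; rewrite inE => /predU1P[->|]; first by split.
  by apply: (stack_ok_le le_d); apply: pop_ok.
- rewrite ltnS /pop; apply: leq_trans h2; do 2?case: ifP => _ //; rewrite !size_behead; lia.
- move: (leq_mul c2 (leqnn m.+1)) g4 h3; rewrite mulSn -/m.
  move: (size (cands U0 U1 stk t) * m.+1) ((m * m + 2) * m.+1) => a K.
  by move: (size ts * K) (size d) (size d') => *; lia.
- move=> g /g5[/h4|/c3|]; rewrite ?tst; move: (tree_size t) (tree_size g) le_d => *; lia.
Qed.

Definition enc_sd := enc_pair (enc_seq enc_table) enc_nodes.

Lemma PT_run X (P : X -> Prop) sz inp (U0 : X -> prof) (U1 : X -> state) (ts : X -> seq tree) :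
  PT P sz inp (fun x => enc_seq id (U0 x)) -> PT P sz inp (fun x => enc_state (U1 x)) ->
  PT P sz inp (fun x => enc_seq id (ts x)) -> polyO P sz (fun x => size (powl (U1 x))) ->
  PT P sz inp (fun x => enc_sd (foldl (run_step (U0 x) (U1 x)) ([::], [:: Cons Nil Nil]) (ts x))).
Proof.
move=> HU0 HU1 Hts HK Hi; move: (Hi).
have [szU1 _] := HU1 Hi; have [szt _] := Hts Hi.
pose m x := size (powl (U1 x)); pose t x := tree_size (enc_seq id (ts x)).
pose u x := tree_size (enc_state (U1 x)).
pose n x := 1 + t x * ((m x * m x + 2) * (m x).+1).
pose Tb x := m x * (u x + 2 * n x + 2).+1 + 1.
pose B x := t x + 4 * n x + 20.
apply: (@PT_foldl _ P sz inp _ _ _ enc_sd ts (fun=> ([::], [:: Cons Nil Nil]))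
   (fun x => run_step (U0 x) (U1 x)) Hts).
- by apply: PT_const (Cons Nil (Cons (Cons Nil Nil) Nil)).
- apply: (polyO_le_fst (P := P) (g := fun x => t x * (Tb x).+1 + 1 + (n x * (B x).+1 + 1) + 1));
    last by rewrite /B /Tb /n; poly.
  move=> x l1 [/= Px [l2 El]]; split=> //.
  have [] := run_inv (U0 x) (U1 x) l1; case: (foldl _ _ _) => stk d /= h1 h2 h3 h4.
  have l1t : tree_size (enc_seq id l1) <= t x by rewrite /t El; apply: tree_size_prefix.
  have l1s : size l1 <= t x by apply: leq_trans l1t; apply/ltnW/size_enc_seq.
  have dn : size d <= n x.
    case/andP: h3 => _ h3; apply: leq_trans h3 _; rewrite leq_add2l.
    by apply: leq_mul => //; rewrite /m.
  have dB g : g \in d -> tree_size g <= B x by move=> /h4; rewrite /B; lia.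
  have TB T : T \in stk -> tree_size (enc_table T) <= Tb x.
    move=> /h1 okT; have [uT sT iT] := okT.
    have [] // := @td_size T d (m x) (n x) (u x) (B x) _ dn iT _ dB.
      exact: table_ok_size okT.
    by move=> k /sT /In_memP; apply: tree_size_powl.
  have : tree_size (enc_seq enc_table stk) <= t x * (Tb x).+1 + 1.
    apply: leq_trans (tree_size_seq_mem TB) _; rewrite leq_add2r leq_mul2r.
    by rewrite (leq_trans h2) ?orbT.
  have : tree_size (enc_nodes d) <= n x * (B x).+1 + 1.
    by apply: leq_trans (tree_size_seq_mem dB) _; rewrite leq_add2r leq_mul2r dn orbT.
  rewrite /enc_sd /enc_pair /=; move: (tree_size (enc_nodes d)) (tree_size (enc_seq enc_table stk)).
  by move=> *; lia.
set Q := fun y : _ * (_ * _) => _.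
have QP y : Q y -> P y.1 by case.
have up o : PT P sz inp o -> PT Q (fun y => sz y.1)
   (fun y => Cons (id y.2.2) (Cons (enc_sd y.2.1) (inp y.1))) (fun y => o y.1).
  move=> Ho; apply: (PT_comp (PT_tl (PT_tl (@PT_id _ _ _ _)))) => _.
  by apply: PT_rel (Ho Hi) => y Qy; exists y.1; split=> //; apply: QP.
have H : PT Q (fun y => sz y.1) (fun y => Cons (id y.2.2) (Cons (enc_sd y.2.1) (inp y.1)))
   (fun y => enc_td (foldl addcand ([::], y.2.1.2) (cands (U0 y.1) (U1 y.1) y.2.1.1 y.2.2))).
  apply: (PT_addcands (sz := fun y => sz y.1) (Ks := fun y => powl (U1 y.1))).
  - apply: (PT_cands (sz := fun y => sz y.1)).
    + exact: (up _ HU0).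
    + exact: (up _ HU1).
    + by pt_solve 4.
    + by pt_solve 2.
  - by pt_solve 4.
  - move=> [x [sd e]] [/= _ [l1 [l2 [_ ->]]]].
    have [h _ _ _] := run_inv (U0 x) (U1 x) l1.
    by have [] := cands_inv (U0 x) e h.
  - by apply: (polyO_le_fst _ HK) => x y [].
apply: PT_cons (PT_tl H); apply: PT_cons (PT_hd H) _.
by apply: (PT_pop (sz := fun y => sz y.1)); pt_solve 4.
Qed.

Lemma fin_inv (T : table) (d : dag) (l1 : table) n (d' := foldl fin_step (Cons Nil Nil :: d) l1) :
  (forall e : state * nat, e \in T -> e.2 < n) -> {subset l1 <= T} -> size d < size d' /\
  size d' <= (size d).+1 + size l1 /\ 
  tree_size (enc_nodes d') <= tree_size (enc_nodes d) + 4 + size l1 * (4 * (n + (size d).+1 + size l1) + 21).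
Proof.
move=> Tn; rewrite {}/d'; elim/last_ind: l1 => [|l1 e IH] sub; first by rewrite /=; lia.
have [|h1 [h2 h3]] := IH.
  by move=> e' el; apply: sub; rewrite mem_rcons inE el orbT.
have en : e.2 < n by apply/Tn/sub; rewrite mem_rcons mem_head.
rewrite foldl_rcons size_rcons; move: (foldl _ _ _) h1 h2 h3 => d' h1 h2 h3.
set K := 4 * (n + (size d).+1 + size l1) + 21 in h3.
have -> : 4 * (n + (size d).+1 + (size l1).+1) + 21 = K + 4 by rewrite /K; lia.
rewrite mulSn mulnDr /fin_step; case: ifP => _; last first.
  by move: (size d) (size d') (size l1 * K) (tree_size (enc_nodes d)) h1 h2 h3 => *; lia.
have : tree_size (t_union e.2 (size d').-1) <= 4 * (n + (size d).+1 + size l1) + 20.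
  by apply: t_union_size; lia.
move: (t_union _ _) => w.
have -> : 4 * (n + (size d).+1 + size l1) + 20 = K - 1 by rewrite /K; lia.
have : 0 < K by rewrite /K; lia.
rewrite [enc_nodes _]/= [tree_size (Cons _ _)]/= [size (_ :: _)]/= -/(enc_nodes d').
move: (tree_size w) (size d) (size d') (size l1 * K) (tree_size (enc_nodes d)) h1 h2 h3 => *.
lia.
Qed.

Lemma PT_finish X (P : X -> Prop) sz inp (T : X -> table) d :
  PT P sz inp (fun x => enc_table (T x)) -> PT P sz inp (fun x => enc_nodes (d x)) ->
  PT P sz inp (fun x => enc_nodes (finish (T x) (d x))).
Proof.
move=> HT Hd Hi; move: (Hi); have [szT _] := HT Hi; have [szd _] := Hd Hi.
pose t x := tree_size (enc_table (T x)); pose n x := tree_size (enc_nodes (d x)).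
apply: (@PT_foldl _ P sz inp _ _ _ enc_nodes T (fun x => Cons Nil Nil :: d x) (fun=> fin_step) HT).
- by apply: PT_cons Hd; exact: PT_const.
- apply: (polyO_le_fst (P := P) (g := fun x => n x + 4 + t x * (4 * (t x + (n x).+1 + t x) + 21)));
    last by poly.
  move=> x l1 [/= Px [l2 El]]; split=> //.
  have [|e|_ [_ h]] := @fin_inv (T x) (d x) l1 (t x).
  + move=> [k i] /(tree_size_mem (enc_pair enc_state enc_nat)).
    by rewrite /enc_pair /= tree_size_enc_nat -/(enc_table _) -/(t x); lia.
  + by rewrite El mem_cat => ->.
  + apply: leq_trans h _; rewrite -/(n x) leq_add2l.
    have a1 : size l1 <= t x.
      apply: (@leq_trans (size (T x))); first by rewrite El size_cat leq_addr.
      exact/ltnW/size_enc_seq.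
    have a2 : size (d x) <= n x by exact/ltnW/size_enc_seq.
    by apply: leq_mul => //; lia.
apply: PT_ext (PT_ite (c := fun y => accept y.2.2.1)
   (a := fun y => enc_nodes (t_union y.2.2.2 (size y.2.1).-1 :: y.2.1))
   (b := fun y => enc_nodes y.2.1) _ _ _).
- by move=> y _; rewrite /fin_step; case: ifP.
- by apply: PT_accept; pt_solve 3.
- apply: PT_cons; last by pt_solve 3.
  apply: PT_cons; first exact: PT_const.
  apply: PT_cons; first by pt_solve 3.
  have H : forall Q, PT Q (fun y : X * (dag * (state * nat)) => sz y.1)
      (fun y => Cons (enc_pair enc_state enc_nat y.2.2) (Cons (enc_nodes y.2.1) (inp y.1)))
      (fun y => enc_nat (size y.2.1)).
    by move=> Q; apply: (PT_size (encE := id)); pt_solve 3.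
  by apply: PT_ext (PT_tl (H _)) => y _; case: (size _).
- by pt_solve 3.
Qed.

(** * Traversal, labels and the total running time *)

Lemma children_size t : sumn [seq tree_size c | c <- children t] < tree_size t.
Proof.
have h1 := tree_size_hd t; have h2 := tree_size_tl (tree_tl t).
case: t h1 h2 => [|[|g1 g2] r] //= h1 h2; rewrite /children //=.
have := tree_size_gt0 g1; have := tree_size_gt0 g2.
by case: ifP => _ /=; case: r h1 h2 => [|r1 r2] /=; lia.
Qed.

Lemma PT_children X (P : X -> Prop) sz inp t :
  PT P sz inp t -> PT P sz inp (fun x => enc_seq id (children (t x))).
Proof.
move=> Ht.
apply: PT_ext (PT_ite (c := fun x => nonnil (tree_hd (t x))) (a := fun x =>
    if nonnil (tree_tl (tree_hd (t x))) then Cons (tree_tl (tree_tl (t x))) Nil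
    else Cons (tree_hd (tree_tl (t x))) (Cons (tree_tl (tree_tl (t x))) Nil))
    (b := fun=> Nil) _ _ _); last exact: PT_nil.
- by move=> x _; rewrite /children; case: nonnil => //; case: nonnil.
- exact/PT_nonnil/PT_hd.
- apply: PT_ite; first exact/PT_nonnil/PT_tl/PT_hd.
    by apply: PT_cons; [exact/PT_tl/PT_tl | exact: PT_nil].
  by do ?apply: PT_cons; [exact/PT_hd/PT_tl | exact/PT_tl/PT_tl | exact: PT_nil].
Qed.

Definition todo_size (to : seq tree * seq tree) := sumn [seq tree_size c | c <- to.1].

Lemma tr_step_size to : ~~ nilp to.1 -> todo_size (tr_step to) < todo_size to.
Proof.
case: to => -[|t s] o //= _; rewrite /todo_size /= map_cat sumn_cat ltn_add2r.
exact: children_size.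
Qed.

Lemma PT_postorder X (P : X -> Prop) sz inp t :
  PT P sz inp t -> PT P sz inp (fun x => enc_seq id (postorder (t x))).
Proof.
move=> Ht Hi; have [szt _] := Ht Hi; move: Hi.
pose encS (to : seq tree * seq tree) := Cons (enc_seq id to.1) (enc_seq id to.2).
have H : PT P sz inp (fun x => encS (iter (todo_size ([:: t x], [::])) tr_step ([:: t x], [::]))).
  apply: (@PT_iter _ P sz inp _ (fun=> encS) (fun=> tr_step) (fun x => ([:: t x], [::]))
     (fun=> todo_size)).
  - by apply: PT_cons; [apply: PT_cons => //|]; exact: PT_nil.
  - by move=> x to _ _ /=; rewrite nonnil_enc_seq; apply: tr_step_size.
  - by move=> x to _ _ /=; rewrite nonnil_enc_seq negbK; case: to => -[].
  - by apply: polyO_le szt => x _; rewrite /todo_size /= addn0.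
  - pose n x := tree_size (t x).
    apply: (polyO_le_fst (P := P) (g := fun x => 2 * n x + 1 + (n x * (n x).+1 + 1) + 1)); last by poly.
    move=> x to [/= Px [i ->]]; split=> //.
    set st := iter _ _ _.
    (* Each visit puts one tree on the output and lowers the potential by at least one, so their sum
       never exceeds the initial size. *)
    have [h1 h2] : todo_size st + size st.2 <= n x /\ (forall g : tree, g \in st.2 -> tree_size g <= n x).
      rewrite /st; elim: i {st} => [|i [h1 h2]]; first by rewrite /todo_size /= !addn0; split.
      rewrite iterS; case: (iter i _ _) h1 h2 => -[|c s] o h1 h2 //.
      have := @tr_step_size (c :: s, o) isT; split; first by move: h1; rewrite /=; lia.
      move=> g; rewrite /= inE => /predU1P[->|/h2//].
      by move: h1; rewrite /todo_size /=; lia.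
    have h3 : tree_size (enc_seq id st.1) <= 2 * todo_size st + 1.
      rewrite /todo_size; elim: st.1 => //= c s; have := tree_size_gt0 c; lia.
    have h4 : tree_size (enc_seq id st.2) <= n x * (n x).+1 + 1.
      apply: leq_trans (tree_size_seq_mem h2) _; rewrite leq_add2r leq_mul2r.
      by rewrite (leq_trans _ h1) ?leq_addl ?orbT.
    by rewrite /encS /=; lia.
  apply: PT_ext (PT_cons (a := fun y => enc_seq id (children (tree_hd (tree_hd (encS y.2))) ++ behead y.2.1))
     (b := fun y => enc_seq id (head Nil y.2.1 :: y.2.2)) _ _).
  - by move=> [x [[|c s] o]] [].
  - apply: PT_cat.
      by apply: PT_children; pt_solve 3.
    apply: PT_ext (PT_tl (PT_hd (@PT_id _ _ _ _))).
    by move=> [x [[|c s] o]] [].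
  - apply: PT_cons; last by pt_solve 2.
    apply: PT_ext (PT_hd (PT_hd (@PT_id _ _ _ _))).
    by move=> [x [[|c s] o]] [].
by apply: PT_ext (PT_tl H) => x _; rewrite /postorder /todo_size /= addn0.
Qed.

Lemma labelsE k : labels k = rev [seq enc_nat i | i <- iota 0 k].
Proof.
elim: k => // k IHk; rewrite /labels -addn1 nseqD foldl_cat -/(labels k) /=.
by rewrite iotaD map_cat rev_cat /= IHk size_rev size_map size_iota add0n.
Qed.

Lemma PT_labels X (P : X -> Prop) sz inp (k : X -> nat) :
  PT P sz inp (fun x => enc_nat (k x)) -> PT P sz inp (fun x => enc_seq id (labels (k x))).
Proof.
move=> Hk Hi; have [szk _] := Hk Hi; move: Hi.
have Hn : PT P sz inp (fun x => enc_seq id (nseq (k x) Nil)).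
  by apply: PT_ext Hk => x _; rewrite enc_nat_seq.
apply: (@PT_foldl _ P sz inp tree _ id (enc_seq id) (fun x => nseq (k x) Nil) (fun=> [::])
  (fun _ acc _ => enc_nat (size acc) :: acc) Hn).
- exact: PT_nil.
- pose n x := tree_size (enc_nat (k x)).
  apply: (polyO_le_fst (P := P) (g := fun x => n x * (n x).+1 + 1)); last by poly.
  move=> x l1 [/= Px [l2 El]]; split=> //.
  have kl : k x = size l1 + size l2 by rewrite -size_cat -El size_nseq.
  have -> : l1 = nseq (size l1) Nil.
    by have := congr1 (take (size l1)) El; rewrite take_size_cat // take_nseq ?kl ?leq_addr.
  rewrite -/(labels _) labelsE tree_size_rev.
  have nk : (size l1).*2 <= n x by rewrite /n tree_size_enc_nat kl; lia.
  apply: leq_trans (tree_size_seq_mem (B := n x) _) _.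
    move=> g /mapP[i]; rewrite mem_iota => ilt ->; rewrite tree_size_enc_nat; lia.
  by rewrite size_map size_iota leq_add2r leq_mul2r; apply/orP; right; lia.
- by apply: PT_cons; [apply: (PT_size (encE := id)) | ]; pt_solve 3.
Qed.

Lemma size_atoms k : size (atoms k) = 3 * k.
Proof. by rewrite size_allpairs labelsE size_rev size_map size_iota mulnC. Qed.

Lemma PT_atoms X (P : X -> Prop) sz inp (k : X -> nat) :
  PT P sz inp (fun x => enc_nat (k x)) -> PT P sz inp (fun x => enc_seq id (atoms (k x))).
Proof.
move=> Hk; apply: (PT_allpairs (enc2 := id) (PT_labels Hk)); last by apply: PT_cons; pt_solve 3.
exact: PT_const.
Qed.

(** The double exponential is the length of [powl (powl (atoms k))], the list of all possible table
    keys. *)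
Lemma PT_algorithm X (P : X -> Prop) sz inp (k : X -> nat) t :
  PT P sz inp (fun x => enc_nat (k x)) -> PT P sz inp t ->
  polyO P sz (fun x => 2 ^ 2 ^ (3 * k x)) ->
  PT P sz inp (fun x => enc_nodes (algorithm (k x) (t x))).
Proof.
move=> Hk Ht Hp; apply: PT_rev.
have H1 : polyO P sz (fun x => size (powl (powl (atoms (k x))))).
  by apply: polyO_le Hp => x _; rewrite !size_powl size_atoms.
have H2 : polyO P sz (fun x => 2 ^ size (atoms (k x))).
  by apply: polyO_le Hp => x _; rewrite size_atoms; apply/ltnW/ltn_expl.
have H := PT_run (PT_atoms Hk) (PT_powl (PT_atoms Hk) H2) (PT_postorder Ht) H1.
by apply: PT_finish; [apply: PT_top; exact: (PT_hd H) | exact: (PT_tl H)].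
Qed.

(** * States of vertex sets *)

Lemma mem_atoms k i c :
  (Cons (enc_nat i) (enc_nat c) \in atoms k) = (i < k) && (0 < c < 4).
Proof.
have -> : (Cons (enc_nat i) (enc_nat c) \in atoms k) =
    (enc_nat i \in labels k) && (enc_nat c \in [:: enc_nat 1; enc_nat 2; enc_nat 3]).
  apply/allpairsP/andP => [[[l c'] /= [h1 h2 [-> ->]]]|[h1 h2]] //.
  by exists (enc_nat i, enc_nat c).
rewrite labelsE mem_rev (mem_map enc_nat_inj) mem_iota add0n !inE !(inj_eq enc_nat_inj).
by congr (_ && _); case: c => [|[|[|[|c]]]].
Qed.

Section States.
Variables (V : finType) (k : nat).
Implicit Types (H : lgraph V k) (S : {set V}) (phi : {ffun V -> 'I_4}) (a : tree) (e : cwexpr V k).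

Definition in_color (c : nat) : bool := (c == 1) || (c == 2).

(** Colourings are total on [V]. For the graph of an expression, whose edges join its own vertices
    by [adj_verts], colours elsewhere matter neither here nor in the profile. *)
Definition valid H S phi : bool :=
  [forall v, (lg_lab H v != None) ==> (in_color (phi v) == (v \in S))] &&
  [forall u, forall v, lg_adj H u v ==> [|| phi u == 0 :> nat, phi v == 0 :> nat | phi u == phi v]].

Lemma validP H S phi : reflect
  ((forall v, lg_lab H v != None -> in_color (phi v) = (v \in S)) /\
   (forall u v, lg_adj H u v -> phi u != 0 :> nat -> phi v != 0 :> nat -> phi u = phi v))
  (valid H S phi).
Proof.
apply: (iffP andP) => -[h1 h2]; split.
- by move=> v Hv; move/forallP/(_ v)/implyP/(_ Hv)/eqP: h1.
- move=> u v uv u0 v0; move/forallP/(_ u)/forallP/(_ v)/implyP/(_ uv): h2.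
  by rewrite (negbTE u0) (negbTE v0) => /eqP.
- by apply/forallP => v; apply/implyP => Hv; rewrite h1.
- apply/forallP => u; apply/forallP => v; apply/implyP => uv.
  by case: eqVneq => //= u0; case: eqVneq => //= v0; rewrite (h2 u v).
Qed.

Definition has_atom H phi a : bool :=
  [exists v, if lg_lab H v is Some i then a == Cons (enc_nat i) (enc_nat (phi v)) else false].

Lemma has_atomP H phi a : reflect
  (exists v i, lg_lab H v = Some i /\ a = Cons (enc_nat i) (enc_nat (phi v))) (has_atom H phi a).
Proof.
apply: (iffP existsP) => [[v]|[v [i [Hv ->]]]].
  by case E: (lg_lab H v) => [i|] // /eqP->; exists v, i.
by exists v; rewrite Hv.
Qed.

Definition prof_of H phi : prof := [seq a <- atoms k | has_atom H phi a].

Definition state_of H S : state :=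
  [seq p <- powl (atoms k) | [exists phi, valid H S phi && (prof_of H phi == p)]].

Lemma state_ofP H S p :
  reflect (exists2 phi, valid H S phi & p = prof_of H phi) (p \in state_of H S).
Proof.
rewrite mem_filter; apply: (iffP andP) => [[/existsP[phi /andP[v /eqP<-]] _]|[phi v ->]].
  by exists phi.
split; last exact: filter_powl.
by apply/existsP; exists phi; rewrite v eqxx.
Qed.

(** States are canonical lists, so each operation on states only has to be checked on membership of
    profiles. *)
Lemma state_ofE H S l :
  (forall p, reflect (exists2 phi, valid H S phi & p = prof_of H phi) (p \in l)) ->
  state_of H S = norm (powl (atoms k)) l.
Proof.
move=> lP; apply: eq_in_filter => p pU; apply/existsP/lP => [[phi /andP[v /eqP<-]]|[phi v ->]].
  by exists phi.
by exists phi; rewrite v eqxx.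
Qed.

(** Allows the state of one side of a disjoint union to be computed from the restriction of the set
    to that side. *)
Lemma eq_state_of H S S' :
  (forall v, lg_lab H v != None -> (v \in S) = (v \in S')) -> state_of H S = state_of H S'.
Proof.
move=> eqS; apply: eq_filter => p; apply: eq_existsb => phi; congr (_ && _).
by apply/validP/validP => -[h1 h2]; split=> // v Hv; rewrite h1 ?eqS.
Qed.

Lemma prof_ofE H phi l :
  (forall a, a \in atoms k -> (a \in l) = has_atom H phi a) -> prof_of H phi = norm (atoms k) l.
Proof. by move=> E; apply: eq_in_filter => a aU; rewrite E. Qed.

Lemma adj_verts e u v : lg_adj (cw_graph e) u v ->
  lg_lab (cw_graph e) u != None /\ lg_lab (cw_graph e) v != None.
Proof.
elim: e => //= [e1 IH1 e2 IH2 /orP[/IH1|/IH2]|i j e IH /IH|i j e IH /or3P[/IH//||]].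
- by move=> [h1 h2]; split; [move: h1 | move: h2]; case: (lg_lab (cw_graph e1) _).
- by move=> [h1 h2]; split; case: (lg_lab (cw_graph e1) _).
- by move=> [u0 v0]; case: ifP => _; case: ifP.
- by case/andP=> /eqP-> /eqP->.
- by case/andP=> /eqP-> /eqP->.
Qed.

Lemma state_vertex v i S (U0 := atoms k) (U1 := powl U0) :
  state_of (cw_graph (CwVertex v i)) S =
  if v \in S then key_leaf U0 U1 (enc_nat i) (enc_nat 1) (enc_nat 2)
  else key_leaf U0 U1 (enc_nat i) (enc_nat 0) (enc_nat 3).
Proof.
have profE phi : prof_of (cw_graph (CwVertex v i)) phi = norm U0 [:: Cons (enc_nat i) (enc_nat (phi v))].
  apply: prof_ofE => a _; rewrite inE; apply/eqP/has_atomP => [->|[u [j /=]]].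
    by exists v, i; rewrite /= eqxx.
  by case; case: eqP => // -> [<-] ->.
have vld phi : valid (cw_graph (CwVertex v i)) S phi = (in_color (phi v) == (v \in S)).
  apply/validP/eqP => [[h _]|h]; first by apply: h; rewrite /= eqxx.
  by split=> // u /=; case: (u =P v) => [->|_ /eqP].
have [vS|vS] := boolP (v \in S); apply: state_ofE => p; rewrite !inE;
  apply: (iffP orP) => [[] /eqP->|[phi]].
- by exists [ffun=> inord 1]; rewrite ?vld ?profE ffunE inordK ?vS.
- by exists [ffun=> inord 2]; rewrite ?vld ?profE ffunE inordK ?vS.
- by rewrite vld vS => /eqP/orP[] /eqP h ->; rewrite profE h eqxx; auto.
- by exists [ffun=> inord 0]; rewrite ?vld ?profE ffunE inordK ?(negbTE vS).
- by exists [ffun=> inord 3]; rewrite ?vld ?profE ffunE inordK ?(negbTE vS).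
- rewrite vld (negbTE vS) => /eqP h ->; rewrite profE.
  by case: (phi v) h => [[|[|[|[|c]]]] lt_c] //= _; rewrite eqxx; auto.
Qed.

(** No edge joins the two sides, so valid colourings of the union are pairs of valid colourings,
    glued along the disjoint vertex sets. *)
Lemma state_union e1 e2 S (U0 := atoms k) (U1 := powl U0) :
  [disjoint lg_verts (cw_graph e1) & lg_verts (cw_graph e2)] ->
  state_of (cw_graph (CwUnion e1 e2)) S =
  key_union U0 U1 (state_of (cw_graph e1) S) (state_of (cw_graph e2) S).
Proof.
move=> dis; set H1 := cw_graph e1; set H2 := cw_graph e2; set H := cw_graph _.
have lab1 v : lg_lab H1 v != None -> lg_lab H v = lg_lab H1 v by rewrite /=; case: (lg_lab H1 v).
have lab2 v : lg_lab H2 v != None -> lg_lab H1 v = None /\ lg_lab H v = lg_lab H2 v.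
  move=> Hv; have : v \notin lg_verts H1.
    by apply/negP => v1; have := disjointFr dis v1; rewrite inE Hv.
  by rewrite inE negbK /= => /eqP->.
have profE phi : prof_of H phi = norm U0 (prof_of H1 phi ++ prof_of H2 phi).
  apply: prof_ofE => a aU; rewrite mem_cat !mem_filter aU !andbT.
  apply/orP/has_atomP => [[/has_atomP|/has_atomP]|] [v [i [Hv ->]]].
  - by exists v, i; rewrite lab1 Hv.
  - by exists v, i; rewrite (proj2 (lab2 v _)) Hv.
  - move: Hv; rewrite /=; case E: (lg_lab H1 v) => [j|] Hv.
      by left; apply/has_atomP; exists v, i; rewrite E.
    by right; apply/has_atomP; exists v, i.
apply: state_ofE => p; apply: (iffP allpairsP).
  move=> [[p1 p2] [/= /state_ofP[f1 /validP[v1 w1] ->] /state_ofP[f2 /validP[v2 w2] ->] ->]].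
  pose phi := [ffun v => if lg_lab H1 v is Some _ then f1 v else f2 v].
  have phi1 v : lg_lab H1 v != None -> phi v = f1 v by rewrite ffunE; case: (lg_lab H1 v).
  have phi2 v : lg_lab H2 v != None -> phi v = f2 v by move=> /lab2[E _]; rewrite ffunE E.
  have E1 : prof_of H1 f1 = prof_of H1 phi.
    apply: eq_filter => a; apply: eq_existsb => v.
    by case E: (lg_lab H1 v) => //; rewrite phi1 // E.
  have E2 : prof_of H2 f2 = prof_of H2 phi.
    apply: eq_filter => a; apply: eq_existsb => v.
    by case E: (lg_lab H2 v) => //; rewrite phi2 // E.
  exists phi; last by rewrite profE E1 E2.
  apply/validP; split.
    move=> v /=; case E: (lg_lab H1 v) => [i|] Hv; first by rewrite phi1 ?v1 ?E.
    by rewrite phi2 ?v2.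
  move=> u v /= /orP[] uv; have [hu hv] := adj_verts uv.
    by rewrite !phi1 //; apply: w1.
  by rewrite !phi2 //; apply: w2.
move=> [phi /validP[h1 h2] ->]; exists (prof_of H1 phi, prof_of H2 phi); split=> //=.
- apply/state_ofP; exists phi => //; apply/validP; split.
    by move=> v Hv; rewrite h1 // lab1.
  by move=> u v uv; apply: h2; rewrite /= uv.
- apply/state_ofP; exists phi => //; apply/validP; split.
    by move=> v Hv; rewrite h1 // (proj2 (lab2 v Hv)).
  by move=> u v uv; apply: h2; rewrite /= uv orbT.
Qed.

(** Vertices and edges stay the same, hence so does validity; only the labels inside the profiles
    move. *)
Lemma state_relabel i j e S (U0 := atoms k) (U1 := powl U0) :
  state_of (cw_graph (CwRelabel i j e)) S =
  key_relabel U0 U1 (enc_nat i) (enc_nat j) (state_of (cw_graph e) S).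
Proof.
set H0 := cw_graph e; set H := cw_graph _.
have labN v : (lg_lab H v != None) = (lg_lab H0 v != None).
  by rewrite /=; case: (lg_lab H0 v =P Some i) => [->|].
have vld phi : valid H S phi = valid H0 S phi.
  by apply/validP/validP => -[h1 h2]; split=> // v; [rewrite -labN | rewrite labN]; apply: h1.
have profE phi : prof_of H phi =
    norm U0 [seq relabel_atom (enc_nat i) (enc_nat j) a | a <- prof_of H0 phi].
  apply: prof_ofE => a aU; apply/mapP/has_atomP => [[b]|[v [l [Hv Ea]]]].
    rewrite mem_filter => /andP[/has_atomP[v [l [Hv ->]]] _] ->.
    rewrite /relabel_atom /= (inj_eq enc_nat_inj) (inj_eq (@ord_inj _)).
    exists v; case: (eqVneq l i) => [li|li]; [exists j | exists l]; rewrite /= Hv.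
      by rewrite li eqxx.
    by rewrite (inj_eq Some_inj) (negbTE li).
  move: Hv; rewrite /=; case E: (lg_lab (cw_graph e) v) => [l0|] //.
  exists (Cons (enc_nat l0) (enc_nat (phi v))).
    rewrite mem_filter; apply/andP; split; first by apply/has_atomP; exists v, l0.
    (* The colour is kept, so an atom of nonzero colour comes from an atom of nonzero colour. *)
    by move: aU; rewrite Ea !mem_atoms !ltn_ord.
  rewrite /relabel_atom /= (inj_eq enc_nat_inj) Ea.
  move: Hv; case: (eqVneq l0 i) => [->|ne].
    by rewrite eqxx => -[->]; rewrite eqxx.
  by rewrite (inj_eq Some_inj) (negbTE ne) => -[<-]; rewrite (inj_eq (@ord_inj _)) (negbTE ne).
apply: state_ofE => p; apply: (iffP mapP) => [[q /state_ofP[phi v ->] ->]|[phi v ->]].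
  by exists phi; rewrite ?vld ?profE.
exists (prof_of H0 phi); last exact: profE.
by apply/state_ofP; exists phi; rewrite -?vld.
Qed.

(** A colouring violates an added edge iff its profile shows labels [i] and [j] with different
    nonzero colours. The profile alone therefore decides which colourings survive. *)
Lemma state_join i j e S (U0 := atoms k) (U1 := powl U0) :
  state_of (cw_graph (CwJoin i j e)) S =
  key_join U1 (enc_nat i) (enc_nat j) (state_of (cw_graph e) S).
Proof.
set H0 := cw_graph e; set H := cw_graph _.
have confP phi : reflect (exists u v, [/\ lg_lab H0 u = Some i, lg_lab H0 v = Some j,
    phi u != 0 :> nat, phi v != 0 :> nat & phi u != phi v])
    (conflict (enc_nat i) (enc_nat j) (prof_of H0 phi)).
  apply: (iffP hasP) => [[a]|[u [v [Hu Hv u0 v0 uv]]]].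
    rewrite mem_filter => /andP[/has_atomP[u [l [Hu ->]]]]; rewrite mem_atoms => /andP[_ u0].
    move=> /hasP[b]; rewrite mem_filter => /andP[/has_atomP[v [l' [Hv ->]]]].
    rewrite mem_atoms => /andP[_ v0] /= /and3P[].
    rewrite !(inj_eq enc_nat_inj) !(inj_eq (@ord_inj _)) => /eqP El /eqP El' ne.
    exists u, v; split; rewrite ?Hu ?Hv ?El ?El' //.
      by case/andP: u0; rewrite lt0n.
    by case/andP: v0; rewrite lt0n.
  have mem w l : lg_lab H0 w = Some l -> phi w != 0 :> nat ->
      Cons (enc_nat l) (enc_nat (phi w)) \in prof_of H0 phi.
    move=> Hw w0; rewrite mem_filter mem_atoms !ltn_ord lt0n w0 !andbT.
    by apply/has_atomP; exists w, l.
  exists (Cons (enc_nat i) (enc_nat (phi u))); first exact: mem.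
  apply/hasP; exists (Cons (enc_nat j) (enc_nat (phi v))); first exact: mem.
  by rewrite /= !eqxx (inj_eq enc_nat_inj) (inj_eq (@ord_inj _)) uv.
have vld phi : valid H S phi = valid H0 S phi && ~~ conflict (enc_nat i) (enc_nat j) (prof_of H0 phi).
  apply/validP/andP => [[h1 h2]|[/validP[h1 h2] /confP nc]].
    split.
      by apply/validP; split=> [|u v uv]; [exact: h1 | apply: h2; rewrite /= -/H0 uv].
    apply/negP => /confP[u [v [Hu Hv u0 v0 /eqP uv]]]; apply: uv; apply: h2 => //=.
    by rewrite -/H0 Hu Hv !eqxx orbT.
  split=> // u v /= /or3P[uv|/andP[/eqP Hu /eqP Hv]|/andP[/eqP Hu /eqP Hv]] u0 v0.
  - exact: h2.
  - by apply/eqP/negP => /negP uv; apply: nc; exists u, v.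
  - by apply/eqP/negP => /negP uv; apply: nc; exists v, u; split=> //; rewrite eq_sym.
apply: state_ofE => p; rewrite mem_filter.
apply: (iffP andP) => [[nc /state_ofP[phi v E]]|[phi]].
  by exists phi; rewrite // vld v -E.
by rewrite vld => /andP[v nc] ->; split=> //; apply/state_ofP; exists phi.
Qed.

Lemma accept_connected_dominating (G : sgraph V) e S :
  is_kexpr_of e G -> accept (state_of (cw_graph e) S) = connected_dominating G S.
Proof.
move=> [_ [l [labE adjE]]]; set H := cw_graph e.
have verts v : lg_lab H v != None by rewrite labE.
have memP phi v : phi v != 0 :> nat ->
    Cons (enc_nat (l v)) (enc_nat (phi v)) \in prof_of H phi.
  move=> v0; rewrite mem_filter mem_atoms !ltn_ord lt0n v0 !andbT.
  by apply/has_atomP; exists v, (l v).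
have acceptP : reflect (forall phi, valid H S phi -> (forall v, phi v != 3 :> nat) /\
     (forall u v, phi u != 0 :> nat -> phi v != 0 :> nat -> phi u = phi v))
   (accept (state_of H S)).
  apply: (iffP allP) => [acc phi vphi|h p /state_ofP[phi /h[h1 h2] ->]].
    have /allP hp : all _ (prof_of H phi) := acc _ (introT (state_ofP _ _ _) (ex_intro2 _ _ phi vphi erefl)).
    split=> [v|u v u0 v0].
      apply/negP => /eqP v3; have v0 : phi v != 0 :> nat by rewrite v3.
      by have /andP[] := hp _ (memP phi v v0); rewrite /= v3 eqxx.
    have /andP[_ /allP/(_ _ (memP phi v v0))] := hp _ (memP phi u u0).
    by rewrite /= (inj_eq enc_nat_inj) => /eqP/val_inj.
  apply/allP => a; rewrite mem_filter => /andP[/has_atomP[u [i [Hu ->]]]].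
  rewrite mem_atoms => /andP[_ /andP[u0 _]].
  rewrite [tree_tl _]/= (inj_eq enc_nat_inj) h1 /=.
  apply/allP => b; rewrite mem_filter => /andP[/has_atomP[v [j [Hv ->]]]].
  rewrite mem_atoms => /andP[_ /andP[v0 _]] /=.
  by rewrite (h2 u v) // -lt0n.
apply/acceptP/andP => [acc|[/eqP dom /forallP conn] phi /validP[h1 h2]].
  split.
    apply/eqP/setP => v; rewrite inE; apply/negPn/negP => nv.
    have vS : v \notin S.
      by apply: contra nv => vS; apply/bigcupP; exists v => //; rewrite !inE eqxx orbT.
    have nadj u : u \in S -> adj G u v = false.
      move=> uS; apply/negP => uv; move/negP: nv; apply.
      by apply/bigcupP; exists u => //; rewrite !inE uv.
    (* An undominated [v] gets colour 3 and all of [S] colour 1; this is valid because [v] has no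
       neighbour in [S]. *)
    pose phi := [ffun u => if u == v then inord 3 else if u \in S then inord 1 else inord 0 : 'I_4].
    have /acc[/(_ v)] : valid H S phi; last by rewrite ffunE eqxx inordK.
    apply/validP; split=> [u _|u w].
      rewrite ffunE; case: eqP => [->|_]; first by rewrite inordK // (negbTE vS).
      by case: ifP; rewrite inordK.
    rewrite /H adjE !ffunE.
    case: (u =P v) => [->|_]; case: (w =P v) => [->|_] //.
    - case: ifP => [wS|_]; last by rewrite !inordK.
      by rewrite adj_sym nadj.
    - case: ifP => [uS|_]; last by rewrite !inordK.
      by rewrite nadj.
    - by do 2 case: ifP => _ //; rewrite !inordK.
  apply/forallP => u; apply/implyP => uS; apply/forallP => v; apply/implyP => vS.
  apply/negPn/negP => nuv.
  (* The part of [S] reachable from [u] inside [S] gets colour 1 and the rest of [S] colour 2. No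
     edge joins the two parts, while [u] and [v] receive different colours. *)
  pose phi := [ffun w => if w \in S then
     if connect (induced_adj G S) u w then inord 1 else inord 2 else inord 0 : 'I_4].
  have /acc[_ /(_ u v)] : valid H S phi; last first.
    rewrite !ffunE uS vS connect0 (negbTE nuv) !inordK // => /(_ isT isT) /(congr1 val).
    by rewrite /= !inordK.
  apply/validP; split=> [w _|w z].
    by rewrite ffunE; case: ifP => _; first case: ifP => _; rewrite inordK.
  rewrite /H adjE !ffunE => wz.
  case wS: (w \in S); last by rewrite inordK.
  case zS: (z \in S); last by rewrite [nat_of_ord (inord 0)]inordK.
  move=> _ _; suff -> : connect (induced_adj G S) u w = connect (induced_adj G S) u z by [].
  have csym : connect_sym (induced_adj G S).
    by apply: sym_connect_sym => x y; rewrite /induced_adj /= adj_sym andbCA.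
  by apply: (same_connect_r csym); apply: connect1; rewrite /induced_adj /= wS zS.
have S12 v : v \in S -> phi v != 0 :> nat.
  by move=> vS; have := h1 v (verts v); rewrite vS; case: eqP => // ->.
(* A vertex of colour 3 lies outside [S], so it has a neighbour in [S]. That neighbour has a nonzero
   colour, which by validity is 3 as well, impossible in [S]. *)
have no3 v : phi v != 3 :> nat.
  apply/negP => /eqP v3; have vS : v \notin S by rewrite -(h1 v (verts v)) v3.
  have : v \in closed_nbhds G S by rewrite dom inE.
  case/bigcupP=> u uS; rewrite !inE => /orP[uv|/eqP vu]; last by rewrite vu uS in vS.
  have := h2 u v; rewrite adjE => /(_ uv (S12 u uS)); rewrite v3 => /(_ isT) uv3.
  by have := h1 u (verts u); rewrite uS uv3 v3.
split=> // u v u0 v0.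
have inS w : phi w != 0 :> nat -> w \in S.
  move=> w0; rewrite -(h1 w (verts w)).
  by move: w0 (no3 w); case: (phi w) => [[|[|[|[|c]]]] lt_c].
have uS := inS u u0; have vS := inS v v0.
have /implyP/(_ uS)/forallP/(_ v)/implyP/(_ vS)/connectP[p pth ->] := conn u.
(* Validity makes the colour constant along a path inside [S]. *)
elim: p u {u0 uS} pth => //= w p IHp u /andP[/and3P[uS wS uw] pth].
by rewrite -(IHp w pth); apply: h2; rewrite ?adjE ?S12.
Qed.

End States.

(** * Semantics of the constructed DAG *)

Section DagSemantics.
Variables (V : finType).
Local Notation node := (junode V bool).
Local Notation pfun := {ffun V -> option bool}.
Implicit Types (D : seq node) (g : node) (W : {set V}) (A B : {set pfun}).

Lemma dag_exprs_rcons D g :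
  dag_exprs (rcons D g) = rcons (dag_exprs D) (node_expr (dag_exprs D) g).
Proof. by rewrite /dag_exprs foldl_rcons. Qed.

Lemma size_dag_exprs D : size (dag_exprs D) = size D.
Proof. by elim/last_ind: D => // D g IHD; rewrite dag_exprs_rcons !size_rcons IHD. Qed.

(** Expressions are built from left to right, so appending nodes never changes an earlier one. This
    keeps the tables computed so far meaningful. *)
Lemma nth_dag_exprs_cat D D' i :
  i < size D -> nth JUEmpty (dag_exprs (D ++ D')) i = nth JUEmpty (dag_exprs D) i.
Proof.
move=> iD; elim/last_ind: D' => [|D' g IHD]; first by rewrite cats0.
by rewrite -rcons_cat dag_exprs_rcons nth_rcons size_dag_exprs size_cat ltn_addr.
Qed.

Definition nodes_wf D : bool := all (fun m => node_wf m (nth NEmpty D m)) (iota 0 (size D)).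

Lemma nodes_wf_rcons D g : nodes_wf D -> node_wf (size D) g -> nodes_wf (rcons D g).
Proof.
move=> /allP wD wg; apply/allP => m; rewrite mem_iota size_rcons ltnS => /= m_le.
rewrite nth_rcons; case: ltngtP m_le => // [m_lt _|-> //].
by apply: wD; rewrite mem_iota.
Qed.

(* The domain may be smaller than [W] only for an expression without solutions;
   such an expression is absorbed by every union. *)
Definition expr_sem (E : juexpr V bool) W A : Prop :=
  [/\ ju_sem E = Some A, ju_dom E \subset W & A != set0 -> ju_dom E = W].

(** Describes a node about to be appended, whose references are read in [D]; [node_sem_rcons] turns
    it into a statement about a position. *)
Definition node_sem D g W A : Prop :=
  node_wf (size D) g /\ expr_sem (node_expr (dag_exprs D) g) W A.

Definition idx_sem D i W A : Prop :=
  i < size D /\ expr_sem (nth JUEmpty (dag_exprs D) i) W A.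

Lemma idx_sem_cat D D' i W A : idx_sem D i W A -> idx_sem (D ++ D') i W A.
Proof. by case=> iD; split; [rewrite size_cat ltn_addr | rewrite nth_dag_exprs_cat]. Qed.

Lemma node_sem_cat D D' g W A : node_sem D g W A -> node_sem (D ++ D') g W A.
Proof.
case=> wg sg; split; first by case: g wg {sg} => //= i j /andP[iD jD];
  rewrite size_cat !ltn_addr.
by case: g wg sg => //= i j /andP[iD jD]; rewrite !nth_dag_exprs_cat.
Qed.

Lemma node_sem_rcons D g W A : node_sem D g W A -> idx_sem (rcons D g) (size D) W A.
Proof.
case=> wg sg; split; first by rewrite size_rcons.
by rewrite dag_exprs_rcons nth_rcons size_dag_exprs ltnn eqxx.
Qed.

(** [JUUnion] compares domains only if both families are nonempty, which is exactly when [expr_sem]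
    fixes both domains to [W]. *)
Lemma node_sem_union D i j W A B :
  idx_sem D i W A -> idx_sem D j W B -> [disjoint A & B] -> node_sem D (NUnion i j) W (A :|: B).
Proof.
move=> [iD [sA dA eA]] [jD [sB dB eB]] dis; split; first by rewrite /= iD jD.
split=> /=; last 1 first.
- have [->|A0] := eqVneq A set0.
    by rewrite set0U => B0; rewrite (eB B0); apply/setUidPr.
  by move=> _; rewrite (eA A0); apply/setUidPl.
- rewrite sA sB; have [->|B0] := eqVneq B set0; first by rewrite setU0.
  have [->|A0] := eqVneq A set0; first by rewrite set0U.
  by rewrite (eA A0) (eB B0) eqxx setI_eq0 dis.
- by rewrite subUset dA.
Qed.

(** [JUJoin] compares domains even for empty families; the inclusions of the domains in [W1] and
    [W2] make this test succeed. *)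
Lemma node_sem_join D i j W1 W2 A B :
  idx_sem D i W1 A -> idx_sem D j W2 B -> [disjoint W1 & W2] ->
  node_sem D (NJoin i j) (W1 :|: W2) [set pjoin f1 f2 | f1 in A, f2 in B].
Proof.
move=> [iD [sA dA eA]] [jD [sB dB eB]] dis; split; first by rewrite /= iD jD.
split=> /=.
- by rewrite sA sB setI_eq0 (disjointWl dA (disjointWr dB dis)).
- exact: setUSS.
- case/set0Pn=> f /imset2P[f1 f2 f1A f2B _].
  by rewrite eA ?eB //; apply/set0Pn; [exists f2 | exists f1].
Qed.

Lemma in_bigcup_seq (X : Type) (xs : seq X) (P : pred X) (B : X -> {set pfun}) f :
  (f \in \bigcup_(x <- xs | P x) B x) = has (fun x => P x && (f \in B x)) xs.
Proof.
elim: xs => [|x xs IHxs]; first by rewrite big_nil inE.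
by rewrite big_cons /=; case: ifP => _; rewrite ?inE IHxs.
Qed.

(** By the last clause, leaving a state out of the table loses no solution. *)
Definition table_sem D W (F : state -> {set pfun}) (T : table) : Prop :=
  [/\ uniq (unzip1 T), (forall e : state * nat, e \in T -> idx_sem D e.2 W (F e.1))
    & forall s : state, s \notin unzip1 T -> F s = set0].

Lemma table_sem_cat D D' W F T : table_sem D W F T -> table_sem (D ++ D') W F T.
Proof. by case=> uT sT nT; split=> // e /sT; apply: idx_sem_cat. Qed.

Lemma table_sem_ext D W F F' T : F =1 F' -> table_sem D W F T -> table_sem D W F' T.
Proof. by move=> eF [uT sT nT]; split=> // [e /sT|s /nT]; rewrite eF. Qed.

End DagSemantics.

(** * Semantics of the table operations *)

Section Encoded.
Variable n : nat.
Local Notation V := 'I_n.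
Local Notation node := (junode V bool).
Local Notation pfun := {ffun V -> option bool}.
Implicit Types (D : seq node) (g : node) (W : {set V}) (A B : {set pfun}) (d : dag).

Definition encodes D d : Prop := d = rev [seq enc_junode g | g <- D] /\ nodes_wf D.

Lemma encodes_size D d : encodes D d -> size d = size D.
Proof. by case=> -> _; rewrite size_rev size_map. Qed.

Lemma encodes_rcons D d g : encodes D d -> node_wf (size D) g -> encodes (rcons D g) (enc_junode g :: d).
Proof. by case=> -> wD wg; split; [rewrite map_rcons rev_rcons | exact: nodes_wf_rcons]. Qed.

Lemma insert_sem D d st idx (T : table) W F B (Td := insert st idx T d) :
  encodes D d -> table_sem D W F T -> idx_sem D idx W B -> [disjoint F st & B] ->
  exists D', encodes (D ++ D') Td.2 /\
    table_sem (D ++ D') W (fun s => if s == st then F s :|: B else F s) Td.1.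
Proof.
move=> eD [uT sT nT] sB dis; rewrite {}/Td /insert.
(* Keys are distinct, so at most one entry has key [st]. The current position stands for [B], and
   for [F st :|: B] once that entry has been met. *)
have [D' [eD' sI]] : exists D', let acc := foldl (ins_step st) ([::], idx, d) T in
    encodes (D ++ D') acc.2 /\
    idx_sem (D ++ D') acc.1.2 W (if st \in unzip1 T then F st :|: B else B).
  elim/last_ind: T uT sT {nT} => [|T e IHT] uT sT; first by exists [::]; rewrite cats0.
  have uTe : uniq (unzip1 T) /\ e.1 \notin unzip1 T.
    by move: uT; rewrite /unzip1 map_rcons rcons_uniq => /andP[].
  have [|e' e'T|D' [eD' sI]] := IHT; first by case: uTe.
    by apply: sT; rewrite mem_rcons inE e'T orbT.
  have := sT e; rewrite mem_rcons mem_head => /(_ isT)/(idx_sem_cat D') sE.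
  rewrite foldl_rcons /unzip1 map_rcons mem_rcons inE -/(unzip1 T).
  move: (foldl _ _ _) eD' sI => acc eD' sI; rewrite /= /ins_step eq_sym.
  case: eqVneq => [est|_] /=; last by exists D'.
  have sU : node_sem (D ++ D') (NUnion e.2 acc.1.2) W (F st :|: B).
    have stT : st \notin unzip1 T by rewrite est; case: uTe.
    by rewrite (negbTE stT) in sI; rewrite -est in sE; apply: node_sem_union.
  exists (rcons D' (NUnion e.2 acc.1.2)); rewrite -rcons_cat; split.
    by apply: (encodes_rcons (g := NUnion e.2 acc.1.2)) => //; case: sU.
  by rewrite (encodes_size eD'); apply: node_sem_rcons.
exists D'; split=> //=.
have tabE := ins_fold_table st idx d T; rewrite /= in tabE *.
move: (foldl _ _ _) eD' sI tabE => acc eD' sI tabE.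
have memF e : (e \in acc.1.1) = (e.1 != st) && (e \in T) by rewrite tabE mem_rev mem_filter.
split.
- rewrite /= tabE; apply/andP; split.
    apply/mapP => -[e]; rewrite mem_rev mem_filter => /andP[/eqP ne _] eq_e.
    by case: ne.
  rewrite /unzip1 map_rev rev_uniq; apply: subseq_uniq uT.
  exact/map_subseq/filter_subseq.
- move=> e; rewrite inE => /predU1P[->|]; last first.
    by rewrite memF => /andP[/negbTE-> eT]; apply/idx_sem_cat/sT.
  rewrite /= eqxx; move: sI; case: ifPn => // /nT ->; by rewrite set0U.
- move=> s; rewrite /= inE negb_or => /andP[sst sT']; rewrite (negbTE sst); apply: nT.
  apply: contra sT' => /mapP[e eT es]; rewrite es; apply: map_f; rewrite memF eT andbT.
  by rewrite -es.
Qed.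

(** The index type is arbitrary because candidates come from two booleans at a leaf, from table
    entries at a unary operation and from pairs of entries at a disjoint union. Disjointness of the
    [B x] allows those with equal key to be merged. *)
Lemma addcands_sem D d (X : eqType) (xs : seq X) (key : X -> state) (nd : X -> node) W
    (B : X -> {set pfun})
    (Td := foldl addcand ([::], d) [seq (key x, enc_junode (nd x)) | x <- xs]) :
  encodes D d -> uniq xs -> (forall x, x \in xs -> node_sem D (nd x) W (B x)) ->
  {in xs &, forall x y, x != y -> [disjoint B x & B y]} ->
  exists D', encodes (D ++ D') Td.2 /\
    table_sem (D ++ D') W (fun s => \bigcup_(x <- xs | key x == s) B x) Td.1.
Proof.
move=> eD; rewrite {}/Td; elim/last_ind: xs => [|xs x IHxs].
  move=> _ _ _; exists [::]; rewrite cats0; split=> //; split=> // s _.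
  by rewrite big_nil.
rewrite rcons_uniq => /andP[xN uxs] sxs dis.
have [//|y yxs|y z yxs zxs|D' [eD' sT]] := IHxs.
- by apply: sxs; rewrite mem_rcons inE yxs orbT.
- by apply: dis; rewrite mem_rcons inE ?yxs ?zxs orbT.
have sx : node_sem (D ++ D') (nd x) W (B x).
  by apply/node_sem_cat/sxs; rewrite mem_rcons mem_head.
rewrite map_rcons foldl_rcons; move: (foldl _ _ _) eD' sT => [T d'] eD' sT.
rewrite /= in eD' sT; rewrite /addcand [(_, _).1]/= [(_, _).2]/= [(_, _).2]/=.
have eD2 := encodes_rcons eD' (proj1 sx).
have sI := node_sem_rcons sx; rewrite -(encodes_size eD') in sI.
rewrite -cats1 in eD2 sI.
have [|D2 [eD3 sT3]] := insert_sem (st := key x) eD2 (table_sem_cat [:: nd x] sT) sI.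
  rewrite -setI_eq0; apply/eqP/setP => f; rewrite !inE in_bigcup_seq.
  apply/negP => /andP[/hasP[y yxs /andP[_ fy]] fx].
  have xy : x != y by apply: contraNneq xN => ->.
  have /disjointFr/(_ fx) : [disjoint B x & B y].
    by apply: dis => //; rewrite mem_rcons inE ?eqxx ?yxs ?orbT.
  by rewrite fy.
exists (D' ++ [:: nd x] ++ D2); rewrite !catA; split=> //.
apply: table_sem_ext sT3 => s /=.
rewrite -cats1 big_cat big_cons big_nil /= eq_sym.
by case: (key x == s); rewrite setU0.
Qed.

End Encoded.

(** * Correctness of the traversal *)

Section Postorder.
Variables n k : nat.

Fixpoint post (e : cwexpr 'I_n k) : seq tree :=
  match e with
  | CwVertex _ _ => [:: enc_cwexpr e]
  | CwUnion e1 e2 => post e2 ++ post e1 ++ [:: enc_cwexpr e]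
  | CwRelabel _ _ e1 | CwJoin _ _ e1 => post e1 ++ [:: enc_cwexpr e]
  end.

Lemma postorderE e : postorder (enc_cwexpr e) = post e.
Proof.
have H : forall e s o, exists m, iter m tr_step (enc_cwexpr e :: s, o) = (s, post e ++ o).
  elim=> [v i|e1 IH1 e2 IH2|i j e1 IH1|i j e1 IH1] s o.
  - by exists 1.
  - have [m1 E1] := IH1 (enc_cwexpr e2 :: s) (enc_cwexpr (CwUnion e1 e2) :: o).
    have [m2 E2] := IH2 s (post e1 ++ enc_cwexpr (CwUnion e1 e2) :: o).
    by exists (m2 + m1.+1); rewrite iterD iterSr [tr_step _]/= E1 E2 /= -!catA.
  - have [m1 E1] := IH1 s (enc_cwexpr (CwRelabel i j e1) :: o).
    by exists m1.+1; rewrite iterSr [tr_step _]/= E1 /= -catA.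
  - have [m1 E1] := IH1 s (enc_cwexpr (CwJoin i j e1) :: o).
    by exists m1.+1; rewrite iterSr [tr_step _]/= E1 /= -catA.
have fix_nil to m : nilp to.1 -> iter m tr_step to = to.
  by case: to => -[] //= o _; elim: m => //= m ->.
have stop : forall m to, todo_size to <= m -> nilp (iter m tr_step to).1.
  elim=> [|m IHm] to le_m.
    by case: (boolP (nilp to.1)) => // /tr_step_size; lia.
  have [nto|/tr_step_size lt] := boolP (nilp to.1); first by rewrite fix_nil.
  by rewrite iterSr; apply: IHm; lia.
have [m E] := H e [::] [::]; rewrite cats0 in E.
rewrite /postorder; set N := tree_size _; set to0 := (_, _).
have nN : nilp (iter N tr_step to0).1 by apply: stop; rewrite /todo_size /= addn0.
(* The traversal is stationary once its list is empty, so the exact number [m] of steps and the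
   budget [N] give the same result, whichever is larger. *)
have [le_mN|/ltnW le_Nm] := leqP m N.
  by rewrite -(subnK le_mN) iterD E fix_nil.
by rewrite -[LHS]/(iter N tr_step to0).2 -(fix_nil _ (m - N) nN) -iterD subnK // E.
Qed.

End Postorder.

(** * Indicator functions of subsets as partial functions *)

Section PartialFunctions.
Variable V : finType.
Local Notation pfun := {ffun V -> option bool}.
Implicit Types (f : pfun) (W : {set V}).

Definition pdom f : {set V} := [set v | f v != None].
Definition ones f : {set V} := [set v | f v == Some true].
Definition prestr (W : {set V}) f : pfun := [ffun v => if v \in W then f v else None].

Lemma pdom_pjoin f1 f2 : pdom (pjoin f1 f2) = pdom f1 :|: pdom f2.
Proof. by apply/setP => v; rewrite !inE ffunE; case: (f1 v). Qed.

Lemma pdom_prestr W f : W \subset pdom f -> pdom (prestr W f) = W.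
Proof.
move=> /subsetP sub; apply/setP => v; rewrite !inE ffunE; case: ifPn => // vW.
by have := sub v vW; rewrite inE.
Qed.

Lemma pjoin_prestr W1 W2 f : pdom f = W1 :|: W2 -> pjoin (prestr W1 f) (prestr W2 f) = f.
Proof.
move=> dom; apply/ffunP => v; rewrite !ffunE; case: ifPn => v1.
  by case: (f v) => //; case: ifP.
case: ifPn => // v2; have : v \notin pdom f by rewrite dom inE negb_or v1.
by rewrite inE negbK => /eqP.
Qed.

(** The parts of a join are recovered by restriction, so distinct pairs have distinct joins; this
    makes the candidates at a disjoint union pairwise disjoint. *)
Lemma prestr_pjoin W1 W2 f1 f2 : [disjoint W1 & W2] -> pdom f1 = W1 -> pdom f2 = W2 ->
  prestr W1 (pjoin f1 f2) = f1 /\ prestr W2 (pjoin f1 f2) = f2.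
Proof.
move=> dis d1 d2.
have out f W v : pdom f = W -> v \notin W -> f v = None.
  by move=> <-; rewrite inE negbK => /eqP.
split; apply/ffunP => v; rewrite !ffunE.
  case: ifPn => [|/(out _ _ _ d1)//]; rewrite -d1 inE; by case: (f1 v).
case: ifPn => [v2|/(out _ _ _ d2)//].
by rewrite (out f1 W1) // (disjointFl dis v2).
Qed.

Lemma in_ones_prestr W f v : v \in W -> (v \in ones (prestr W f)) = (v \in ones f).
Proof. by move=> vW; rewrite !inE ffunE vW. Qed.

End PartialFunctions.

(** * Correctness of the algorithm *)

Section Run.
Variables n k : nat.
Local Notation V := 'I_n.
Local Notation pfun := {ffun V -> option bool}.
Local Notation U0 := (atoms k).
Local Notation U1 := (powl (atoms k)).
Implicit Types (e : cwexpr V k) (D : seq (junode V bool)) (d : dag).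

Definition family e (s : state) : {set pfun} :=
  [set f | (pdom f == lg_verts (cw_graph e)) && (state_of (cw_graph e) (ones f) == s)].

(** All disjoint unions in the DAG rest on this: a function determines its state. *)
Lemma family_disjoint e s s' : s != s' -> [disjoint family e s & family e s'].
Proof.
move=> ne; rewrite -setI_eq0; apply/eqP/setP => f; rewrite !inE.
by apply/negP => /andP[/andP[_ /eqP->] /andP[_ /eqP E]]; rewrite E eqxx in ne.
Qed.

Definition starts_empty D : Prop := 0 < size D /\ nth JUEmpty (dag_exprs D) 0 = JUEmpty.

Lemma starts_empty_cat D D' : starts_empty D -> starts_empty (D ++ D').
Proof. by case=> h1 h2; split; [rewrite size_cat ltn_addr | rewrite nth_dag_exprs_cat]. Qed.

Lemma idx_sem_empty D W : starts_empty D -> idx_sem D 0 W set0.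
Proof. by case=> h1 h2; split=> //; rewrite h2; split; rewrite ?sub0set ?eqxx. Qed.

Lemma node_sem_copy D i W A :
  starts_empty D -> idx_sem D i W A -> node_sem D (NUnion i 0) W A.
Proof.
move=> hD hi; rewrite -[A]setU0; apply: node_sem_union hi (idx_sem_empty _ hD) _.
by rewrite -setI_eq0 setI0.
Qed.

Lemma table_neq D W e T (x y : state * nat) :
  table_sem D W (family e) T -> x \in T -> y \in T -> x != y -> x.1 != y.1.
Proof.
case=> uT _ _ xT yT; apply: contraNneq => exy.
elim: T uT xT yT => //= z T IHT /andP[zT uT]; rewrite !inE.
move=> /predU1P[Ex|xT] /predU1P[Ey|yT]; first by rewrite Ex Ey.
- by case/negP: zT; rewrite -Ex exy map_f.
- by case/negP: zT; rewrite -Ey -exy map_f.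
- exact: IHT.
Qed.

(** Serves relabelings and edge additions alike: the vertex set stays, and the new state is a
    function [key] of the old one. Even where [key] identifies states, the old families are disjoint
    and may be united. *)
Lemma unary_sem D d e e' (T : table) (key : state -> state)
    (Td := foldl addcand ([::], d) [seq (key x.1, t_union x.2 0) | x <- T]) :
  encodes D d -> starts_empty D -> table_sem D (lg_verts (cw_graph e)) (family e) T ->
  lg_verts (cw_graph e') = lg_verts (cw_graph e) ->
  (forall S, state_of (cw_graph e') S = key (state_of (cw_graph e) S)) ->
  exists D', encodes (D ++ D') Td.2 /\
    table_sem (D ++ D') (lg_verts (cw_graph e')) (family e') Td.1.
Proof.
move=> eD hD sT eW eS; rewrite {}/Td eW.
have [uT iT nT] := sT.
have [||x y xT yT ne|D' [eD' sT']] := @addcands_sem n D d _ T (fun x => key x.1)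
   (fun x => NUnion x.2 0) (lg_verts (cw_graph e)) (fun x => family e x.1) eD.
- exact: map_uniq uT.
- by move=> x /iT; apply: node_sem_copy.
- by apply: family_disjoint; apply: table_neq sT xT yT ne.
exists D'; split=> //; apply: table_sem_ext sT' => s; apply/setP => f.
rewrite in_bigcup_seq !inE eW; apply/hasP/andP.
  move=> [x xT /andP[/eqP <-]]; rewrite inE => /andP[-> /eqP E].
  by rewrite eS E.
rewrite eS => -[dom /eqP <-].
have : state_of (cw_graph e) (ones f) \in unzip1 T.
  apply/negPn/negP => /nT /setP/(_ f); by rewrite !inE dom eqxx.
case/mapP=> x xT E; exists x => //; by rewrite E eqxx inE dom E eqxx.
Qed.

(** Stack and DAG are arbitrary for the induction: a subexpression pushes one table and only appends
    nodes, so the tables below it stay valid. *)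
Lemma run_correct e stk d D :
  cw_wf e -> encodes D d -> starts_empty D ->
  exists D' T d', foldl (run_step U0 U1) (stk, d) (post e) = (T :: stk, d') /\
    encodes (D ++ D') d' /\
    table_sem (D ++ D') (lg_verts (cw_graph e)) (family e) T.
Proof.
elim: e stk d D => [v i|e1 IH1 e2 IH2|i j e1 IH1|i j e1 IH1] stk d D.
- move=> _ eD hD; rewrite [post _]/= [foldl _ _ _]/= /run_step [(stk, d).1]/= [(stk, d).2]/=.
  pose key b := if b then key_leaf U0 U1 (enc_nat i) (enc_nat 1) (enc_nat 2)
                else key_leaf U0 U1 (enc_nat i) (enc_nat 0) (enc_nat 3).
  pose f0 b : pfun := [ffun x => if x == v then Some b else None].
  have pd b : pdom (f0 b) = lg_verts (cw_graph (CwVertex v i)).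
    by apply/setP => x; rewrite !inE ffunE /=; case: (x == v).
  have fE f : pdom f = lg_verts (cw_graph (CwVertex v i)) -> f = f0 (v \in ones f).
    move=> dom; apply/ffunP => x; have /setP/(_ x) := dom; rewrite ffunE !inE /=.
    case: (x =P v) => [->|_]; first by case: (f v) => // -[].
    by case: (f x).
  have [||b b' _ _|D' [eD' sT']] := @addcands_sem n D d _ [:: true; false] key
     (fun b => NMap v b) [set v] (fun b => [set f0 b]) eD => //.
  + move=> ne; rewrite disjoints1 inE; apply: contraNneq ne => /ffunP/(_ v).
    by rewrite !ffunE eqxx => -[->].
  exists D', (foldl addcand ([::], d) [seq (key b, enc_junode (NMap v b)) | b <- [:: true; false]]).1.
  exists (foldl addcand ([::], d) [seq (key b, enc_junode (NMap v b)) | b <- [:: true; false]]).2.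
  split; first by [].
  split=> //.
  have -> : lg_verts (cw_graph (CwVertex v i)) = [set v].
    by apply/setP => x; rewrite !inE /=; case: (x == v).
  apply: table_sem_ext sT' => s; apply/setP => f; rewrite in_bigcup_seq inE state_vertex.
  apply/hasP/andP => [[b _ /andP[/eqP<-]]|[/eqP /fE Ef /eqP <-]].
    rewrite inE => /eqP->; split; first by rewrite pd.
    by rewrite inE ffunE eqxx; case: b.
  exists (v \in ones f); first by case: (v \in ones f).
  by rewrite in_set1 -Ef !eqxx.
- move=> /= /and3P[wf1 wf2 dis] eD hD.
  (* The second argument is processed first, so its table ends up below that of the first, where
     [cands] looks for it. *)
  have [D2 [T2 [d2 [E2 [eD2 sT2]]]]] := IH2 stk d D wf2 eD hD.
  have [D1 [T1 [d1 [E1 [eD1 sT1]]]]] := IH1 (T2 :: stk) d2 (D ++ D2) wf1 eD2 (starts_empty_cat _ hD).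
  rewrite !foldl_cat E2 E1 /= /run_step [(_, d1).1]/= [(_, d1).2]/=.
  have {}sT2 := table_sem_cat D1 sT2; set D0 := _ ++ D1 in eD1 sT1 sT2 *.
  have [u1 i1 n1] := sT1; have [u2 i2 n2] := sT2.
  set W1 := lg_verts (cw_graph e1) in dis sT1 i1 *; set W2 := lg_verts (cw_graph e2) in dis sT2 i2 *.
  pose xs := [seq (x, y) | x <- T1, y <- T2].
  pose key (z : (state * nat) * (state * nat)) := key_union U0 U1 z.1.1 z.2.1.
  pose nd (z : (state * nat) * (state * nat)) : junode V bool := NJoin z.1.2 z.2.2.
  pose B (z : (state * nat) * (state * nat)) : {set pfun} :=
    [set pjoin f1 f2 | f1 in family e1 z.1.1, f2 in family e2 z.2.1].
  have famD e s f : f \in family e s -> pdom f = lg_verts (cw_graph e).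
    by rewrite inE => /andP[/eqP].
  have [||z z' zT zT' ne|D' [eD' sT']] := @addcands_sem n D0 d1 _ xs key nd (W1 :|: W2) B eD1.
  + by apply: allpairs_uniq; [exact: map_uniq u1 | exact: map_uniq u2 | case=> ? ? []].
  + move=> z /allpairsP[[x y] /= [xT yT ->]].
    by apply: node_sem_join; [exact: i1 | exact: i2 | ].
  + rewrite -setI_eq0; apply/eqP/setP => f; rewrite !inE; apply/negP => /andP[].
    move=> /imset2P[f1 f2 F1 F2 Ef] /imset2P[g1 g2 G1 G2 Eg].
    have [r1 r2] := prestr_pjoin dis (famD _ _ _ F1) (famD _ _ _ F2).
    have [q1 q2] := prestr_pjoin dis (famD _ _ _ G1) (famD _ _ _ G2).
    rewrite -Ef Eg q1 q2 in r1 r2; subst f1 f2.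
    case/allpairsP: zT => -[x y] [/= xT yT Ez]; case/allpairsP: zT' => -[x' y'] [/= xT' yT' Ez'].
    subst z z'; rewrite /= in F1 F2 G1 G2.
    have ex : x = x'.
      apply/eqP/negPn/negP => /(table_neq sT1 xT xT').
      by move: F1 G1; rewrite !inE => /andP[_ /eqP->] /andP[_ ->].
    have ey : y = y'.
      apply/eqP/negPn/negP => /(table_neq sT2 yT yT').
      by move: F2 G2; rewrite !inE => /andP[_ /eqP->] /andP[_ ->].
    by rewrite ex ey eqxx in ne.
  have Exs : [seq (key_union U0 U1 x.1 y.1, t_join x.2 y.2) | x <- T1, y <- T2] =
      [seq (key z, enc_junode (nd z)) | z <- xs].
    by rewrite /xs map_allpairs.
  exists (D2 ++ D1 ++ D'), (foldl addcand ([::], d1) [seq (key z, enc_junode (nd z)) | z <- xs]).1.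
  exists (foldl addcand ([::], d1) [seq (key z, enc_junode (nd z)) | z <- xs]).2.
  split; first by rewrite -Exs.
  rewrite !catA -/D0; split=> //.
  have eW : lg_verts (cw_graph (CwUnion e1 e2)) = W1 :|: W2.
    by apply/setP => v; rewrite !inE /=; case: (lg_lab _ v).
  rewrite eW; apply: table_sem_ext sT' => s; apply/setP => f; rewrite in_bigcup_seq inE eW.
  have stE f1 f2 : pdom f1 = W1 -> pdom f2 = W2 -> state_of (cw_graph (CwUnion e1 e2)) (ones (pjoin f1 f2)) =
     key_union U0 U1 (state_of (cw_graph e1) (ones f1)) (state_of (cw_graph e2) (ones f2)).
    move=> df1 df2; have [r1 r2] := prestr_pjoin dis df1 df2.
    rewrite state_union //; congr (key_union _ _ _ _); apply: eq_state_of => v Hv.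
      by rewrite -{2}r1 in_ones_prestr // inE.
    by rewrite -{2}r2 in_ones_prestr // inE.
  apply/hasP/andP.
    move=> [z zT /andP[/eqP<- /imset2P[f1 f2 F1 F2 ->]]].
    have df1 := famD _ _ _ F1; have df2 := famD _ _ _ F2.
    rewrite pdom_pjoin df1 df2 eqxx stE //; split=> //.
    by move: F1 F2; rewrite !inE => /andP[_ /eqP->] /andP[_ /eqP->].
  move=> [/eqP dom /eqP <-].
  (* Conversely, a function on the whole domain splits into its restrictions; each belongs to the
     family of its own state, which is therefore a key of the table. *)
  set f1 := prestr W1 f; set f2 := prestr W2 f.
  have df1 : pdom f1 = W1 by rewrite pdom_prestr // dom subsetUl.
  have df2 : pdom f2 = W2 by rewrite pdom_prestr // dom subsetUr.
  have Ef : pjoin f1 f2 = f by exact: pjoin_prestr.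
  have k1 : state_of (cw_graph e1) (ones f1) \in unzip1 T1.
    by apply/negPn/negP => /n1 /setP/(_ f1); rewrite !inE df1 !eqxx.
  have k2 : state_of (cw_graph e2) (ones f2) \in unzip1 T2.
    by apply/negPn/negP => /n2 /setP/(_ f2); rewrite !inE df2 !eqxx.
  case/mapP: k1 => x xT Ex; case/mapP: k2 => y yT Ey.
  exists (x, y); first by apply: allpairs_f.
  rewrite /key /= -Ex -Ey -stE // Ef eqxx -Ef.
  by apply: imset2_f; rewrite inE ?df1 ?df2 -?Ex -?Ey !eqxx.
- move=> /= /andP[_ wf1] eD hD.
  have [D1 [T1 [d1 [E1 [eD1 sT1]]]]] := IH1 stk d D wf1 eD hD.
  rewrite foldl_cat E1 /= /run_step [(_, d1).1]/= [(_, d1).2]/=.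
  have [||D' [eD' sT']] := @unary_sem (D ++ D1) d1 e1 (CwRelabel i j e1) T1
    (key_relabel U0 U1 (enc_nat i) (enc_nat j)) eD1 (starts_empty_cat _ hD) sT1.
  + by apply/setP => v; rewrite !inE /=; case: (lg_lab _ v =P Some i) => [->|].
  + by move=> S; rewrite state_relabel.
  by exists (D1 ++ D'); do 2 eexists; split; first reflexivity; rewrite !catA.
- move=> /= /andP[_ wf1] eD hD.
  have [D1 [T1 [d1 [E1 [eD1 sT1]]]]] := IH1 stk d D wf1 eD hD.
  rewrite foldl_cat E1 /= /run_step [(_, d1).1]/= [(_, d1).2]/=.
  have [||D' [eD' sT']] := @unary_sem (D ++ D1) d1 e1 (CwJoin i j e1) T1
    (key_join U1 (enc_nat i) (enc_nat j)) eD1 (starts_empty_cat _ hD) sT1.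
  + by [].
  + by move=> S; rewrite state_join.
  by exists (D1 ++ D'); do 2 eexists; split; first reflexivity; rewrite !catA.
Qed.

Lemma finish_correct e D d T :
  encodes D d -> table_sem D (lg_verts (cw_graph e)) (family e) T ->
  exists D', encodes D' (finish T d) /\
    idx_sem D' (size D').-1 (lg_verts (cw_graph e)) (\bigcup_(x <- T | accept x.1) family e x.1).
Proof.
move=> eD sT; have [uT iT _] := sT.
(* Generalised to duplicate-free lists of entries of [T], with the last node always holding the
   union so far. *)
suff H : forall l, uniq l -> {subset l <= T} ->
    exists D', encodes (D ++ D') (foldl fin_step (Cons Nil Nil :: d) l) /\
    idx_sem (D ++ D') (size (D ++ D')).-1 (lg_verts (cw_graph e))
      (\bigcup_(x <- l | accept x.1) family e x.1).
  have [//|D' [eD' sI]] := H T (map_uniq uT); by exists (D ++ D').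
elim/last_ind=> [|l x IHl] ul sub.
  exists [:: NEmpty]; rewrite cats1; split; first exact: (encodes_rcons (g := NEmpty) eD).
  rewrite size_rcons /= big_nil; apply: node_sem_rcons; split=> //=.
  by split=> //=; rewrite ?sub0set ?eqxx.
move: ul; rewrite rcons_uniq => /andP[xl ul].
have [//|y yl|D' [eD' sI]] := IHl.
  by apply: sub; rewrite mem_rcons inE yl orbT.
have xT : x \in T by apply: sub; rewrite mem_rcons mem_head.
rewrite foldl_rcons -cats1 big_cat big_cons big_nil /=.
move: (foldl _ _ _) eD' => d' eD'; rewrite /fin_step; case: ifP => _; last first.
  by exists D'; rewrite setU0.
have sU : node_sem (D ++ D') (NUnion x.2 (size (D ++ D')).-1) (lg_verts (cw_graph e))
   (family e x.1 :|: \bigcup_(y <- l | accept y.1) family e y.1).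
  apply: node_sem_union => //; first exact/idx_sem_cat/iT.
  rewrite -setI_eq0; apply/eqP/setP => f; rewrite !in_setI in_bigcup_seq in_set0.
  apply/negP => /andP[fx /hasP[y yl /andP[_ fy]]].
  have yT : y \in T by apply: sub; rewrite mem_rcons inE yl orbT.
  have ne : x != y by apply: contraNneq xl => ->.
  have := family_disjoint e (table_neq sT xT yT ne).
  by move/disjointFr/(_ fx); rewrite fy.
exists (rcons D' (NUnion x.2 (size (D ++ D')).-1)); rewrite -rcons_cat; split.
  rewrite (encodes_size eD').
  by apply: (encodes_rcons (g := NUnion x.2 (size (D ++ D')).-1)) => //; case: sU.
by rewrite size_rcons setU0 setUC /=; apply: node_sem_rcons.
Qed.

Lemma algorithm_correct (G : sgraph V) e :
  is_kexpr_of e G ->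
  exists D : seq (junode V bool), [/\ enc_dag D = enc_nodes (algorithm k (enc_cwexpr e)), dag_wf D
    & ju_sem (dag_expr D) =
        Some [set indicator S | S : {set V} & connected_dominating G S]].
Proof.
move=> kG; have [wf [l [labE adjE]]] := kG.
have eD : encodes [:: NEmpty : junode V bool] [:: Cons Nil Nil] by split.
have hD : starts_empty [:: NEmpty : junode V bool] by split.
have [D1 [T [d1 [E1 [eD1 sT]]]]] := run_correct [::] wf eD hD.
have [D [eD' [sz [sem _ _]]]] := finish_correct eD1 sT.
have lastE : dag_expr D = nth JUEmpty (dag_exprs D) (size D).-1.
  by rewrite /dag_expr -nth_last size_dag_exprs.
exists D; split.
- rewrite /algorithm /run postorderE E1 /=; case: eD' => -> _; rewrite revK.
  by rewrite /enc_dag /enc_nodes; elim: (D) => //= g D0 ->.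
- by apply/andP; split; [apply: leq_ltn_trans sz | case: eD'].
rewrite lastE sem; congr Some; apply/setP => f; rewrite in_bigcup_seq.
have verts : lg_verts (cw_graph e) = setT by apply/setP => v; rewrite !inE labE.
have [_ _ nT] := sT.
apply/hasP/imsetP => [[x xT /andP[acc]]|[S]].
  rewrite inE verts => /andP[/eqP dom /eqP E].
  exists (ones f); first by rewrite inE -(accept_connected_dominating _ kG) E.
  apply/ffunP => v; rewrite ffunE inE.
  by have /setP/(_ v) := dom; rewrite !inE; case: (f v) => // -[].
rewrite inE -(accept_connected_dominating _ kG) => acc ->.
have onesE : ones (indicator S) = S by apply/setP => v; rewrite !inE ffunE; case: (v \in S).
have domE : pdom (indicator S) = setT by apply/setP => v; rewrite !inE ffunE.
(* The family of this state contains the indicator of [S], so the state cannot be absent from the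
   table. *)
have : state_of (cw_graph e) S \in unzip1 T.
  by apply/negPn/negP => /nT /setP/(_ (indicator S)); rewrite !inE verts onesE domE !eqxx.
by case/mapP=> x xT E; exists x => //; rewrite -E acc inE verts domE onesE E !eqxx.
Qed.

End Run.

(** * Time bound *)

(** A unary number is doubled repeatedly. The result has size exponential in [n x], hence the
    hypothesis on the measure. *)
Lemma PT_exp2 X (P : X -> Prop) sz inp (n : X -> nat) :
  PT P sz inp (fun x => enc_nat (n x)) -> polyO P sz (fun x => 2 ^ n x) ->
  PT P sz inp (fun x => enc_nat (2 ^ n x)).
Proof.
move=> Hn Hp.
have foldE m (l : seq tree) : foldl (fun m _ => m + m) m l = m * 2 ^ size l.
  by elim: l m => [|a l IHl] m /=; rewrite ?muln1 // IHl expnS; lia.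
apply: (@PT_ext _ _ _ _ (fun x => enc_nat (foldl (fun m _ => m + m) 1 (nseq (n x) Nil)))).
  by move=> x _; rewrite foldE size_nseq mul1n.
apply: (@PT_foldl _ P sz inp _ _ id enc_nat (fun x => nseq (n x) Nil) (fun=> 1) (fun _ m _ => m + m)).
- by apply: PT_ext Hn => x _; rewrite enc_nat_seq.
- exact: PT_const.
- apply: (polyO_le_fst (P := P) (g := fun x => 2 * 2 ^ n x + 1)); last by poly.
  move=> x l1 [/= Px [l2 El]]; split=> //; rewrite foldE mul1n tree_size_enc_nat.
  have : 2 ^ size l1 <= 2 ^ n x.
    by rewrite leq_exp2l // -(size_nseq (n x) Nil) El size_cat leq_addr.
  lia.
- apply: PT_ext (PT_cat (encE := id) (l := fun y => nseq y.2.1 Nil) (m := fun y => nseq y.2.1 Nil) _ _).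
  + by move=> y _; rewrite cat_nseq /ncons -iterD -[iter _ _ _]/(ncons _ _ _) -/(nseq _ _) -enc_nat_seq.
  + by apply: PT_ext (PT_hd (PT_tl (@PT_id _ _ _ _))) => y _; rewrite -enc_nat_seq.
  + by apply: PT_ext (PT_hd (PT_tl (@PT_id _ _ _ _))) => y _; rewrite -enc_nat_seq.
Qed.

Lemma computable_PT (f sz : nat -> nat) :
  polyO (fun=> True) sz id -> PT (fun=> True) sz enc_nat (fun k => enc_nat (f k)) -> computable f.
Proof.
move=> Hid Hf; have [|_ [p [b [T [_ hp]]]]] := Hf.
  by apply: (polyO_le (h := fun k => 2 * k + 1)); [move=> k _; rewrite tree_size_enc_nat; lia | poly].
exists p => k; have [s [t [ex o _ _]]] := hp k (init_store (enc_nat k)) I erefl.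
by exists (t + tree_size (enc_nat (f k))), s, t.
Qed.

(** With the final value itself as measure, every intermediate exponential is trivially bounded. *)
Lemma computable_tower C : computable (fun k => 2 ^ 2 ^ 2 ^ (C + k)).
Proof.
have HC s : PT (fun=> True) s enc_nat (fun k => enc_nat (C + k)).
  by elim: C => [|C IHC]; [exact: PT_id | exact: PT_cons (@PT_nil _ _ _ _) IHC].
pose sz k := 2 ^ 2 ^ 2 ^ (C + k).
have le_exp m : m <= 2 ^ m by apply/ltnW/ltn_expl.
have H (g : nat -> nat) : (forall k, g k <= sz k) -> polyO (fun=> True) sz g.
  by move=> le_g; apply: polyO_le (polyO_sz _ _) => k _.
have l2 k : 2 ^ 2 ^ (C + k) <= sz k by apply: le_exp.
have l1 k : 2 ^ (C + k) <= sz k by apply: leq_trans (le_exp _) (l2 k).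
have l0 k : C + k <= sz k by apply: leq_trans (le_exp _) (l1 k).
apply: (@computable_PT _ sz).
  by apply: H => k; apply: leq_trans (l0 k); apply: leq_addl.
apply: PT_exp2; last exact: H.
apply: PT_exp2; last exact: H.
apply: PT_exp2; last exact: H.
exact: HC.
Qed.

(** Once [N ^ c] is split off, the remaining factor is at most 2 to the power
    [c + (2 ^ (3 * k)).+1 * c], and this exponent is at most [2 ^ (c + 2 + 3 * k)]. *)
Lemma exp_le_tower c k N : 0 < N ->
  c * (N * 2 ^ 2 ^ (3 * k)).+1 ^ c <= 2 ^ 2 ^ 2 ^ (c + 3 + k) * N ^ c.
Proof.
move=> N_gt0; set M := 2 ^ 2 ^ (3 * k).
have NM_gt0 : 0 < N * M by rewrite muln_gt0 N_gt0 expn_gt0.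
(* [N * M] is positive, so the successor costs at most a factor 2. *)
have le1 : (N * M).+1 <= N * (2 * M) by rewrite mulnCA mul2n -addnn; lia.
have le2 : (N * M).+1 ^ c <= (N * (2 * M)) ^ c by case: (c) => // c'; rewrite leq_exp2r.
apply: leq_trans (leq_mul (leqnn c) le2) _.
rewrite expnMn mulnCA mulnC leq_mul2r; apply/orP; right.
have c_le : c <= 2 ^ c by apply/ltnW/ltn_expl.
apply: leq_trans (leq_mul c_le (leqnn _)) _.
rewrite /M -expnS -expnM -expnD leq_exp2l //.
have e_gt0 : 0 < 2 ^ (3 * k) by rewrite expn_gt0.
apply: (@leq_trans (2 ^ c * (4 * 2 ^ (3 * k)))).
  have := leq_mul c_le e_gt0; have := leq_mul c_le (leqnn (2 ^ (3 * k))).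
  move: e_gt0 c_le; move: (2 ^ (3 * k)) (2 ^ c) => a b; nia.
rewrite -[4]/(2 ^ 2) -!expnD leq_exp2l //.
have h x : x.+1 <= 2 ^ x by apply: ltn_expl.
(* The shift by 3 makes this product large enough to bound [c + 2 + 3 * k]; its factors are at most
   [2 ^ (c + 3)] and [2 ^ k]. *)
apply: leq_trans (_ : (c + 3).+1 * k.+1 <= _); first by nia.
by rewrite expnD; apply: leq_mul.
Qed.

Theorem theorem7 :
  exists f : nat -> nat, computable f /\
  exists (algo : wcmd) (c : nat),
    forall (n : nat) (G : sgraph 'I_n) (k : nat) (e : cwexpr 'I_n k),
      clique_width G k -> is_kexpr_of e G ->
      exists (D : seq (junode 'I_n bool)) (time : nat),
        [/\ computes_in algo (enc_input G e) (enc_dag D) time,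
            time <= f k * tree_size (enc_input G e) ^ c,
            dag_wf D
          & ju_sem (dag_expr D) =
              Some [set indicator S | S : {set 'I_n} & connected_dominating G S]].
Proof.
(* Arbitrary trees take the place of the encoded graph and expression; only [k] has to be a number,
   as the measure depends on it. *)
pose inp (x : tree * (nat * tree)) := Cons x.1 (Cons (enc_nat x.2.1) x.2.2).
pose sz x := tree_size (inp x) * 2 ^ 2 ^ (3 * x.2.1).
have szP : polyO (fun=> True) sz sz by exact: polyO_sz.
have sz_inp : polyO (fun=> True) sz (fun x => tree_size (inp x)).
  by apply: polyO_le szP => x _; rewrite leq_pmulr // expn_gt0.
have sz_exp : polyO (fun=> True) sz (fun x => 2 ^ 2 ^ (3 * x.2.1)).
  by apply: polyO_le szP => x _; rewrite leq_pmull // tree_size_gt0.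
have [||szo [p [b [T [hT hp]]]]] := @PT_algorithm _ _ sz inp (fun x => x.2.1) (fun x => x.2.2)
  _ _ sz_exp sz_inp; [by pt_solve 4 | by pt_solve 4 | ].
(* One constant bounds running time plus output size; it becomes both the degree in the input size
   and the shift of the tower. *)
have [c hc] := polyO_add hT szo.
exists (fun k => 2 ^ 2 ^ 2 ^ (c + 3 + k)); split; first exact: computable_tower.
exists p, c => n G k e _ kG.
have [D [eD wD sD]] := algorithm_correct kG.
pose x : tree * (nat * tree) := (enc_graph G, (k, enc_cwexpr e)).
have [s [t [ex o _ le_t]]] := hp x (init_store (inp x)) I erefl.
exists D, (t + tree_size (enc_dag D)); split=> //.
  by exists s, t; split=> //; rewrite o eD.
rewrite eD; apply: leq_trans (leq_trans _ (hc x I)) (exp_le_tower _ _ (tree_size_gt0 _)).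
by rewrite leq_add2r.
Qed.
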